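(* Suppose conditions (B1), (B2), (B3), (B5) listed in the context hold, $\kappa=0$, $K[\ln(n)]^2/n\to0$, and $\gamma_0$ is Holder of order $s_\gamma$. Suppose that one of the following holds: (i) $\hat\beta$ is the expected conditional covariance estimator, $E[a_i\mid x_i=x]$ is Holder of order $s_\alpha$, and $E[a_i^2\mid x_i]$ is bounded; (ii) $\hat\beta$ is the missing data mean estimator, and $\pi_0(w_i)=\Pr(a_i=1\mid w_i)$ is bounded away from zero and is Holder of order $s_\alpha$; (iii) $\hat\beta$ is the average derivative estimator, $\omega(x)$ and $f_0(x)$ are Holder of order $s_\alpha$, and $f_0(x)$ is bounded away from zero on the set where $\omega(x)>0$. Then $$\sqrt n(\hat\beta-\beta_0)=\frac1{\sqrt n}\sum_{i=1}^n\psi(z_i)+O_p\left(\bar\Delta_n^*+K^{-\zeta_\gamma}\ln(n)\right).$$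
   Context: Data $z_1,\dots,z_n$ are i.i.d. with distribution $F_0$; $y_i$ is a scalar component and $x_i$ a subvector of $z_i$; $\gamma_0(x)=E[y_i\mid x_i=x]$. All limits are as $n\to\infty$; $K=K_n$; $C>0$ is a generic constant. In each example $\beta_0=E[m(z_i,\gamma_0)]$, and $\psi(z)=m(z,\gamma_0)-\beta_0+\alpha_0(x)[y-\gamma_0(x)]$. $I_1,\dots,I_L$ is a partition of $\{1,\dots,n\}$ with $L\geq2$ fixed, $\hat I_\ell=\{1,\dots,n\}\setminus I_\ell$, $\bar n_\ell=|I_\ell|$, $\hat n_\ell=|\hat I_\ell|$; $A^-$ is any generalized inverse. With a $K\times1$ vector $p(x)$, $\hat\gamma_\ell(x)=p(x)^T\hat\Sigma_\ell^-\hat h_\ell$, where $\hat\Sigma_\ell=\hat n_\ell^{-1}\sum_{i\in\hat I_\ell}p(x_i)p(x_i)^T$, $\hat h_\ell=\hat n_\ell^{-1}\sum_{i\in\hat I_\ell}p(x_i)y_i$. The three examples: - Expected conditional covariance: $z=(y,a,x)$, $a$ scalar, $m(z,\gamma)=a[y-\gamma(x)]$, $\beta_0=E[Cov(a_i,y_i\mid x_i)]$, $\alpha_0(x)=-E[a_i\mid x_i=x]$, $\hat\beta=\frac1n\sum_\ell\sum_{i\in I_\ell}a_i[y_i-\hat\gamma_\ell(x_i)]$. Here $w=x$ and $p(x)=q(x)$. - Missing data mean: $\beta_0=E[Y_i]$, where $a_i\in\{0,1\}$ indicates whether $Y_i$ is observed, $y_i=a_iY_i$, covariates $w_i$ are such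 that $E[Y_i\mid a_i=1,w_i]=E[Y_i\mid w_i]$, $x=(a,w)$, $m(z,\gamma)=\gamma(1,w)$, $\alpha_0(x)=a/\pi_0(w)$, $p(x)=aq(w)$, and $\hat\beta=\frac1n\sum_\ell\sum_{i\in I_\ell}q(w_i)^T\hat\delta_\ell$ with $\hat\delta_\ell=[\sum_{i\in\hat I_\ell}a_iq(w_i)q(w_i)^T]^-\sum_{i\in\hat I_\ell}a_iq(w_i)y_i$. Holder smoothness of $\gamma_0$ refers to $\gamma_0(1,w)=E[y_i\mid a_i=1,w_i=w]$ as a function of $w$. - Average derivative: $\beta_0=\int v(x)[\partial\gamma_0(x)/\partial x_1]dx$ for a weight function $v$ with $\int v(x)dx=1$, $v$ zero at the boundary, $x_1$ continuously distributed; $\omega(x)=-\partial v(x)/\partial x_1$, $m(z,\gamma)=\int\omega(x)\gamma(x)dx$, $f_0$ is the pdf of $x_i$, $\alpha_0(x)=\omega(x)/f_0(x)$. Here $w=x$, $p(x)=q(x)$, and the estimator uses all the data: $\hat\beta=\left(\int\omega(x)p(x)dx\right)^T[\sum_{i=1}^np(x_i)p(x_i)^T]^-\sum_{i=1}^np(x_i)y_i$. (B1) $E[\alpha_0(x_i)^2]<\infty$ and $E[m(z_i,\gamma)-m(z_i,0)]=E[\alpha_0(x_i)\gamma(x_i)]$ for all $\gamma$ with $E[\gamma(x_i)^2]<\infty$. (B2) $\bar n_\ell+\hat n_\ell=n$, $\min_\ell\{\bar n_\ell,\hat n_\ell\}\ge Cn$; the groups $I_\ell$ are as close as possible to being of equal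 size. (B3) (i) The support of $w_i$ is $[0,1]^r$ and $w_i$ is continuously distributed with pdf bounded and bounded away from zero; (ii) $q(w)$ consists of tensor product b-splines of order $\kappa$ ($\kappa=0$ is the Haar basis of piecewise constant functions) with approximately evenly spaced knots; (iii) $q$ is normalized so that $\lambda_{\min}(E[q(w_i)q(w_i)^T])\ge C>0$ and $\sup_{w\in[0,1]^r}\|q(w)\|\le C\sqrt K$; (iv) when $p(x)=aq(w)$ (missing data), $a_i$ is bounded and $E[a_i^2\mid w_i]$ is bounded away from zero. (B5) $Var(y_i\mid x_i)\le C$, $K\to\infty$, and $K\ln(K)/n\to0$. Holder: $g$ is Holder of order $s$ if it is continuously differentiable of order $\bar s=\mathrm{int}[s]$ and each of its order-$\bar s$ partial derivatives satisfies $|\nabla^{\bar s}g(\tilde x)-\nabla^{\bar s}g(x)|\le C\|\tilde x-x\|^{s-\bar s}$. Remainder: $\zeta_\gamma=\min\{1+\kappa,s_\gamma\}/r$, $\zeta_\alpha=\min\{1+\kappa,s_\alpha\}/r$, $\bar\Delta_n^*=\sqrt nK^{-\zeta_\gamma-\zeta_\alpha}+K^{-\zeta_\gamma}+K^{-\zeta_\alpha}+\sqrt{K/n}$. *)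

(* Defs.v *)
From HB Require Import structures.
From mathcomp Require Import all_boot all_order all_algebra finmap.
From mathcomp Require Import all_classical all_reals all_analysis.

Set Implicit Arguments.
Unset Strict Implicit.
Unset Printing Implicit Defensive.
Import Order.TTheory GRing.Theory Num.Theory.
Import numFieldNormedType.Exports.
Local Open Scope classical_set_scope.
Local Open Scope ring_scope.

(* R^n is represented by [n.-tuple R], which carries the product sigma-algebra. *)
Section cons_lebesgue.
Local Open Scope ereal_scope.
Context (R : realType) (n : nat).
Variable mu : {sigma_finite_measure set (n.-tuple R) -> \bar R}.

Let leb : {sigma_finite_measure set (measurableTypeR R) -> \bar R} :=
  @lebesgue_measure R.

Let consT (u : measurableTypeR R * n.-tuple R) : n.+1.-tuple R :=
  [tuple of u.1 :: u.2].

Definition cons_lebesgue : set (n.+1.-tuple R) -> \bar R :=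
  pushforward (leb \x mu) consT.

Let measurable_preimage_consT B : measurable B -> measurable (consT @^-1` B).
Proof.
move=> mB; rewrite -[X in measurable X]setTI.
by apply: (measurable_cons measurable_fst measurable_snd).
Qed.

Let cons0 : cons_lebesgue set0 = 0.
Proof. by rewrite /cons_lebesgue /pushforward preimage_set0 measure0. Qed.

Let cons_ge0 A : 0 <= cons_lebesgue A.
Proof. by rewrite /cons_lebesgue /pushforward; exact: measure_ge0. Qed.

Let cons_sigma_additive : semi_sigma_additive cons_lebesgue.
Proof.
move=> F mF /trivIsetP tF mUF; rewrite /cons_lebesgue /pushforward preimage_bigcup.
apply: measure_semi_sigma_additive.
- by move=> k; exact: measurable_preimage_consT.
- by apply/trivIsetP => i j _ _ ij; rewrite -preimage_setI tF// preimage_set0.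
- by rewrite -preimage_bigcup; exact: measurable_preimage_consT.
Qed.

HB.instance Definition _ := isMeasure.Build _ _ _ cons_lebesgue
  cons0 cons_ge0 cons_sigma_additive.

Let cons_sigma_finite : sigma_finite setT cons_lebesgue.
Proof.
have /sigma_finiteP[F [TF ndF Foo]] := sigma_finiteT leb.
have /sigma_finiteP[G [TG ndG Goo]] := sigma_finiteT mu.
pose H k : set (n.+1.-tuple R) :=
  (@thead n R) @^-1` F k `&` (fun t : n.+1.-tuple R => [tuple of behead t]) @^-1` G k.
exists H => [|k].
  apply/esym; rewrite -subTset => t _.
  have [i _ Fi] : (\bigcup_i F i) (thead t) by rewrite -TF.
  have [j _ Gj] : (\bigcup_i G i) [tuple of behead t] by rewrite -TG.
  exists (maxn i j) => //; split.
  - by apply: (subsetPset _ _ (ndF _ _ (leq_maxl i j))).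
  - by apply: (subsetPset _ _ (ndG _ _ (leq_maxr i j))).
have [mF Fk] := Foo k; have [mG Gk] := Goo k; split.
  apply: measurableI; rewrite -[X in measurable X]setTI.
  - exact: (measurable_tnth ord0).
  - exact: measurable_behead.
rewrite /cons_lebesgue /pushforward (_ : _ @^-1` _ = F k `*` G k).
  by rewrite product_measure1E// lte_mul_pinfty// ge0_fin_numE.
apply/seteqP; split => -[x t]; rewrite /H /consT /= theadE => -[Fx Gt]; split => //=.
  by move: Gt; congr (G k _); exact/val_inj.
by move: Gt; congr (G k _); exact/val_inj.
Qed.

HB.instance Definition _ :=
  Measure_isSigmaFinite.Build _ _ _ cons_lebesgue cons_sigma_finite.

End cons_lebesgue.

Fixpoint lebesgue_tuple (R : realType) (n : nat) :
    {sigma_finite_measure set (n.-tuple R) -> \bar R} :=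
  match n with
  | 0 => \d_([tuple] : 0.-tuple R)
  | n'.+1 => cons_lebesgue (lebesgue_tuple R n')
  end.


Section cube.
Context (R : realType) (r : nat).
Implicit Types (x y : r.-tuple R) (g : r.-tuple R -> R).

Definition cube : set (r.-tuple R) := [set x | forall i, 0 <= tnth x i <= 1].

Definition open_cube : set (r.-tuple R) := [set x | forall i, 0 < tnth x i < 1].

Definition edist x y : R := Num.sqrt (\sum_(i < r) (tnth x i - tnth y i) ^+ 2).

Definition cube_continuous g := forall x, cube x ->
  forall e : R, 0 < e -> exists2 del : R, 0 < del &
    forall y, cube y -> edist x y < del -> `|g x - g y| < e.

Definition replace_coord x (j : 'I_r) (h : R) : r.-tuple R :=
  [tuple if i == j then h else tnth x i | i < r].

Definition has_partial (j : 'I_r) g (dg : r.-tuple R -> R) := forall x,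
  open_cube x ->
  is_derive (tnth x j) 1 (fun h : R => g (replace_coord x j h)) (dg x).

(* Partial derivatives live in the open cube and are required to extend
   continuously to the closed one. With k = 0 and exponent t = 0 the Hoelder
   inequality only bounds the oscillation of g, whence the separate continuity
   clause. *)
Fixpoint holder_rec (k : nat) (t : R) g : Prop :=
  cube_continuous g /\
  match k with
  | 0 => exists C : R, forall x y, cube x -> cube y ->
           `|g y - g x| <= C * edist y x `^ t
  | k'.+1 => forall j, exists2 dg, has_partial j g dg & holder_rec k' t dg
  end.

Definition holder (s : R) g : Prop :=
  0 < s /\ holder_rec (Num.truncn s) (s - (Num.truncn s)%:R) g.

End cube.

Section probability_notions.
Context (R : realType).

Definition iid d d' (Omega : measurableType d) (Z : measurableType d')
    (P : probability Omega R) (F0 : probability Z R)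
    (z : nat -> {RV P >-> Z}) : Prop :=
  (forall i A, measurable A -> P (z i @^-1` A) = F0 A) /\
  (forall (J : {fset nat}) (A : nat -> set Z),
     (forall i, measurable (A i)) ->
     P (\bigcap_(i in [set` J]) (z i @^-1` A i)) =
     (\prod_(i <- J) P (z i @^-1` A i))%E).

Context d d' (T : measurableType d) (X : measurableType d').
Variables (P : probability T R) (x : T -> X).

(* g is a version of the regression function E[Y | x = .] *)
Definition cond_exp (Y : T -> R) (g : X -> R) : Prop :=
  [/\ measurable_fun setT g,
      P.-integrable setT (EFin \o Y),
      P.-integrable setT (EFin \o (g \o x)) &
      forall B, measurable B ->
        (\int[P]_(t in x @^-1` B) (Y t)%:E =
         \int[P]_(t in x @^-1` B) (g (x t))%:E)%E].

Definition cond_exp_bounded (Y : T -> R) : Prop :=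
  exists g C, cond_exp Y g /\ forall u, `|g u| <= C.

Definition cond_exp_bounded_away0 (Y : T -> R) : Prop :=
  exists g c, [/\ cond_exp Y g, 0 < c & forall u, c <= g u].

End probability_notions.

(* V n = O_p(a n). The event {|V n| > M a n} is covered by a measurable event of
   small probability (outer probability), because an estimator built from an
   arbitrary choice of generalized inverse need not be measurable. *)
Definition bigO_p (R : realType) d (Omega : measurableType d)
    (P : probability Omega R) (V : nat -> Omega -> R) (a : nat -> R) : Prop :=
  forall e : R, 0 < e -> exists M : R, \forall n \near \oo,
    exists A : set Omega, [/\ measurable A,
      [set o | M * a n < `|V n o|] `<=` A & (P A <= e%:E)%E].

(* z = ((y, a), w) *)
Notation obs R r := (R * R * r.-tuple R)%type.

Section data.
Context (R : realType) (r : nat).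
Implicit Types z : obs R r.

Definition obs_y z : R := z.1.1.
Definition obs_a z : R := z.1.2.
Definition obs_w z : r.-tuple R := z.2.
Definition obs_aw z : R * r.-tuple R := (obs_a z, obs_w z).

(* The density of w is taken with respect to Lebesgue measure on the cube; being
   bounded away from zero there, it makes the cube the support of w. *)
Definition cube_density (F0 : probability (obs R r) R) (f0 : r.-tuple R -> R) : Prop :=
  [/\ measurable_fun setT f0,
      forall A : set (r.-tuple R), measurable A ->
        F0 (@obs_w @^-1` A) =
        (\int[lebesgue_tuple R r]_(x in A `&` @cube R r) (f0 x)%:E)%E &
      exists c C : R, 0 < c /\ forall x, cube x -> c <= f0 x <= C].

End data.

Section bsplines.
Context (R : realType).

(* Cox-de Boor recursion for the knots t; x / 0 = 0 handles repeated knots. The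
   knot interval ending at 1 is closed, so that the splines cover the point 1. *)
Fixpoint bspline (t : nat -> R) (k j : nat) (x : R) : R :=
  match k with
  | 0 => (if x == 1 then (t j < 1) && (t j.+1 == 1) else t j <= x < t j.+1)%:R
  | k'.+1 =>
      (x - t j) / (t (j + k)%N - t j) * bspline t k' j x +
      (t (j + k).+1 - x) / (t (j + k).+1 - t j.+1) * bspline t k' j.+1 x
  end.

Context (r : nat).

(* In coordinate i and at sample size n there are [m n i] knot intervals in
   [0, 1], delimited by the knots number kappa, ..., kappa + m n i of [t n i]; the
   other knots are the auxiliary boundary knots. [idx n] enumerates the tensor
   products, [sc n] holds the scale factors of the normalization. Approximately
   evenly spaced knots: all knot intervals, in all coordinates, have length of
   exact order K ^ (-1 / r). *)
Definition tensor_bsplines (kappa : nat) (K : nat -> nat)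
    (q : forall n, r.-tuple R -> 'cV[R]_(K n)) : Prop :=
  exists (m : nat -> 'I_r -> nat) (t : nat -> 'I_r -> nat -> R)
         (idx : forall n, 'I_(K n) -> {ffun 'I_r -> nat})
         (sc : forall n, 'I_(K n) -> R) (c C : R),
  0 < c /\ forall n,
  [/\ forall i, [/\ (0 < m n i)%N, t n i kappa = 0,
         t n i (kappa + m n i)%N = 1 & {homo t n i : j l / (j <= l)%N >-> j <= l}],
      forall i j, (kappa <= j < kappa + m n i)%N ->
        c * (K n)%:R `^ (- r%:R^-1) <= t n i j.+1 - t n i j
          <= C * (K n)%:R `^ (- r%:R^-1),
      injective (idx n),
      forall f : {ffun 'I_r -> nat},
        (forall i, (f i < m n i + kappa)%N) <-> exists k, idx n k = f &
      forall w k, q n w k 0 =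
        sc n k * \prod_(i < r) bspline (t n i) kappa (idx n k i) (tnth w i)].

Definition enorm (k : nat) (u : 'cV[R]_k) : R :=
  Num.sqrt (\sum_(i < k) u i 0 ^+ 2).

Definition lambda_min (k : nat) (A : 'M[R]_k) : R :=
  inf [set l : R | eigenvalue A l].

Definition second_moment (F0 : probability (obs R r) R) (k : nat)
    (q : r.-tuple R -> 'cV[R]_k) : 'M[R]_k :=
  \matrix_(i, j) fine 'E_F0[fun z => (q (obs_w z) i 0 * q (obs_w z) j 0)%R]%E.

Definition normalized_basis (F0 : probability (obs R r) R) (K : nat -> nat)
    (q : forall n, r.-tuple R -> 'cV[R]_(K n)) : Prop :=
  exists c C : R, 0 < c /\ forall n,
    c <= lambda_min (second_moment F0 (q n)) /\
    forall w, cube w -> enorm (q n w) <= C * Num.sqrt (K n)%:R.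

End bsplines.

(* [I n l] is the l-th group of observations, ~: [I n l] its complement. *)
Definition balanced_partition (R : realType) (L : nat) (I : forall n, 'I_L -> {set 'I_n}) : Prop :=
  [/\ forall n l l', l != l' -> I n l :&: I n l' = finset.set0,
      forall n, (\bigcup_l I n l)%SET = [set: 'I_n]%SET,
      (exists2 C : R, 0 < C & \forall n \near \oo, forall l,
         C * n%:R <= #|I n l|%:R /\ C * n%:R <= #|~: I n l|%:R) &
      forall n l l', (#|I n l| <= #|I n l'|.+1)%N].

Definition is_ginv (R : realType) (ginv : forall k, 'M[R]_k -> 'M[R]_k) : Prop :=
  forall k (A : 'M[R]_k), A *m ginv k A *m A = A.

Section estimators.
Context (R : realType) (r : nat) (ginv : forall k, 'M[R]_k -> 'M[R]_k).
Context (n L : nat) (I : 'I_L -> {set 'I_n}) (z : 'I_n -> obs R r).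

Section series.
Context (X : Type) (x : obs R r -> X) (K : nat) (p : X -> 'cV[R]_K).

Definition gram (S : {set 'I_n}) : 'M[R]_K :=
  \sum_(i in S) p (x (z i)) *m (p (x (z i)))^T.

Definition cross (S : {set 'I_n}) : 'cV[R]_K :=
  \sum_(i in S) obs_y (z i) *: p (x (z i)).

Definition gamma_hat (l : 'I_L) (u : X) : R :=
  let nl : R := #|~: I l|%:R in
  ((p u)^T *m ginv (nl^-1 *: gram (~: I l)) *m (nl^-1 *: cross (~: I l))) 0 0.

End series.

Context (K : nat) (q : r.-tuple R -> 'cV[R]_K).

Definition beta_hat_cov : R :=
  n%:R^-1 * \sum_(l < L) \sum_(i in I l)
    obs_a (z i) * (obs_y (z i) - gamma_hat (@obs_w R r) q l (obs_w (z i))).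

Definition delta_hat (l : 'I_L) : 'cV[R]_K :=
  ginv (\sum_(i in ~: I l) obs_a (z i) *: (q (obs_w (z i)) *m (q (obs_w (z i)))^T))
  *m \sum_(i in ~: I l) (obs_a (z i) * obs_y (z i)) *: q (obs_w (z i)).

Definition beta_hat_missing : R :=
  n%:R^-1 * \sum_(l < L) \sum_(i in I l) ((q (obs_w (z i)))^T *m delta_hat l) 0 0.

Definition beta_hat_deriv (omega : r.-tuple R -> R) : R :=
  ((\col_k \int[lebesgue_tuple R r]_(x in @cube R r) (omega x * q x k 0))^T
   *m ginv (gram (@obs_w R r) q [set: 'I_n]%SET)
   *m cross (@obs_w R r) q [set: 'I_n]%SET) 0 0.

End estimators.

Section expansion.
Context (R : realType) (r : nat) (F0 : probability (obs R r) R).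

Section model.
Context d (X : measurableType d) (x : obs R r -> X).
Context (m : obs R r -> (X -> R) -> R) (alpha0 : X -> R).

Definition riesz_representer : Prop :=
  F0.-integrable setT (EFin \o (fun z => alpha0 (x z) ^+ 2)) /\
  forall g : X -> R, measurable_fun setT g ->
    F0.-integrable setT (EFin \o (fun z => g (x z) ^+ 2)) ->
    ('E_F0[fun z => (m z g - m z (cst 0))%R] =
     'E_F0[fun z => (alpha0 (x z) * g (x z))%R])%E.

Definition influence (gamma0 : X -> R) (beta0 : R) (z : obs R r) : R :=
  m z gamma0 - beta0 + alpha0 (x z) * (obs_y z - gamma0 (x z)).

End model.

Definition m_cov (z : obs R r) (g : r.-tuple R -> R) : R :=
  obs_a z * (obs_y z - g (obs_w z)).

Definition m_missing (z : obs R r) (g : R * r.-tuple R -> R) : R :=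
  g (1, obs_w z).

Definition m_deriv (omega : r.-tuple R -> R) (z : obs R r)
    (g : r.-tuple R -> R) : R :=
  \int[lebesgue_tuple R r]_(x in @cube R r) (omega x * g x).

Definition zeta (kappa : nat) (s : R) : R :=
  Num.min (1 + kappa)%:R s / r%:R.

Definition Delta_star (kappa : nat) (s_gamma s_alpha : R) (K : nat -> nat)
    (n : nat) : R :=
  let k : R := (K n)%:R in
  Num.sqrt n%:R * k `^ (- zeta kappa s_gamma - zeta kappa s_alpha) +
  k `^ (- zeta kappa s_gamma) + k `^ (- zeta kappa s_alpha) +
  Num.sqrt (k / n%:R).

Definition expansion d (Omega : measurableType d) (P : probability Omega R)
    (z : nat -> {RV P >-> obs R r}) (beta_hat : forall n, ('I_n -> obs R r) -> R)
    (beta0 : R) (psi : obs R r -> R) (rate : nat -> R) : Prop :=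
  bigO_p P
    (fun n o =>
       Num.sqrt n%:R * (beta_hat n (fun i => z i o) - beta0) -
       (Num.sqrt n%:R)^-1 * \sum_(i < n) psi (z i o))
    rate.

End expansion.

(* Main.v *)
Require Import Defs.
From HB Require Import structures.
From mathcomp Require Import all_boot all_order all_algebra finmap.
From mathcomp Require Import all_classical all_reals all_analysis.
From mathcomp Require Import measurable_realfun lebesgue_integral ring lra.

Set Implicit Arguments.
Unset Strict Implicit.
Unset Printing Implicit Defensive.
Import Order.TTheory GRing.Theory Num.Theory.
Import numFieldNormedType.Exports.
Local Open Scope classical_set_scope.
Local Open Scope ring_scope.

(** For splines of order zero the series regression is a regressogram: the cube is cut
   into K cells, and on each cell the estimate is the average of y over the
   observations found there. The Gram matrix is diagonal, and once every cell contains
   an observation its generalized inverse is its inverse (regressogram).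

   This gives the three estimators a common form. Let s select the observations that
   enter the regression, let h be the multiplier of the regression function in the
   moment condition, and let alp be the function of the covariates with
   E[h g(w)] = E[alp(w) s g(w)] for all g. The multiplier is - a in the covariance
   example, 1 for the missing data mean and alp for the average derivative. Write
   gam_dev, alp_dev, h_dev for the deviations of gamma_0, alp, h from their averages
   over a cell and eps for the regression error; noise stands for s times the deviation
   of y from the cell average of gamma_0. Then n times the estimation error minus
   the sum of the influence function is, fold by fold, the sum of five pieces:
   - in each cell, the sum of h_dev over the fold times the average of the noise
     outside the fold;
   - in each cell, the average of the noise outside the fold times a weighted
     difference of two counts;
   - the sum of gam_dev (alp s - h);
   - minus the sum of gam_dev alp_dev s;
   - minus the sum of alp_dev eps.
   In the first two pieces the terms of different cells are orthogonal given the cells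
   of all observations, and each of the K terms has a bounded second moment. This is
   where cross-fitting pays: it makes the two factors of the first piece independent,
   and the order is sqrt K. The third and the fifth piece are sums of n centred
   variables of order K^(- zeta_gamma) and K^(- zeta_alpha), by the Riesz identity and
   because eps is orthogonal to functions of the covariates; the fourth is at most n
   times the product of the two. Divided by sqrt n these are the four terms of the
   rate. See crossfit_remainder_moment, and plugin_remainder_moment for the average
   derivative, where all observations are used at once and there is no noise in h.

   Conditioning on the cells needs no conditional distributions: as the cells of the
   sample take finitely many values, everything follows from the formula E[prod f_i(z_i)] = prod E[f_i]
   (iid_prod, E_orth_sum).

   The second moments are taken on the event that every cell holds at least a quarter
   of the expected number of observations. The normalization of the basis gives each
   cell a probability of at least a multiple of 1 / K (cell_probability), so that by a
   Chernoff bound (tally_lower_tail) and K ln K / n -> 0 (empty_cell_rate) this event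
   has probability tending to one. Bounded second moments on such an event imply O_p
   (bigO_p_of_moment). Finally cells have diameter of order K^(- 1 / r), and a function
   that is Hoelder of order s oscillates on them by a multiple of K^(- min(1, s) / r)
   (holder_oscillation). *)

(** * Expectations of products over an i.i.d. sample *)

Section product_formula.
Context (R : realType) d d' (T : measurableType d) (Z : measurableType d').
Variables (P : probability T R) (F : probability Z R).
Import HBNNSimple.

(** Here c F is the law of X under the density G, known on sets; approximation by
   simple functions carries the identity over to integrands. *)
Lemma reweighted_integral (G : T -> R) (X : T -> Z) (c : R) (f : Z -> R) :
  measurable_fun setT G -> measurable_fun setT X ->
  (forall t, 0 <= G t) -> 0 <= c ->
  (forall A, measurable A ->
     (\int[P]_t (G t * \1_A (X t))%:E = c%:E * F A)%E) ->
  measurable_fun setT f -> (forall u, 0 <= f u) ->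
  (\int[P]_t (G t * f (X t))%:E = c%:E * \int[F]_u (f u)%:E)%E.
Proof.
move=> mG mX G0 c0 GA mf f0.
have mfE : measurable_fun setT (fun u => (f u)%:E) by exact/measurable_EFinP.
pose f_ := nnsfun_approx measurableT mfE.
have f0E u : setT u -> (0 <= (f u)%:E)%E by move=> _; rewrite lee_fin.
have mfX n : measurable_fun setT (fun t => f_ n (X t)).
  exact: measurableT_comp.
have f_0 n u : 0 <= f_ n u by [].
have cvgf u : (f_ n u)%:E @[n --> \oo] --> (f u)%:E.
  exact: (@cvg_nnsfun_approx _ _ _ _ measurableT _ mfE f0E u).
have ndf u : {homo (fun n => f_ n u) : m n / (m <= n)%N >-> m <= n}.
  by move=> m n mn; exact/lefP/nd_nnsfun_approx.
have simple n : (\int[P]_t (G t * f_ n (X t))%:E = c%:E * \int[F]_u (f_ n u)%:E)%E.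
  pose A r : set Z := f_ n @^-1` [set r].
  have mA r : measurable (A r) by exact: measurable_funPTI.
  have A0 r : (r < 0)%R -> A r = set0 by move=> r0; exact: preimage_nnfun0.
  have mGA r : measurable_fun setT (fun t => G t * (r * \1_(A r) (X t))).
    apply: measurable_funM => //; apply: measurable_funM => //.
    exact: measurableT_comp.
  have GA0 r t : 0 <= r * \1_(A r) (X t).
    have [r0|r0] := ltP r 0; first by rewrite A0// indic0 mulr0.
    by rewrite mulr_ge0.
  under [in LHS]eq_integral => t _.
    rewrite (_ : (_ * _)%:E =
      \sum_(r \in range (f_ n)) (G t * (r * \1_(A r) (X t)))%:E)%E; last first.
      by rewrite fsumEFin// -mulr_fsumr {1}fimfunE.
    over.
  rewrite ge0_integral_fsum//; last 2 first.
  - by move=> r; apply/measurable_EFinP.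
  - by move=> r t _; rewrite lee_fin mulr_ge0.
  under [in RHS]eq_integral => u _ do rewrite fimfunE -fsumEFin//.
  rewrite ge0_integral_fsum//; last 2 first.
  - by move=> r; apply/measurable_EFinP; exact: measurable_funM.
  - by move=> r u _; rewrite EFinM; exact: nnfun_muleindic_ge0.
  rewrite ge0_mule_fsumr; last first.
    move=> r; apply: integral_ge0 => u _; rewrite EFinM; exact: nnfun_muleindic_ge0.
  apply: eq_fsbigr => r _.
  rewrite integralZl_indic_nnsfun//.
  rewrite (_ : (\int[F]_x (\1_(f_ n @^-1` [set r]) x)%:E)%E = F (A r)); last first.
    by rewrite -[in RHS](setIT (A r)) -integral_indic.
  have [r0|r0] := ltP r 0.
    rewrite A0// measure0 !mule0; apply: integral0_eq => t _.
    by rewrite indic0 !mulr0.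
  under eq_integral => t _.
    rewrite mulrCA EFinM; over.
  rewrite ge0_integralZl//=; last 2 first.
  - apply/measurable_EFinP; apply: measurable_funM => //.
    exact: measurableT_comp.
  - by move=> t _; rewrite lee_fin mulr_ge0.
  by rewrite GA// muleCA.
have lhs : (\int[P]_t (G t * f_ n (X t))%:E)%E @[n --> \oo] -->
    (\int[P]_t (G t * f (X t))%:E)%E.
  rewrite (_ : (\int[P]_t (G t * f (X t))%:E)%E =
      \int[P]_t limn (fun n => (G t * f_ n (X t))%:E))%E; last first.
    apply: eq_integral => t _; apply/esym/cvg_lim => //=.
    rewrite EFinM; under eq_fun do rewrite EFinM.
    by apply: cvgeZl => //.
  apply: cvg_monotone_convergence => //.
  - by move=> n; apply/measurable_EFinP/measurable_funM.
  - by move=> n t _; rewrite lee_fin mulr_ge0.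
  - by move=> t _ m n mn; rewrite lee_fin ler_wpM2l// ndf.
have rhs : (\int[F]_u (f_ n u)%:E)%E @[n --> \oo] --> (\int[F]_u (f u)%:E)%E.
  rewrite (_ : (\int[F]_u (f u)%:E)%E =
      \int[F]_u limn (fun n => (f_ n u)%:E))%E; last first.
    by apply: eq_integral => t _; apply/esym/cvg_lim => //=.
  apply: cvg_monotone_convergence => //.
  - by move=> n; apply/measurable_EFinP.
  - by move=> n t _; rewrite lee_fin.
  - by move=> t _ m n mn; rewrite lee_fin ndf.
have := cvgeZl (erefl : c%:E \is a fin_num) rhs.
rewrite (_ : (fun n => _) = (fun n => \int[P]_t (G t * f_ n (X t))%:E)%E); last first.
  by apply/funext => n; rewrite simple.
by move=> rhs'; exact: (cvg_unique _ lhs rhs').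
Qed.

Variable (z : nat -> {RV P >-> Z}).
Hypothesis z_iid : iid F z.

Lemma iid_prod_indic n (A : 'I_n -> set Z) : (forall i, measurable (A i)) ->
  (\int[P]_t (\prod_(i < n) \1_(A i) (z i t))%:E = (\prod_(i < n) fine (F (A i)))%:E)%E.
Proof.
move=> mA.
pose B (j : nat) : set Z := if insub j is Some i then A i else setT.
have BA (i : 'I_n) : B i = A i by rewrite /B valK.
have mB j : measurable (B j) by rewrite /B; case: insub.
pose J : {fset nat} := [fset j | j in iota 0 n]%fset.
have memJ j : (j \in J) = (j < n)%N.
  apply/idP/idP; first by move=> /imfsetP[k /=]; rewrite mem_iota => /andP[_ kn] ->.
  by move=> jn; apply/imfsetP; exists j => //=; rewrite mem_iota.
have [zF /(_ J B mB) zJ] := z_iid.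
have Jperm : perm_eq J (iota 0 n).
  by apply: uniq_perm; [exact: fset_uniq|exact: iota_uniq|move=> j; rewrite memJ mem_iota].
have prodF : (\prod_(i <- J) P (z i @^-1` B i) = (\prod_(i < n) fine (F (A i)))%:E)%E.
  rewrite (perm_big _ Jperm)/= -[n in iota _ n]subn0 big_mkord -prodEFin.
  by apply: eq_bigr => i _; rewrite zF// BA fineK// fin_num_measure.
rewrite -prodF -zJ -[X in P X]setIT -integral_indic//; last first.
  by apply: fin_bigcap_measurable => // i _; rewrite -[X in measurable X]setTI; exact: measurable_funP.
apply: eq_integral => t _; congr EFin.
rewrite [RHS]indicE.
have [tB|tB] := boolP (_ \in _).
  rewrite big1// => i _; rewrite indicE mem_set//.
  move: tB; rewrite inE => /(_ i) /=; rewrite BA; apply; rewrite memJ//.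
have /existsNP[i iB] : ~ forall i : 'I_n, A i (z i t).
  move=> tA; move/negP: tB; apply; rewrite inE => j /=; rewrite memJ => jn.
  have := tA (Ordinal jn); rewrite -BA; exact.
by rewrite (bigD1 i)//= indicE memNset// mul0r.
Qed.

(** The factors are turned into indicator functions one at a time, the remaining
   product being the density that reweighs the law of the observation concerned. *)
Lemma iid_prod_ge0 n (f : 'I_n -> Z -> R) :
  (forall i, F.-integrable setT (EFin \o f i)) -> (forall i u, 0 <= f i u) ->
  (\int[P]_t (\prod_(i < n) f i (z i t))%:E =
   (\prod_(i < n) \int[F]_u f i u)%:E)%E.
Proof.
move=> intf f0.
suff claim m : (forall i : 'I_n, (m <= i)%N -> exists2 A, measurable A & f i = \1_A) ->
    (\int[P]_t (\prod_(i < n) f i (z i t))%:E =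
   (\prod_(i < n) \int[F]_u f i u)%:E)%E.
  by apply: (claim n) => i; rewrite leqNgt ltn_ord.
(* The factors number m and up are already indicator functions. *)
elim: m f intf f0 => [|m IH] f intf f0 fA.
  have /choice[A fAE] i : exists A, measurable A /\ f i = \1_A.
    by have [A mA fAi] := fA i (leq0n _); exists A.
  under eq_integral => t _ do under eq_bigr => i _ do rewrite (fAE i).2.
  rewrite iid_prod_indic; last by move=> i; exact: (fAE i).1.
  congr EFin; apply: eq_bigr => i _; rewrite (fAE i).2 /Rintegral integral_indic ?setIT//.
  exact: (fAE i).1.
have [mn|nm] := ltnP m n; last first.
  by apply: IH => // i mi; have := leq_trans nm mi; rewrite leqNgt ltn_ord.
pose j := Ordinal mn.
have mf i : measurable_fun setT (f i) by exact/measurable_EFinP/(measurable_int F)/intf.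
under eq_integral => t _ do rewrite (bigD1 j)//= mulrC.
rewrite (reweighted_integral (c := \prod_(i < n | i != j) \int[F]_u f i u))//.
- rewrite [in RHS](bigD1 j)//= mulrC EFinM; congr (_ * _)%E.
  rewrite fineK//.
  exact: (integrable_fin_num measurableT (intf j)).
- under eq_fun do rewrite big_mkcond/=.
  by apply: measurable_prod => i _; case: eqP => _ //=; exact: measurableT_comp.
- by move=> t; apply: prodr_ge0.
- by apply: prodr_ge0 => i _; apply: Rintegral_ge0.
- move=> A mA.
  pose g i := if i == j then \1_A else f i.
  have gj t : g j t = \1_A t by rewrite /g eqxx.
  have gi i t : i != j -> g i t = f i t by rewrite /g => /negPf ->.
  under eq_integral => t _.
    rewrite (eq_bigr (fun i : 'I_n => g i (z i t))); last by move=> i ij; rewrite gi.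
    rewrite -[\1_A _]gj mulrC -(bigD1 j (P := xpredT) (F := fun i : 'I_n => g i (z i t)))//=.
    over.
  rewrite IH.
  + rewrite [in LHS](bigD1 j)//= mulrC EFinM; congr (_%:E * _)%E.
      by apply: eq_bigr => i ij; rewrite /g (negPf ij).
    rewrite /Rintegral; under eq_integral do rewrite gj.
    by rewrite integral_indic// setIT fineK// fin_num_measure.
  + move=> i; rewrite /g; case: eqP => // _.
    by apply: integrable_indic => //; rewrite ?fin_num_measure//; exact: fin_num_fun_lty.
  + by move=> i u; rewrite /g; case: eqP.
  + move=> i; rewrite leq_eqVlt /g => /predU1P[mi|mi].
      have -> : i = j by exact/val_inj.
      by rewrite eqxx; exists A.
    by have [B mB fB] := fA i mi; case: eqP => _; [exists A|exists B].
Qed.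

Lemma iid_prod_integrable n (f : 'I_n -> Z -> R) :
  (forall i, F.-integrable setT (EFin \o f i)) ->
  P.-integrable setT (EFin \o (fun t => \prod_(i < n) f i (z i t))).
Proof.
move=> intf.
have mf i : measurable_fun setT (f i) by exact/measurable_EFinP/(measurable_int F)/intf.
apply/integrableP; split.
  by apply/measurable_EFinP; apply: measurable_prod => i _; exact: measurableT_comp.
under eq_integral => t _ do rewrite /= normr_prod.
rewrite (iid_prod_ge0 (f := fun i u => `|f i u|)) ?ltry// => i.
exact: integrable_norm.
Qed.

(** Splitting one factor at a time into positive and negative parts leaves
   nonnegative factors only. *)
Lemma iid_prod n (f : 'I_n -> Z -> R) :
  (forall i, F.-integrable setT (EFin \o f i)) ->
  \int[P]_t (\prod_(i < n) f i (z i t)) = \prod_(i < n) \int[F]_u f i u.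
Proof.
move=> intf.
suff claim m : (forall (i : 'I_n) u, (m <= i)%N -> 0 <= f i u) ->
    \int[P]_t (\prod_(i < n) f i (z i t)) = \prod_(i < n) \int[F]_u f i u.
  by apply: (claim n) => i u; rewrite leqNgt ltn_ord.
elim: m f intf => [|m IH] f intf f0.
  by rewrite {1}/Rintegral iid_prod_ge0//= => i u; exact: f0.
have [mn|nm] := ltnP m n; last first.
  by apply: IH => // i u mi; have := leq_trans nm mi; rewrite leqNgt ltn_ord.
pose j := Ordinal mn.
pose g (h : Z -> R) (i : 'I_n) := if i == j then h else f i.
have gj h : g h j = h by rewrite /g eqxx.
have gi h i : i != j -> g h i = f i by rewrite /g => /negPf ->.
have prodg h t : \prod_(i < n) g h i (z i t) =
    h (z j t) * \prod_(i < n | i != j) f i (z i t).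
  by rewrite (bigD1 j)//= gj; congr (_ * _); apply: eq_bigr => i ij; rewrite gi.
have inth h : F.-integrable setT (EFin \o h) -> (forall u, 0 <= h u) ->
    P.-integrable setT (EFin \o (fun t => h (z j t) * \prod_(i < n | i != j) f i (z i t))) /\
    \int[P]_t (h (z j t) * \prod_(i < n | i != j) f i (z i t)) =
    \int[F]_u h u * \prod_(i < n | i != j) \int[F]_u f i u.
  move=> ih h0.
  have ig i : F.-integrable setT (EFin \o g h i) by rewrite /g; case: eqP.
  split.
    have := iid_prod_integrable ig.
    by under [X in EFin \o X]eq_fun do rewrite prodg.
  transitivity (\int[P]_t \prod_(i < n) g h i (z i t)).
    by apply: eq_Rintegral => t _; rewrite prodg.
  rewrite IH//; last first.
    move=> i u; rewrite leq_eqVlt => /predU1P[mi|mi]; last first.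
      by rewrite /g; case: eqP => // _; exact: f0.
    have -> : i = j by exact/val_inj.
    by rewrite gj.
  by rewrite (bigD1 j)//= gj; congr (_ * _); apply: eq_bigr => i ij; rewrite gi.
have [ip ep] := inth _ (integrable_funrpos measurableT (intf j)) (funrpos_ge0 _).
have [iq eq] := inth _ (integrable_funrneg measurableT (intf j)) (funrneg_ge0 _).
rewrite [RHS](bigD1 j)//=.
transitivity (\int[P]_t ((f j)^\+ (z j t) * (\prod_(i < n | i != j) f i (z i t)) -
    (f j)^\- (z j t) * (\prod_(i < n | i != j) f i (z i t)))).
  apply: eq_Rintegral => t _; rewrite (bigD1 j)//= -mulrBl; congr (_ * _).
  by rewrite -[in LHS](funrposBneg (f j)).
rewrite RintegralB// ep eq -mulrBl -RintegralB//.
- by congr (_ * _); apply: eq_Rintegral => u _; rewrite -[in RHS](funrposBneg (f j)).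
- exact: integrable_funrpos.
- exact: integrable_funrneg.
Qed.

End product_formula.

(** * Integrable real random variables *)

Section expectation_toolkit.
Context (R : realType) d (T : measurableType d) (P : probability T R).
Implicit Types (f g : T -> R).

Local Notation L1 f := (P.-integrable setT (EFin \o f)).
Local Notation E f := (\int[P]_t f t).

Lemma L1_measurable f : L1 f -> measurable_fun setT f.
Proof. by move=> /(measurable_int P)/measurable_EFinP. Qed.

Lemma L1_dominated f g : measurable_fun setT f -> L1 g ->
  (forall t, `|f t| <= g t) -> L1 f.
Proof.
move=> mf ig fg; apply: (le_integrable measurableT _ _ ig).
  exact/measurable_EFinP.
by move=> t _; rewrite /= lee_fin (le_trans (fg t))// ler_norm.
Qed.

Lemma L1_cst (c : R) : L1 (fun=> c).
Proof. exact: finite_measure_integrable_cst. Qed.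

Lemma L1_bounded f (c : R) : measurable_fun setT f -> (forall t, `|f t| <= c) -> L1 f.
Proof. by move=> mf fc; apply: L1_dominated (L1_cst c) _. Qed.

Lemma L1D f g : L1 f -> L1 g -> L1 (fun t => f t + g t).
Proof. exact: integrableD. Qed.

Lemma L1B f g : L1 f -> L1 g -> L1 (fun t => f t - g t).
Proof. exact: integrableB. Qed.

Lemma L1Z f (c : R) : L1 f -> L1 (fun t => c * f t).
Proof. exact: integrableZl. Qed.

Lemma L1_sum (I : finType) (Q : pred I) (f : I -> T -> R) :
  (forall i, L1 (f i)) -> L1 (fun t => \sum_(i | Q i) f i t).
Proof.
move=> intf; rewrite (_ : _ \o _ = fun t => (\sum_(i | Q i) (f i t)%:E)%E).
  by apply: integrable_sum => // i _; exact: intf.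
by apply/funext => t /=; rewrite sumEFin.
Qed.

Lemma E_sum (I : finType) (Q : pred I) (f : I -> T -> R) :
  (forall i, L1 (f i)) -> E (fun t => \sum_(i | Q i) f i t) = \sum_(i | Q i) E (f i).
Proof.
move=> intf; elim: (index_enum I) => [|i s IH].
  under eq_Rintegral do rewrite big_nil.
  by rewrite big_nil Rintegral_cst// mul0r.
under eq_Rintegral do rewrite big_cons; rewrite big_cons.
case: ifPn => // _; rewrite RintegralD// ?IH//.
rewrite (_ : _ \o _ = fun t => (\sum_(i <- s | Q i) (f i t)%:E)%E).
  by apply: integrable_sum => // j _; exact: intf.
by apply/funext => t /=; rewrite sumEFin.
Qed.

Lemma E_cst (c : R) : E (fun=> c) = c.
Proof. by rewrite Rintegral_cst// [X in fine X]probability_setT mulr1. Qed.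

Lemma E_le f g : L1 f -> L1 g -> (forall t, f t <= g t) -> E f <= E g.
Proof. by move=> fi gi fg; apply: le_Rintegral. Qed.

Lemma EZ f (c : R) : L1 f -> E (fun t => c * f t) = c * E f.
Proof. by move=> fi; rewrite RintegralZl. Qed.

Lemma ED f g : L1 f -> L1 g -> E (fun t => f t + g t) = E f + E g.
Proof. by move=> fi gi; rewrite RintegralD. Qed.

Lemma E_ge0 f : (forall t, 0 <= f t) -> 0 <= E f.
Proof. by move=> f0; apply: Rintegral_ge0. Qed.

Lemma L1_mul f g : measurable_fun setT f -> measurable_fun setT g ->
  L1 (fun t => f t ^+ 2) -> L1 (fun t => g t ^+ 2) -> L1 (fun t => f t * g t).
Proof.
move=> mf mg f2 g2; apply: L1_dominated (L1D f2 g2) _.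
  exact: measurable_funM.
move=> t; rewrite normrM.
rewrite -[f t ^+ 2]real_normK ?num_real// -[g t ^+ 2]real_normK ?num_real//.
have := normr_ge0 (f t); have := normr_ge0 (g t).
set x := `|f t|; set y := `|g t|; move: x y => x y; nra.
Qed.

Lemma L1_sqr f : measurable_fun setT f -> L1 (fun t => f t ^+ 2) -> L1 f.
Proof.
move=> mf f2; rewrite (_ : f = fun t => f t * 1); last by apply/funext => t; rewrite mulr1.
apply: L1_mul => //; exact: L1_cst.
Qed.

Lemma L1_sqr_scale f (h : T -> R) (c : R) : measurable_fun setT f -> measurable_fun setT h ->
  (forall t, `|h t| <= c) -> L1 (fun t => f t ^+ 2) -> L1 (fun t => (h t * f t) ^+ 2).
Proof.
move=> mf mh hc f2; apply: L1_dominated (L1Z (c ^+ 2) f2) _.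
  by apply: measurable_funX; exact: measurable_funM.
move=> t; rewrite ger0_norm ?sqr_ge0// exprMn ler_wpM2r ?sqr_ge0//.
rewrite -[h t ^+ 2]real_normK ?num_real// lerXn2r ?nnegrE ?normr_ge0//.
exact: le_trans (normr_ge0 (h t)) (hc t).
Qed.

Lemma markov_ineq f (a : R) : L1 f -> (forall t, 0 <= f t) -> 0 < a ->
  (P [set t | (a <= f t)%R] <= (E f / a)%:E)%E.
Proof.
move=> fi f0 a0; have mf := L1_measurable fi.
have mA : measurable [set t | (a <= f t)%R].
  rewrite -[X in measurable X]setTI.
  by apply: (measurable_fun_le (f := cst a)).
rewrite -[X in P X]setIT -integral_indic// -[leLHS]fineK; last first.
  by rewrite integral_indic// setIT fin_num_measure.
rewrite lee_fin ler_pdivlMr// mulrC -RintegralZl//; last first.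
  by apply: integrable_indic => //; exact: fin_num_fun_lty.
apply: E_le => //.
  by apply: L1Z; apply: integrable_indic => //; exact: fin_num_fun_lty.
move=> t; rewrite indicE; have [|] := boolP (t \in _); last by rewrite mulr0.
by rewrite inE/= mulr1.
Qed.

End expectation_toolkit.

(** * Sums with terms orthogonal given a finite partition *)

Section orthogonal_sums.
Context (R : realType) d d' (T : measurableType d) (Z : measurableType d').
Variables (P : probability T R) (F : probability Z R) (z : nat -> {RV P >-> Z}).
Hypothesis z_iid : iid F z.
Variables (n : nat) (B : finType) (bin : 'I_n -> Z -> B).
Hypothesis mbin : forall i b, measurable_fun setT (fun u => (bin i u == b)%:R : R).

Local Notation L1 P f := (P.-integrable setT (EFin \o f)).
Local Notation E P f := (\int[P]_t f t).
Local Notation ind b := (b%:R : R).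

(** The bins stand for the information that one conditions on. As they take finitely
   many values, conditional arguments become finite sums over those values. *)
Definition bins (t : T) : {ffun 'I_n -> B} := [ffun i => bin i (z i t)].

Lemma ind_binsE (k : {ffun 'I_n -> B}) t :
  ind (bins t == k) = \prod_(i < n) ind (bin i (z i t) == k i).
Proof.
have [<-|tk] := eqVneq.
  by rewrite big1// => i _; rewrite ffunE eqxx.
have /existsP[i ik] : [exists i, bin i (z i t) != k i].
  apply: contraR tk; rewrite negb_exists => /forallP h; apply/eqP/ffunP => i.
  by have := h i; rewrite negbK ffunE => /eqP.
by rewrite (bigD1 i)//= (negPf ik) mul0r.
Qed.

Lemma sum_binsE (c : {ffun 'I_n -> B} -> R) t :
  c (bins t) = \sum_k c k * ind (bins t == k).
Proof.
rewrite (bigD1 (bins t))//= eqxx mulr1 big1 ?addr0// => k.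
by rewrite eq_sym => /negPf ->; rewrite mulr0.
Qed.

Lemma measurable_bins (c : {ffun 'I_n -> B} -> R) :
  measurable_fun setT (fun t => c (bins t)).
Proof.
under eq_fun do rewrite sum_binsE.
apply: measurable_sum => k; apply: measurable_funM => //.
under eq_fun do rewrite ind_binsE.
by apply: measurable_prod => i _; apply: (measurableT_comp (mbin i (k i))).
Qed.

Lemma L1_bins (c : {ffun 'I_n -> B} -> R) : L1 P (fun t => c (bins t)).
Proof.
apply: (@L1_bounded _ _ _ P _ (\sum_k `|c k|)); first exact: measurable_bins.
by move=> t; rewrite (bigD1 (bins t))//= lerDl sumr_ge0.
Qed.

Lemma L1_bin i b : L1 F (fun u => ind (bin i u == b)).
Proof.
by apply: (@L1_bounded _ _ _ F _ 1) => // u; case: eqP; rewrite ?normr1 ?normr0.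
Qed.

Lemma E_bins (c : {ffun 'I_n -> B} -> R) :
  E P (fun t => c (bins t)) =
  \sum_k c k * \prod_(i < n) E F (fun u => ind (bin i u == k i)).
Proof.
have iL (k : {ffun 'I_n -> B}) i := L1_bin i (k i).
under eq_Rintegral => t _ do rewrite sum_binsE.
rewrite E_sum; last first.
  by move=> k; apply: L1Z; under eq_fun do rewrite ind_binsE; exact: iid_prod_integrable (iL k).
apply: eq_bigr => k _; rewrite EZ; last first.
  by under eq_fun do rewrite ind_binsE; exact: iid_prod_integrable (iL k).
congr (_ * _); under eq_Rintegral => t _ do rewrite ind_binsE.
exact: iid_prod (iL k).
Qed.

Variables (S : finType) (Q : pred S) (xi : S -> 'I_n -> Z -> R) (v : S -> 'I_n -> R).
Variable c : S -> {ffun 'I_n -> B} -> R.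
Hypothesis mxi : forall s i, measurable_fun setT (xi s i).
Hypothesis xi2 : forall s i, L1 F (fun u => xi s i u ^+ 2).
Hypothesis xi_orth : forall s s', Q s -> Q s' -> s != s' -> exists i, forall b,
  E F (fun u => xi s i u * xi s' i u * ind (bin i u == b)) = 0.
Hypothesis xi_var : forall s i b, Q s ->
  E F (fun u => xi s i u ^+ 2 * ind (bin i u == b)) <=
  v s i * E F (fun u => ind (bin i u == b)).

Definition orth_sum t := \sum_(s | Q s) c s (bins t) * \prod_(i < n) xi s i (z i t).

Let f s s' (k : {ffun 'I_n -> B}) i u := xi s i u * xi s' i u * ind (bin i u == k i).

Let L1f s s' k i : L1 F (f s s' k i).
Proof.
have := L1_mul (mxi s i) (mxi s' i) (xi2 s i) (xi2 s' i) => h.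
apply: (L1_dominated (g := fun u => `|xi s i u * xi s' i u|)).
- by apply: measurable_funM => //; exact: measurable_funM.
- exact: integrable_norm h.
- by move=> u; rewrite /f; case: eqP => _; rewrite ?mulr1 ?mulr0 ?normr0.
Qed.

Let orth_sumE t : orth_sum t ^+ 2 = \sum_(s | Q s) \sum_(s' | Q s') \sum_k
   (c s k * c s' k) * \prod_(i < n) f s s' k i (z i t).
Proof.
rewrite expr2 /orth_sum big_distrlr/=; apply: eq_bigr => s _; apply: eq_bigr => s' _.
rewrite mulrACA (sum_binsE (fun k => c s k * c s' k)) mulr_suml.
apply: eq_bigr => k _; rewrite ind_binsE -[LHS]mulrA; congr (_ * _).
by rewrite -!big_split/=; apply: eq_bigr => i _; rewrite mulrC.
Qed.

Lemma L1_orth_sum : L1 P (fun t => orth_sum t ^+ 2).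
Proof.
under eq_fun do rewrite orth_sumE.
apply: L1_sum => s; apply: L1_sum => s'; apply: L1_sum => k; apply: L1Z.
exact: (iid_prod_integrable z_iid (L1f s s' k)).
Qed.

(** Expanding the square over pairs of terms and over the values of the bins turns
   every expectation into a product over the observations. For two different terms
   this product has a vanishing factor, whatever the coefficients c are as functions
   of the bins. *)
Lemma E_orth_sum : E P (fun t => orth_sum t ^+ 2) <=
  \sum_(s | Q s) (\prod_(i < n) v s i) * E P (fun t => c s (bins t) ^+ 2).
Proof.
under eq_Rintegral => t _ do rewrite orth_sumE.
have ip s s' k := iid_prod_integrable z_iid (L1f s s' k).
rewrite E_sum; last first.
  by move=> s; apply: L1_sum => s'; apply: L1_sum => k; apply: L1Z.
apply: ler_sum => s Qs.
rewrite E_sum; last by move=> s'; apply: L1_sum => k; apply: L1Z.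
rewrite (bigD1 s)//= [X in _ + X]big1 ?addr0; last first.
  move=> s' /andP[Qs' ss']; rewrite E_sum; last by move=> k; apply: L1Z.
  rewrite big1// => k _; rewrite EZ// (iid_prod z_iid (L1f s s' k)).
  have [||//|i i0] := xi_orth (s := s) (s' := s'); rewrite // 1?eq_sym//.
  by rewrite (bigD1 i)//= /f i0 mul0r mulr0.
rewrite E_sum; last by move=> k; apply: L1Z.
rewrite (E_bins (fun k => c s k ^+ 2)) mulr_sumr; apply: ler_sum => k _.
rewrite EZ// (iid_prod z_iid (L1f s s k)) mulrCA -expr2 ler_wpM2l ?sqr_ge0// -big_split/=.
apply: ler_prod => i _; apply/andP; split.
  by apply: E_ge0 => u; rewrite /f -expr2 mulr_ge0 ?sqr_ge0 ?ler0n.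
by under eq_Rintegral => u _ do rewrite /f -expr2; exact: xi_var.
Qed.

End orthogonal_sums.

Section linear_and_bilinear_sums.
Context (R : realType) d d' (T : measurableType d) (Z : measurableType d').
Variables (P : probability T R) (F : probability Z R) (z : nat -> {RV P >-> Z}).
Hypothesis z_iid : iid F z.
Variables (n : nat) (B : finType) (bin : 'I_n -> Z -> B).
Hypothesis mbin : forall i b, measurable_fun setT (fun u => (bin i u == b)%:R : R).

Local Notation L1 P f := (P.-integrable setT (EFin \o f)).
Local Notation E P f := (\int[P]_t f t).
Local Notation ind b := (b%:R : R).
Local Notation bins := (bins z bin).

(** Conditions on the law given the bin are stated as integrals over the events that
   the bin generates, which dispenses with conditional distributions. *)
Definition bin_noise i (g : Z -> R) (v : R) :=
  [/\ measurable_fun setT g, L1 F (fun u => g u ^+ 2),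
      forall b, E F (fun u => g u * ind (bin i u == b)) = 0 &
      forall b, E F (fun u => g u ^+ 2 * ind (bin i u == b)) <=
                v * E F (fun u => ind (bin i u == b))].

Lemma linear_sum_moment (Q : pred 'I_n) (g : 'I_n -> Z -> R) (v : 'I_n -> R)
    (c : 'I_n -> {ffun 'I_n -> B} -> R) :
  (forall j, Q j -> bin_noise j (g j) (v j)) ->
  let X t := \sum_(j | Q j) c j (bins t) * g j (z j t) in
  L1 P (fun t => X t ^+ 2) /\
  E P (fun t => X t ^+ 2) <= \sum_(j | Q j) v j * E P (fun t => c j (bins t) ^+ 2).
Proof.
move=> gnoise X.
pose xi (j l : 'I_n) : Z -> R := if (l == j) && Q j then g j else cst 1.
have XE t : X t = \sum_(j | Q j) c j (bins t) * \prod_(l < n) xi j l (z l t).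
  apply: eq_bigr => j Qj; congr (_ * _).
  rewrite (bigD1 j)//= /xi eqxx Qj big1 ?mulr1// => l lj; by rewrite (negPf lj).
have mxi j l : measurable_fun setT (xi j l).
  by rewrite /xi; case: ifPn => [/andP[_ /gnoise[]]|_].
have xi2 j l : L1 F (fun u => xi j l u ^+ 2).
  by rewrite /xi; case: ifPn => [/andP[_ /gnoise[]]|_] //; exact: (@L1_cst _ _ _ F (1 ^+ 2)).
pose vv j l := if (l == j) && Q j then v j else 1.
have orth s s' : Q s -> Q s' -> s != s' -> exists i, forall b,
    E F (fun u => xi s i u * xi s' i u * ind (bin i u == b)) = 0.
  move=> Qs Qs' ss'; exists s => b; rewrite /xi eqxx (negPf ss') Qs/=.
  have [_ _ /(_ b) <- _] := gnoise _ Qs.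
  by apply: eq_Rintegral => u _; rewrite mulr1.
have var s i b : Q s -> E F (fun u => xi s i u ^+ 2 * ind (bin i u == b)) <=
    vv s i * E F (fun u => ind (bin i u == b)).
  move=> Qs; rewrite /xi /vv Qs andbT; case: eqP => [->|_].
    by have [_ _ _ /(_ b) ->] := gnoise _ Qs.
  rewrite mul1r le_eqVlt; apply/orP; left; apply/eqP.
  by apply: eq_Rintegral => u _; rewrite expr1n mul1r.
have XO t : X t = orth_sum z bin Q xi c t by rewrite XE.
split.
  under eq_fun do rewrite XO.
  exact: (L1_orth_sum z_iid mbin Q c mxi xi2).
under eq_Rintegral => t _ do rewrite XO.
apply: (le_trans (E_orth_sum z_iid mbin c mxi xi2 orth var)).
apply: ler_sum => j Qj.
rewrite (bigD1 j)//= {1}/vv eqxx Qj big1 ?mulr1// => l lj.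
by rewrite /vv (negPf lj).
Qed.

(** Distinct pairs of observations differ in a coordinate, and since A and A' are
   disjoint, the noise at that coordinate occurs only once in the product of the two
   terms; its mean given the bin is zero. *)
Lemma bilinear_sum_moment (A A' : {set 'I_n}) (g h : Z -> R) (v w : R)
    (c : 'I_n * 'I_n -> {ffun 'I_n -> B} -> R) :
  (forall j, j \in A' -> j \notin A) ->
  (forall j, j \in A -> bin_noise j g v) -> (forall j, j \in A' -> bin_noise j h w) ->
  let Q (p : 'I_n * 'I_n) := (p.1 \in A) && (p.2 \in A') in
  let X t := \sum_(p | Q p) c p (bins t) * (g (z p.1 t) * h (z p.2 t)) in
  L1 P (fun t => X t ^+ 2) /\
  E P (fun t => X t ^+ 2) <= \sum_(p | Q p) v * w * E P (fun t => c p (bins t) ^+ 2).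
Proof.
move=> AA' gn hn Q X.
have disj i j : i \in A -> j \in A' -> (i == j) = false.
  by move=> iA /AA' jA; apply/eqP => ij; move: jA; rewrite -ij iA.
pose xi (p : 'I_n * 'I_n) (l : 'I_n) : Z -> R :=
  if (l == p.1) && (p.1 \in A) then g else if (l == p.2) && (p.2 \in A') then h else cst 1.
have XE t : X t = \sum_(p | Q p) c p (bins t) * \prod_(l < n) xi p l (z l t).
  apply: eq_bigr => -[i j] /andP[/= iA jA]; congr (_ * _).
  have ji : j != i by rewrite eq_sym disj.
  rewrite (bigD1 i)//= (bigD1 j)//= /xi/= !eqxx iA/= (negPf ji) jA/=.
  by rewrite big1 ?mulr1// => l /andP[/negPf -> /negPf ->].
have mxi p l : measurable_fun setT (xi p l).
  by rewrite /xi; case: ifPn => [/andP[_ /gn[]]|_]//; case: ifPn => [/andP[_ /hn[]]|_].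
have xi2 p l : L1 F (fun u => xi p l u ^+ 2).
  rewrite /xi; case: ifPn => [/andP[_ /gn[]]|_]//.
  by case: ifPn => [/andP[_ /hn[]]|_] //; exact: (@L1_cst _ _ _ F (1 ^+ 2)).
pose vv (p : 'I_n * 'I_n) (l : 'I_n) := if l == p.1 then v else if l == p.2 then w else 1.
have orth s s' : Q s -> Q s' -> s != s' -> exists i, forall b,
    E F (fun u => xi s i u * xi s' i u * ind (bin i u == b)) = 0.
  case: s s' => [i j] [i' j'] /andP[/= iA jA] /andP[/= iA' jA'].
  rewrite xpair_eqE negb_and; have [<-|ii _] := eqVneq i i'.
    rewrite /= => jj; exists j => b; rewrite /xi/= iA jA jA' !andbT.
    rewrite eq_sym disj// eqxx (negPf jj).
    by have [_ _ /(_ b) <- _] := hn _ jA; apply: eq_Rintegral => u _; rewrite mulr1.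
  exists i => b; rewrite /xi/= eqxx iA/= (negPf ii) disj//=.
  by have [_ _ /(_ b) <- _] := gn _ iA; apply: eq_Rintegral => u _; rewrite mulr1.
have var s i b : Q s -> E F (fun u => xi s i u ^+ 2 * ind (bin i u == b)) <=
    vv s i * E F (fun u => ind (bin i u == b)).
  case: s => k l /andP[/= kA lA]; rewrite /xi /vv/= kA lA !andbT.
  case: eqP => [->|_]; first by have [_ _ _ /(_ b) ->] := gn _ kA.
  case: eqP => [->|_]; first by have [_ _ _ /(_ b) ->] := hn _ lA.
  rewrite mul1r le_eqVlt; apply/orP; left; apply/eqP.
  by apply: eq_Rintegral => u _; rewrite expr1n mul1r.
have XO t : X t = orth_sum z bin Q xi c t by rewrite XE.
split.
  under eq_fun do rewrite XO.
  exact: (L1_orth_sum z_iid mbin Q c mxi xi2).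
under eq_Rintegral => t _ do rewrite XO.
apply: (le_trans (E_orth_sum z_iid mbin c mxi xi2 orth var)).
apply: ler_sum => -[i j] /andP[/= iA jA].
have ji : j != i by rewrite eq_sym disj.
rewrite (bigD1 i)//= (bigD1 j)//= /vv/= !eqxx (negPf ji).
by rewrite big1 ?mulr1// => l /andP[/negPf -> /negPf ->].
Qed.

End linear_and_bilinear_sums.

Section unconditional_sums.
Context (R : realType) d d' (T : measurableType d) (Z : measurableType d').
Variables (P : probability T R) (F : probability Z R) (z : nat -> {RV P >-> Z}).
Hypothesis z_iid : iid F z.
Variable n : nat.

Local Notation L1 P f := (P.-integrable setT (EFin \o f)).
Local Notation E P f := (\int[P]_t f t).

(** With a single bin there is nothing to condition on. *)
Lemma centred_sum_moment (g : 'I_n -> Z -> R) (v : 'I_n -> R) :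
  (forall j, measurable_fun setT (g j)) -> (forall j, L1 F (fun u => g j u ^+ 2)) ->
  (forall j, E F (g j) = 0) -> (forall j, E F (fun u => g j u ^+ 2) <= v j) ->
  let X t := \sum_j g j (z j t) in
  L1 P (fun t => X t ^+ 2) /\ E P (fun t => X t ^+ 2) <= \sum_j v j.
Proof.
move=> mg g2 g0 gv X; pose bin (_ : 'I_n) (_ : Z) := tt.
have mbin i b : measurable_fun setT (fun u => (bin i u == b)%:R : R) by [].
have noise j : bin_noise F bin j (g j) (v j).
  split=> // -[]; rewrite /bin eqxx.
    by rewrite -[RHS](g0 j); apply: eq_Rintegral => u _; rewrite mulr1.
  rewrite E_cst mulr1; under eq_Rintegral => u _ do rewrite mulr1.
  exact: gv.
have [X2 EX] := linear_sum_moment z_iid mbin (Q := xpredT) (fun _ _ => 1)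
  (fun j _ => noise j).
have XE t : X t = \sum_j 1 * g j (z j t).
  by apply: eq_bigr => j _; rewrite mul1r.
split; first by under eq_fun do rewrite XE.
under eq_Rintegral => t _ do rewrite XE.
apply: le_trans EX _.
by apply: ler_sum => j _; rewrite expr1n E_cst mulr1.
Qed.

(** Centring the summands separates the variance from the square of the mean. *)
Lemma sum_moment (g : 'I_n -> Z -> R) :
  (forall j, measurable_fun setT (g j)) -> (forall j, L1 F (fun u => g j u ^+ 2)) ->
  let X t := \sum_j g j (z j t) in
  L1 P (fun t => X t ^+ 2) /\ E P (fun t => X t ^+ 2) <=
    2 * \sum_j E F (fun u => g j u ^+ 2) + 2 * (\sum_j E F (g j)) ^+ 2.
Proof.
move=> mg g2 X.
pose f j u := g j u - E F (g j).
have g1 j : L1 F (g j) by apply: L1_sqr.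
have mf j : measurable_fun setT (f j) by apply: measurable_funB.
have f2E j u : f j u ^+ 2 = g j u ^+ 2 + (- (2 * E F (g j)) * g j u + E F (g j) ^+ 2).
  by rewrite /f; ring.
have f2i j : L1 F (fun u => - (2 * E F (g j)) * g j u + E F (g j) ^+ 2).
  by apply: L1D; [exact: L1Z|exact: L1_cst].
have f2 j : L1 F (fun u => f j u ^+ 2).
  by under eq_fun do rewrite f2E; apply: L1D.
have f0 j : E F (f j) = 0.
  rewrite RintegralB//; last exact: L1_cst.
  by rewrite E_cst subrr.
have fv j : E F (fun u => f j u ^+ 2) <= E F (fun u => g j u ^+ 2).
  under eq_Rintegral => u _ do rewrite f2E.
  rewrite ED// ED//; [|exact: L1Z|exact: L1_cst].
  rewrite EZ// E_cst; set a := E F (g j).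
  by have := sqr_ge0 a; nra.
have [Y2 EY] := centred_sum_moment mf f2 f0 fv.
pose Y t := \sum_j f j (z j t).
have XY t : X t = Y t + \sum_j E F (g j).
  by rewrite /Y -big_split/=; apply: eq_bigr => j _; rewrite /f subrK.
have mX : measurable_fun setT X.
  by apply: measurable_sum => j; exact: measurableT_comp.
have Xle t : X t ^+ 2 <= 2 * (Y t ^+ 2) + 2 * (\sum_j E F (g j)) ^+ 2.
  by rewrite XY; have := sqr_ge0 (Y t - \sum_j E F (g j)); nra.
have Yi : L1 P (fun t => 2 * (Y t ^+ 2) + 2 * (\sum_j E F (g j)) ^+ 2).
  by apply: L1D; [exact: L1Z|exact: L1_cst].
have Xi : L1 P (fun t => X t ^+ 2).
  apply: L1_dominated Yi _; first exact: measurable_funX.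
  by move=> t; rewrite ger0_norm ?sqr_ge0.
split => //; apply: le_trans (E_le Xi Yi Xle) _.
rewrite ED//; [|exact: L1Z|exact: L1_cst].
by rewrite EZ// E_cst lerD2r ler_wpM2l.
Qed.

End unconditional_sums.

(** * Cell averages of noise *)

Section cell_averages.
Context (R : realType) d d' (T : measurableType d) (Z : measurableType d').
Variables (P : probability T R) (F : probability Z R) (z : nat -> {RV P >-> Z}).
Hypothesis z_iid : iid F z.
Variables (n K : nat) (cell : Z -> option 'I_K) (s : Z -> bool).

Local Notation L1 P f := (P.-integrable setT (EFin \o f)).
Local Notation E P f := (\int[P]_t f t).
Local Notation ind b := (b%:R : R).

Hypothesis mcell : forall o, measurable_fun setT (fun u => ind (cell u == o)).
Hypothesis ms : measurable_fun setT (fun u => ind (s u)).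

Definition incell k u := cell u == Some k.
Definition insel k u := s u && (cell u == Some k).

Definition total (A : {set 'I_n}) (f : Z -> R) t := \sum_(i in A) f (z i t).
Definition tally A (Q : Z -> bool) t := total A (fun u => ind (Q u)) t.

Lemma measurable_incell k : measurable_fun setT (fun u => ind (incell k u)).
Proof. exact: mcell. Qed.

Lemma measurable_insel k : measurable_fun setT (fun u => ind (insel k u)).
Proof.
rewrite (_ : (fun _ => _) = fun u => ind (s u) * ind (cell u == Some k)).
  exact: measurable_funM.
by apply/funext => u; rewrite /insel -natrM mulnb.
Qed.

Lemma L1_ind (Q : Z -> bool) : measurable_fun setT (fun u => ind (Q u)) ->
  L1 F (fun u => ind (Q u)).
Proof. by move=> mQ; apply: (@L1_bounded _ _ _ F _ 1) => // u; case: (Q u); rewrite ?normr1 ?normr0. Qed.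

Lemma measurable_total A f : measurable_fun setT f -> measurable_fun setT (total A f).
Proof.
move=> mf; rewrite /total; under eq_fun do rewrite big_mkcond/=.
by apply: measurable_sum => i; case: (i \in A) => //; exact: measurableT_comp.
Qed.

Lemma E_one (f : Z -> R) (i : nat) : L1 F f ->
  L1 P (fun t => f (z i t)) /\ E P (fun t => f (z i t)) = E F f.
Proof.
move=> fi.
pose g (j : 'I_i.+1) : Z -> R := if j == ord_max then f else cst 1.
have gi j : L1 F (g j) by rewrite /g; case: eqP => // _; exact: L1_cst.
have gE t : \prod_(j < i.+1) g j (z j t) = f (z i t).
  rewrite (bigD1 ord_max)//= /g eqxx big1 ?mulr1// => j /negPf jn; by rewrite jn.
split; first by under eq_fun do rewrite -gE; exact: (iid_prod_integrable z_iid gi).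
under eq_Rintegral => t _ do rewrite -gE.
rewrite (iid_prod z_iid gi).
rewrite (bigD1 ord_max)//= /g eqxx big1 ?mulr1// => j /negPf ->.
exact: E_cst.
Qed.

Lemma E_total A f : L1 F f ->
  L1 P (total A f) /\ E P (total A f) = #|A|%:R * E F f.
Proof.
move=> fi; split; first by apply: L1_sum => i; have [] := E_one i fi.
rewrite E_sum; last by move=> i; have [] := E_one i fi.
rewrite (eq_bigr (fun=> E F f)); last by move=> i _; have [] := E_one i fi.
by rewrite sumr_const mulr_natl.
Qed.

Definition noise_on (Q : 'I_K -> Z -> bool) (f : Z -> R) (v : R) :=
  [/\ measurable_fun setT f, L1 F (fun u => f u ^+ 2),
      forall k, E F (fun u => f u * ind (Q k u)) = 0,
      forall k, E F (fun u => f u ^+ 2 * ind (Q k u)) <= v * E F (fun u => ind (Q k u)) &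
      forall u, (forall k, ~~ Q k u) -> f u = 0].

(** Inside A only the cell is recorded, elsewhere the selection as well. This is
   what makes a variable centred given the cell alone a legitimate noise on A. *)
Definition cell_bin (A : {set 'I_n}) (l : 'I_n) u : option 'I_K * bool :=
  (cell u, (l \in A) || s u).

Lemma measurable_cell_bin A l b : measurable_fun setT (fun u => ind (cell_bin A l u == b)).
Proof.
case: b => co b.
rewrite (_ : (fun _ => _) = fun u => ind (cell u == co) *
    (if l \in A then ind b else if b then ind (s u) else 1 - ind (s u))).
  apply: measurable_funM => //; case: (l \in A) => //; case: b => //.
  exact: measurable_funB.
apply/funext => u; rewrite /cell_bin xpair_eqE -mulnb natrM; congr (_ * _).
by case: (l \in A); case: (s u); case: b; rewrite ?subrr ?subr0.
Qed.

Let E0 (f : Z -> R) : (forall u, f u = 0) -> E F f = 0.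
Proof. by move=> f0; under eq_Rintegral do rewrite f0; exact: E_cst. Qed.

Lemma incell_bin_noise (A : {set 'I_n}) l f v : 0 <= v -> l \in A ->
  noise_on incell f v -> bin_noise F (cell_bin A) l f v.
Proof.
move=> v0 lA [mf f2 f0 fv fz]; split => // -[co b].
  case: co => [k|]; case: b.
  - rewrite -[RHS](f0 k); apply: eq_Rintegral => u _.
    by rewrite /cell_bin lA/= xpair_eqE andbT.
  - by apply: E0 => u; rewrite /cell_bin lA/= xpair_eqE andbF mulr0.
  - apply: E0 => u; rewrite /cell_bin lA/= xpair_eqE andbT.
    case: (eqVneq (cell u)) => [uN|_]; last by rewrite mulr0.
    by rewrite fz ?mul0r// => k; rewrite /incell uN.
  - by apply: E0 => u; rewrite /cell_bin lA/= xpair_eqE andbF mulr0.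
have [[k ->]|fb] : (exists k, (co, b) = (Some k, true)) \/
    (forall u, f u ^+ 2 * ind (cell_bin A l u == (co, b)) = 0).
  case: co => [k|]; case: b.
  - by left; exists k.
  - by right => u; rewrite /cell_bin lA/= xpair_eqE andbF mulr0.
  - right => u; rewrite /cell_bin lA/= xpair_eqE andbT.
    case: (eqVneq (cell u)) => [uN|_]; last by rewrite mulr0.
    by rewrite fz ?expr0n ?mul0r// => k; rewrite /incell uN.
  - by right => u; rewrite /cell_bin lA/= xpair_eqE andbF mulr0.
  have binE u : (cell_bin A l u == (Some k, true)) = incell k u.
    by rewrite /cell_bin lA xpair_eqE andbT.
  under eq_Rintegral do rewrite binE.
  by under [in leRHS]eq_Rintegral do rewrite binE.
rewrite (E0 fb) mulr_ge0//; apply: E_ge0 => u; exact: ler0n.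
Qed.

Lemma insel_bin_noise (A : {set 'I_n}) l f v : 0 <= v -> l \notin A ->
  noise_on insel f v -> bin_noise F (cell_bin A) l f v.
Proof.
move=> v0 /negPf lA [mf f2 f0 fv fz].
have binE k u : (cell_bin A l u == (Some k, true)) = insel k u.
  by rewrite /cell_bin lA xpair_eqE eqb_id andbC.
have fb u b : (forall k, b <> (Some k, true)) -> f u * ind (cell_bin A l u == b) = 0.
  move=> bk; case: (eqVneq (cell_bin A l u)) => [ub|_]; last by rewrite mulr0.
  rewrite fz ?mul0r// => k; apply/negP; rewrite -binE => /eqP ubk.
  by apply: (bk k); rewrite -ub.
have split_bin (b : option 'I_K * bool) : (exists k, b = (Some k, true)) \/ forall k, b <> (Some k, true).
  case: b => -[k|] []; [by left; exists k|by right|by right|by right].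
split => // b; have [[k ->]|bk] := split_bin b.
- by under eq_Rintegral do rewrite binE.
- by apply: E0 => u; exact: fb.
- under eq_Rintegral do rewrite binE.
  by under [in leRHS]eq_Rintegral do rewrite binE.
- rewrite E0; last by move=> u; rewrite expr2 -mulrA fb// mulr0.
  by rewrite mulr_ge0//; apply: E_ge0 => u; exact: ler0n.
Qed.

(** At most one term of the sum differs from zero. *)
Lemma pick_sum_sqr (J : eqType) (g : 'I_K -> J) (a : J) (y : 'I_K -> R) : injective g ->
  (\sum_k ind (a == g k) * y k) ^+ 2 = \sum_k ind (a == g k) * y k ^+ 2.
Proof.
move=> gi; have [[k ->]|ag] : (exists k, a = g k) \/ forall k, (a == g k) = false.
- have [/existsP[k /eqP ->]|] := boolP [exists k, a == g k]; first by left; exists k.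
  by rewrite negb_exists => /forallP ag; right => k; apply/negbTE; exact: ag.
- have gk l : l != k -> (g k == g l) = false.
    by move=> lk; apply/eqP => /gi kl; rewrite kl eqxx in lk.
  rewrite [in LHS](bigD1 k)//= [in RHS](bigD1 k)//= eqxx !mul1r.
  rewrite big1 ?addr0; last by move=> l lk; rewrite gk// mul0r.
  by rewrite big1 ?addr0// => l lk; rewrite gk// mul0r.
- by rewrite big1 1?big1 ?expr0n// => k _; rewrite ag mul0r.
Qed.

(** Division by a number of observations is under control on this event only, and it
   depends on the sample through the bins, hence can be put into the coefficients. *)
Definition enough (A : {set 'I_n}) (tau : 'I_K -> R) t :=
  [forall k, tau k <= tally A (insel k) t].

Lemma enough_ge A tau t k : enough A tau t -> tau k <= tally A (insel k) t.
Proof. by move/forallP/(_ k). Qed.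

Let bin_tally (A' : {set 'I_n}) (kk : {ffun 'I_n -> option 'I_K * bool}) k : R :=
  \sum_(j in A') ind (kk j == (Some k, true)).

Let bin_enough A' (tau : 'I_K -> R) kk := [forall k, tau k <= bin_tally A' kk k].

Let cell_bin_insel (A : {set 'I_n}) j k u : j \notin A ->
  (cell_bin A j u == (Some k, true)) = insel k u.
Proof. by move=> /negPf jA; rewrite /cell_bin jA xpair_eqE eqb_id andbC. Qed.

Let cell_bin_incell (A : {set 'I_n}) j k u : j \in A ->
  (cell_bin A j u == (Some k, true)) = incell k u.
Proof. by move=> jA; rewrite /cell_bin jA xpair_eqE andbT. Qed.

Let bin_tallyE (A A' : {set 'I_n}) k t : (forall j, j \in A' -> j \notin A) ->
  bin_tally A' (bins z (cell_bin A) t) k = tally A' (insel k) t.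
Proof.
by move=> AA'; apply: eq_bigr => j jA'; rewrite ffunE cell_bin_insel// AA'.
Qed.

Let bin_enoughE (A A' : {set 'I_n}) tau t : (forall j, j \in A' -> j \notin A) ->
  bin_enough A' tau (bins z (cell_bin A) t) = enough A' tau t.
Proof. by move=> AA'; apply: eq_forallb => k; rewrite bin_tallyE. Qed.

Lemma L1_tally A (Q : Z -> bool) : measurable_fun setT (fun u => ind (Q u)) ->
  L1 P (tally A Q).
Proof. by move=> mQ; have [] := E_total A (L1_ind mQ). Qed.

Lemma E_tally A (Q : Z -> bool) : measurable_fun setT (fun u => ind (Q u)) ->
  E P (tally A Q) = #|A|%:R * E F (fun u => ind (Q u)).
Proof. by move=> mQ; have [] := E_total A (L1_ind mQ). Qed.

(** Given the bins, products of noises from different observations are orthogonal,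
   so that the contributions of the K cells add up in the variance and not in the
   standard deviation. *)
Lemma cross_noise_moment (A A' : {set 'I_n}) (b f : Z -> R) (v w : R) (tau : 'I_K -> R) :
  (forall j, j \in A' -> j \notin A) -> 0 <= v -> 0 <= w ->
  noise_on incell b v -> noise_on insel f w -> (forall k, 0 < tau k) ->
  let X t := \sum_k ind (enough A' tau t) *
    (total A (fun u => ind (incell k u) * b u) t *
     total A' (fun u => ind (insel k u) * f u) t / tally A' (insel k) t) in
  L1 P (fun t => X t ^+ 2) /\
  E P (fun t => X t ^+ 2) <= v * w * \sum_k #|A|%:R * E F (fun u => ind (incell k u)) / tau k.
Proof.
move=> AA' v0 w0 bn fn tau0 X.
pose c (p : 'I_n * 'I_n) (kk : {ffun 'I_n -> option 'I_K * bool}) : R :=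
  \sum_k ind (kk p.1 == (Some k, true)) *
    (ind (bin_enough A' tau kk) * (ind (kk p.2 == (Some k, true)) / bin_tally A' kk k)).
pose Q (p : 'I_n * 'I_n) := (p.1 \in A) && (p.2 \in A').
have XE t : X t = \sum_(p | Q p) c p (bins z (cell_bin A) t) * (b (z p.1 t) * f (z p.2 t)).
  transitivity (\sum_k \sum_(p | Q p) ind (enough A' tau t) *
     (ind (incell k (z p.1 t)) * ind (insel k (z p.2 t)) / tally A' (insel k) t *
      (b (z p.1 t) * f (z p.2 t)))).
    apply: eq_bigr => k _; rewrite -mulr_sumr; congr (_ * _).
    rewrite /total big_distrlr/= pair_big_dep/= mulr_suml.
    by apply: eq_bigr => p _; ring.
  rewrite exchange_big/=; apply: eq_bigr => p /andP[pA pA']; rewrite mulr_suml.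
  apply: eq_bigr => k _.
  rewrite bin_enoughE// bin_tallyE// !ffunE cell_bin_incell// cell_bin_insel ?AA'//.
  ring.
have [X2 EX] := bilinear_sum_moment z_iid (measurable_cell_bin A) c AA'
  (fun j jA => incell_bin_noise v0 jA bn) (fun j jA => insel_bin_noise w0 (AA' j jA) fn).
split; first by under eq_fun do rewrite XE.
under eq_Rintegral => t _ do rewrite XE.
apply: le_trans EX _; rewrite -mulr_sumr ler_wpM2l ?mulr_ge0//.
rewrite -E_sum; last first.
  by move=> p; exact: (L1_bins z (measurable_cell_bin A) (fun kk => c p kk ^+ 2)).
have rhsE : \sum_k #|A|%:R * E F (fun u => ind (incell k u)) / tau k =
    E P (fun t => \sum_k (tau k)^-1 * tally A (incell k) t).
  rewrite E_sum; last by move=> k; apply: L1Z; apply: L1_tally; exact: measurable_incell.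
  apply: eq_bigr => k _; rewrite EZ; last by apply: L1_tally; exact: measurable_incell.
  by rewrite E_tally; [rewrite mulrC|exact: measurable_incell].
rewrite rhsE; apply: E_le.
- apply: L1_sum => p.
  exact: (L1_bins z (measurable_cell_bin A) (fun kk => c p kk ^+ 2)).
- by apply: L1_sum => k; apply: L1Z; apply: L1_tally; exact: measurable_incell.
move=> t.
have injS : injective (fun k : 'I_K => (Some k, true)) by move=> k l [].
under eq_bigr => p Qp.
  rewrite (pick_sum_sqr _ _ injS).
  under eq_bigr => k _.
    rewrite bin_enoughE// bin_tallyE// !ffunE.
    have /andP[p1 p2] := Qp.
    rewrite cell_bin_incell// cell_bin_insel ?AA'//.
    over.
  over.
rewrite exchange_big/=; apply: ler_sum => k _.
rewrite -(pair_big_dep (mem A) (fun _ => mem A') (fun i j =>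
  ind (incell k (z i t)) * (ind (enough A' tau t) *
     (ind (insel k (z j t)) / tally A' (insel k) t)) ^+ 2))/=.
rewrite mulrC /tally {2}/total mulr_suml; apply: ler_sum => i _.
rewrite -mulr_sumr ler_wpM2l ?ler0n// -/(tally A' (insel k) t).
have [en|_] := boolP (enough A' tau t); last first.
  under eq_bigr do rewrite mul0r expr0n.
  by rewrite sumr_const mul0rn invr_ge0 ltW.
under eq_bigr do rewrite mul1r exprMn.
rewrite -mulr_suml.
under eq_bigr do rewrite -natrX -mulnn mulnb andbb.
rewrite -[\sum_(_ in _) _]/(tally A' (insel k) t).
have taum := enough_ge k en; have m0 := lt_le_trans (tau0 k) taum.
rewrite expr2 mulrA divff ?gt_eqF// mul1r lef_pV2 ?posrE//.
Qed.

(** Given the bins the weights V are constants and the noises of different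
   observations are orthogonal, so that again the cells contribute separately. *)
Lemma averaged_noise_moment (A' : {set 'I_n}) (f : Z -> R) (w : R) (tau : 'I_K -> R)
    (V : 'I_K -> T -> R) :
  0 <= w -> noise_on insel f w -> (forall k, 0 < tau k) ->
  (forall k, exists Vk, forall t, V k t = Vk (bins z (cell_bin finset.set0) t)) ->
  let X t := \sum_k ind (enough A' tau t) *
    (V k t * total A' (fun u => ind (insel k u) * f u) t / tally A' (insel k) t) in
  L1 P (fun t => X t ^+ 2) /\
  E P (fun t => X t ^+ 2) <= w * \sum_k E P (fun t => V k t ^+ 2) / tau k.
Proof.
move=> w0 fn tau0 /choice[Vb VE] X.
have AA' j : j \in A' -> j \notin (finset.set0 : {set 'I_n}) by rewrite finset.inE.
have in0 (j : 'I_n) : j \notin finset.set0 by rewrite finset.inE.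
pose c (j : 'I_n) (kk : {ffun 'I_n -> option 'I_K * bool}) : R :=
  \sum_k ind (kk j == (Some k, true)) *
    (ind (bin_enough A' tau kk) * (Vb k kk / bin_tally A' kk k)).
have mb := measurable_cell_bin finset.set0.
have XE t : X t = \sum_(j in A') c j (bins z (cell_bin finset.set0) t) * f (z j t).
  transitivity (\sum_k \sum_(j in A') ind (enough A' tau t) *
     (ind (insel k (z j t)) * V k t / tally A' (insel k) t * f (z j t))).
    apply: eq_bigr => k _; rewrite -mulr_sumr; congr (_ * _).
    rewrite /total mulr_sumr mulr_suml.
    by apply: eq_bigr => p _; ring.
  rewrite exchange_big/=; apply: eq_bigr => j jA'; rewrite mulr_suml.
  apply: eq_bigr => k _.
  rewrite bin_enoughE// bin_tallyE// !ffunE cell_bin_insel// VE.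
  ring.
have [X2 EX] := linear_sum_moment z_iid mb c
  (fun j (_ : j \in A') => insel_bin_noise w0 (in0 j) fn).
split; first by under eq_fun do rewrite XE.
under eq_Rintegral => t _ do rewrite XE.
apply: le_trans EX _; rewrite -mulr_sumr ler_wpM2l//.
rewrite -E_sum; last first.
  by move=> p; exact: (L1_bins z mb (fun kk => c p kk ^+ 2)).
have V2 k : L1 P (fun t => V k t ^+ 2).
  by under eq_fun do rewrite VE; exact: (L1_bins z mb (fun kk => Vb k kk ^+ 2)).
have rhsE : \sum_k E P (fun t => V k t ^+ 2) / tau k =
    E P (fun t => \sum_k (tau k)^-1 * V k t ^+ 2).
  rewrite E_sum; last by move=> k; apply: L1Z.
  by apply: eq_bigr => k _; rewrite EZ// mulrC.
rewrite rhsE; apply: E_le.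
- by apply: L1_sum => p; exact: (L1_bins z mb (fun kk => c p kk ^+ 2)).
- by apply: L1_sum => k; apply: L1Z.
move=> t.
have injS : injective (fun k : 'I_K => (Some k, true)) by move=> k l [].
under eq_bigr => j jA'.
  rewrite (pick_sum_sqr _ _ injS).
  under eq_bigr => k _.
    rewrite bin_enoughE// bin_tallyE// !ffunE cell_bin_insel// -VE.
    over.
  over.
rewrite exchange_big/=; apply: ler_sum => k _.
rewrite -mulr_suml -[\sum_(_ in _) _]/(tally A' (insel k) t).
have [en|_] := boolP (enough A' tau t); last first.
  by rewrite mul0r expr0n mulr0 mulr_ge0 ?sqr_ge0// invr_ge0 ltW.
have taum := enough_ge k en; have m0 := lt_le_trans (tau0 k) taum.
rewrite mul1r exprMn mulrCA mulrC ler_wpM2r ?sqr_ge0//.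
rewrite expr2 mulrA divff ?gt_eqF// mul1r lef_pV2 ?posrE//.
Qed.

(** A Chernoff bound, from the exponential moment of minus the tally. *)
Lemma tally_lower_tail (A : {set 'I_n}) (Q : Z -> bool) (mu : R) :
  measurable_fun setT (fun u => ind (Q u)) ->
  E F (fun u => ind (Q u)) = mu ->
  (P [set t | (tally A Q t <= #|A|%:R * mu / 4)%R] <=
     (expR (- (#|A|%:R * mu / 4)))%:E)%E.
Proof.
move=> mQ muE.
pose g (j : 'I_n) (u : Z) : R := if j \in A then 1 - (1 - expR (-1)) * ind (Q u) else 1.
have gi j : L1 F (g j).
  rewrite /g; case: (j \in A); last exact: L1_cst.
  under eq_fun do rewrite -mulNr; apply: L1D; first exact: L1_cst.
  by apply: L1Z; exact: L1_ind.
have gE t : \prod_j g j (z j t) = expR (- tally A Q t).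
  rewrite /tally /total -sumrN expR_sum [RHS]big_mkcond/=; apply: eq_bigr => j _.
  rewrite /g; case: (j \in A) => //; case: (Q _); rewrite ?mulr1 ?mulr0.
    by rewrite opprB addrC subrK.
  by rewrite subr0 oppr0 expR0.
have Ei : L1 P (fun t => expR (- tally A Q t)).
  by under eq_fun do rewrite -gE; exact: (iid_prod_integrable z_iid gi).
have EE : E P (fun t => expR (- tally A Q t)) <= expR (- (#|A|%:R * mu / 2)).
  under eq_Rintegral => t _ do rewrite -gE.
  rewrite (iid_prod z_iid gi).
  have -> : expR (- (#|A|%:R * mu / 2)) = \prod_(j in A) expR (- (mu / 2)).
    by rewrite -expR_sum sumr_const; congr expR; rewrite mulNrn -[mu / 2 *+ _]mulr_natl mulrA.
  rewrite [leRHS]big_mkcond/=; apply: ler_prod => j _; rewrite /g.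
  have e1 : 0 < expR (-1) :> R by exact: expR_gt0.
  have e2 : expR (-1) <= 2^-1 :> R.
    rewrite expRN lef_pV2 ?posrE ?expR_gt0//.
    by have := @expR_ge1Dx R 1; lra.
  case: (j \in A); last by rewrite E_cst ler01 lexx.
  apply/andP; split.
    by apply: E_ge0 => u; case: (Q u); rewrite ?mulr1 ?mulr0; lra.
  under eq_Rintegral do rewrite -mulNr.
  rewrite ED; [|exact: L1_cst|by apply: L1Z; exact: L1_ind].
  rewrite E_cst EZ; last exact: L1_ind.
  have mu0 : 0 <= mu by rewrite -muE; apply: E_ge0 => u; exact: ler0n.
  (* 1 - (1 - 1/e) mu <= 1 - mu/2 <= exp (- mu/2), as e >= 2. *)
  apply: le_trans (expR_ge1Dx _).
  rewrite muE; nra.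
have := markov_ineq Ei (fun t => expR_ge0 _) (expR_gt0 (- (#|A|%:R * mu / 4))).
rewrite (_ : [set t | _] = [set t | (tally A Q t <= #|A|%:R * mu / 4)%R]); last first.
  by apply/seteqP; split => t /=; rewrite ler_expR lerN2.
move=> /le_trans; apply; rewrite lee_fin ler_pdivrMr ?expR_gt0// -expRD.
apply: le_trans EE _; rewrite ler_expR; lra.
Qed.

End cell_averages.

(** * The estimation error of a regressogram *)

Lemma sum_partition (R : realType) n L (I : 'I_L -> {set 'I_n}) (x : 'I_n -> R) :
  (forall i, exists2 l, i \in I l & forall l', i \in I l' -> l' = l) ->
  \sum_l \sum_(i in I l) x i = \sum_i x i.
Proof.
move=> I_part; under eq_bigr do rewrite big_mkcond/=.
rewrite exchange_big/=; apply: eq_bigr => i _.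
have [l il lu] := I_part i; rewrite (bigD1 l)//= il big1 ?addr0// => l' ll'.
by case: ifPn => // /lu ll; rewrite ll eqxx in ll'.
Qed.

Section remainder.
Context (R : realType) d d' (T : measurableType d) (Z : measurableType d').
Variables (P : probability T R) (F : probability Z R) (z : nat -> {RV P >-> Z}).
Hypothesis z_iid : iid F z.
Variables (n K : nat) (cell : Z -> option 'I_K) (s : Z -> bool).

Local Notation L1 P f := (P.-integrable setT (EFin \o f)).
Local Notation E P f := (\int[P]_t f t).
Local Notation ind b := (b%:R : R).
Local Notation incell := (incell cell).
Local Notation insel := (insel cell s).
Local Notation total := (total (n := n) z).
Local Notation tally := (tally (n := n) z).
Local Notation enough := (enough (n := n) z cell s).

Hypothesis mcell : forall o, measurable_fun setT (fun u => ind (cell u == o)).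
Hypothesis ms : measurable_fun setT (fun u => ind (s u)).

Definition on_cells (f : 'I_K -> Z -> R) u := \sum_k ind (incell k u) * f k u.

Lemma on_cells_in f u k : cell u = Some k -> on_cells f u = f k u.
Proof.
move=> uk; rewrite /on_cells (bigD1 k)//= /incell uk eqxx mul1r big1 ?addr0// => l lk.
by case: eqP => [[kl]|_]; [rewrite kl eqxx in lk|rewrite mul0r].
Qed.

Lemma on_cells_out f u : cell u = None -> on_cells f u = 0.
Proof. by move=> uk; rewrite /on_cells big1// => k _; rewrite /incell uk mul0r. Qed.

Lemma on_cells_ind f k u : on_cells f u * ind (incell k u) = f k u * ind (incell k u).
Proof.
rewrite /incell; case: eqP => [uk|_]; last by rewrite !mulr0.
by rewrite (on_cells_in _ uk).
Qed.

Lemma measurable_on_cells f : (forall k, measurable_fun setT (f k)) ->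
  measurable_fun setT (on_cells f).
Proof.
move=> mf; apply: measurable_sum => k; apply: measurable_funM => //.
exact: mcell.
Qed.

Lemma on_cells_bounded f c u : 0 <= c ->
  (forall k, cell u = Some k -> `|f k u| <= c) -> `|on_cells f u| <= c.
Proof.
move=> c0 fc; case uE : (cell u) => [k|]; last by rewrite on_cells_out ?normr0.
by rewrite (on_cells_in _ uE) fc.
Qed.

Lemma L1_ind_mul (Q : Z -> bool) f : measurable_fun setT (fun u => ind (Q u)) ->
  L1 F f -> L1 F (fun u => ind (Q u) * f u).
Proof.
move=> mQ fi; apply: (L1_dominated (g := fun u => `|f u|)).
- by apply: measurable_funM => //; exact: L1_measurable fi.
- exact: integrable_norm.
- by move=> u; case: (Q u); rewrite ?mul1r ?mul0r ?normr0.
Qed.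

Lemma E_on_cells f : (forall k, L1 F (f k)) ->
  L1 F (on_cells f) /\ E F (on_cells f) = \sum_k E F (fun u => ind (incell k u) * f k u).
Proof.
move=> fi.
have ki k : L1 F (fun u => ind (incell k u) * f k u).
  by apply: L1_ind_mul => //; exact: mcell.
by split; [exact: L1_sum|rewrite E_sum].
Qed.

Variables (y h gam alp : Z -> R) (c1 Ce Ch Cg Ca dg da : R).
Local Notation p k := (E F (fun u => ind (incell k u))).
Local Notation mu k := (E F (fun u => ind (insel k u))).

Definition eps := on_cells (fun _ u => ind (s u) * (y u - gam u)).

(** One design for the three examples. The regression uses the observations selected
   by s; h multiplies the value of the regression function in the moment condition
   that defines the parameter; alp is its Riesz representer, which satisfies
   E[h g] = E[alp s g] for functions g of the covariates. This identity is required
   for the indicator functions of the cells and for their products with gam. The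
   last fields say that selected observations are found in every cell. *)
Record regression_design : Prop := RegressionDesign {
  rd_my : measurable_fun setT y;
  rd_mh : measurable_fun setT h;
  rd_mgam : measurable_fun setT gam;
  rd_malp : measurable_fun setT alp;
  rd_gam : forall u, `|gam u| <= Cg;
  rd_alp : forall u, `|alp u| <= Ca;
  rd_gam_osc : forall u v k, cell u = Some k -> cell v = Some k -> `|gam u - gam v| <= dg;
  rd_alp_osc : forall u v k, cell u = Some k -> cell v = Some k -> `|alp u - alp v| <= da;
  rd_dg : 0 <= dg;
  rd_da : 0 <= da;
  rd_eps2 : L1 F (fun u => eps u ^+ 2);
  rd_eps : forall k, E F (fun u => ind (incell k u) * eps u) = 0;
  rd_eps_alp : forall k, E F (fun u => ind (incell k u) * (alp u * eps u)) = 0;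
  rd_eps_var : forall k, E F (fun u => ind (incell k u) * eps u ^+ 2) <= Ce * p k;
  rd_eps_var1 : E F (fun u => eps u ^+ 2) <= Ce;
  rd_h2 : L1 F (fun u => h u ^+ 2);
  rd_h_var : forall k, E F (fun u => ind (incell k u) * h u ^+ 2) <= Ch * p k;
  rd_h_var1 : E F (fun u => h u ^+ 2) <= Ch;
  rd_riesz : forall k, E F (fun u => ind (incell k u) * h u) =
                       E F (fun u => ind (insel k u) * alp u);
  rd_riesz_gam : forall k, E F (fun u => ind (incell k u) * (h u * gam u)) =
                           E F (fun u => ind (insel k u) * (alp u * gam u));
  rd_c1 : 0 < c1;
  rd_p : forall k, 0 < p k;
  rd_mu : forall k, c1 * p k <= mu k }.

Hypothesis design : regression_design.

Let my := rd_my design.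
Let mh := rd_mh design.
Let mgam := rd_mgam design.
Let malp := rd_malp design.

Let min_ k : measurable_fun setT (fun u => ind (incell k u)).
Proof. exact: mcell. Qed.

Let msel k : measurable_fun setT (fun u => ind (insel k u)).
Proof. exact: measurable_insel. Qed.

Let bounded_sqr (g : Z -> R) c : measurable_fun setT g -> (forall u, `|g u| <= c) ->
  L1 F (fun u => g u ^+ 2).
Proof.
move=> mg gam_avg; apply: (@L1_bounded _ _ _ F _ (c ^+ 2)); first exact: measurable_funX.
by move=> u; rewrite normrX lerXn2r// nnegrE (le_trans (normr_ge0 (g u))).
Qed.

Let p_le1 k : p k <= 1.
Proof.
rewrite -[leRHS](E_cst F 1); apply: E_le; [exact: L1_ind|exact: L1_cst|].
by move=> u; case: (incell _ _); rewrite ?ler01.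
Qed.

Let mu_le_p k : mu k <= p k.
Proof.
apply: E_le; [exact: L1_ind|exact: L1_ind|].
by move=> u; rewrite /insel /incell; case: (s u) => //=; exact: ler0n.
Qed.

Let mu_gt0 k : 0 < mu k.
Proof.
apply: lt_le_trans (rd_mu design k).
by rewrite mulr_gt0 ?(rd_c1 design) ?(rd_p design).
Qed.

Let mu_neq0 k : mu k != 0. Proof. by rewrite gt_eqF. Qed.
Let p_neq0 k : p k != 0. Proof. by rewrite gt_eqF// (rd_p design). Qed.

Let Cg0 : 0 <= Cg.
Proof.
have [u _] : exists u : Z, True.
  apply: contrapT => /forallNP noZ; have := @probability_setT _ _ _ F.
  rewrite (_ : setT = set0) ?measure0; last by apply/seteqP; split => // u; have := noZ u.
  by move=> [] /eqP; rewrite eq_sym oner_eq0.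
exact: le_trans (normr_ge0 _) (rd_gam design u).
Qed.

Let Ca0 : 0 <= Ca.
Proof.
have [u _] : exists u : Z, True.
  apply: contrapT => /forallNP noZ; have := @probability_setT _ _ _ F.
  rewrite (_ : setT = set0) ?measure0; last by apply/seteqP; split => // u; have := noZ u.
  by move=> [] /eqP; rewrite eq_sym oner_eq0.
exact: le_trans (normr_ge0 _) (rd_alp design u).
Qed.

Let L1in k f : L1 F f -> L1 F (fun u => ind (incell k u) * f u).
Proof. exact: L1_ind_mul. Qed.

Let L1sel k f : L1 F f -> L1 F (fun u => ind (insel k u) * f u).
Proof. exact: L1_ind_mul. Qed.

Let gami : L1 F gam.
Proof. exact: L1_bounded (rd_gam design). Qed.

Let alpi : L1 F alp.
Proof. exact: L1_bounded (rd_alp design). Qed.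

Let hi : L1 F h.
Proof. exact: L1_sqr (rd_h2 design). Qed.

Let h0 (f : Z -> R) (g : Z -> R) : f =1 g -> E F f = E F g.
Proof. by move=> fg; apply: eq_Rintegral => u _; rewrite fg. Qed.

(** The denominators differ: h is averaged over all observations of the cell, gam
   over the selected ones. By the Riesz identity alp_avg is the average of alp over
   the selected observations of the cell. *)
Definition gam_avg k := E F (fun u => ind (insel k u) * gam u) / mu k.
Definition h_avg k := E F (fun u => ind (incell k u) * h u) / p k.
Definition alp_avg k := E F (fun u => ind (incell k u) * h u) / mu k.

Let sel_avg_osc (g : Z -> R) e k u : L1 F g -> 0 <= e -> cell u = Some k ->
  (forall v, cell v = Some k -> `|g u - g v| <= e) ->
  `|g u - E F (fun v => ind (insel k v) * g v) / mu k| <= e.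
Proof.
move=> ig e0 uk osc; rewrite -[X in X <= _](mulfK (mu_neq0 k)).
rewrite ler_pdivrMr// -[X in _ * X](gtr0_norm (mu_gt0 k)) -normrM mulrBl divfK ?gt_eqF//.
rewrite -EZ; last exact: L1_ind.
rewrite -RintegralB//; [|by apply: L1Z; exact: L1_ind|exact: L1sel].
apply: le_trans (le_normr_Rintegral _ _) _ => //.
  by apply: L1B; [apply: L1Z; exact: L1_ind|exact: L1sel].
rewrite -EZ; last exact: L1_ind.
apply: E_le.
- apply: integrable_norm.
  by apply: L1B; [apply: L1Z; exact: L1_ind|exact: L1sel].
- by apply: L1Z; exact: L1_ind.
move=> v; rewrite mulrC -mulrBr normrM ger0_norm ?ler0n// mulrC.
have [/andP[_ /eqP vk]|_] := boolP (insel k v); last by rewrite !mulr0.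
by rewrite !mulr1 osc.
Qed.

Let sel_avg_bound (g : Z -> R) c k : L1 F g -> (forall u, `|g u| <= c) ->
  `|E F (fun v => ind (insel k v) * g v) / mu k| <= c.
Proof.
move=> ig gc_; rewrite normrM normfV (gtr0_norm (mu_gt0 k)) ler_pdivrMr//.
apply: le_trans (le_normr_Rintegral _ _) _ => //; first exact: L1sel.
rewrite -EZ; last exact: L1_ind.
apply: E_le.
- by apply: integrable_norm => //; exact: L1sel.
- by apply: L1Z; exact: L1_ind.
by move=> v; rewrite normrM ger0_norm ?ler0n// mulrC ler_wpM2r ?ler0n.
Qed.

Let gc_osc k u : cell u = Some k -> `|gam u - gam_avg k| <= dg.
Proof.
move=> uk; apply: sel_avg_osc => //; first exact: rd_dg design.
by move=> v vk; exact: rd_gam_osc design _ _ _ uk vk.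
Qed.

Let ac_osc k u : cell u = Some k -> `|alp u - alp_avg k| <= da.
Proof.
move=> uk; rewrite /alp_avg rd_riesz//; apply: sel_avg_osc => //; first exact: rd_da design.
by move=> v vk; exact: rd_alp_osc design _ _ _ uk vk.
Qed.

Let ac_bound k : `|alp_avg k| <= Ca.
Proof. by rewrite /alp_avg rd_riesz//; apply: sel_avg_bound => //; exact: rd_alp design. Qed.

Let gc_bound k : `|gam_avg k| <= Cg.
Proof. by apply: sel_avg_bound => //; exact: rd_gam design. Qed.

Let hc_ac k : h_avg k * p k = alp_avg k * mu k.
Proof. by rewrite /h_avg /alp_avg !divfK ?gt_eqF ?(rd_p design). Qed.

Let hc_bound k : `|h_avg k| <= Ca.
Proof.
have pk := rd_p design k.
rewrite -[h_avg k](mulfK (p_neq0 k)) hc_ac normrM normfV (gtr0_norm pk).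
by rewrite ler_pdivrMr// normrM (gtr0_norm (mu_gt0 k)) ler_pM ?normr_ge0 ?(ltW (mu_gt0 k)).
Qed.

Let sqr_le (x c : R) : 0 <= c -> `|x| <= c -> x ^+ 2 <= c ^+ 2.
Proof. by move=> c0 xc; rewrite -[x ^+ 2]real_normK ?num_real// lerXn2r. Qed.

Definition gam_dev := on_cells (fun k u => gam u - gam_avg k).
Definition alp_dev := on_cells (fun k u => alp u - alp_avg k).
Definition h_dev := on_cells (fun k u => h u - h_avg k).
Definition y_dev := on_cells (fun k u => ind (s u) * (y u - gam_avg k)).

Let mgt : measurable_fun setT gam_dev.
Proof. by apply: measurable_on_cells => k; exact: measurable_funB. Qed.

Let mat : measurable_fun setT alp_dev.
Proof. by apply: measurable_on_cells => k; exact: measurable_funB. Qed.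

Let mht : measurable_fun setT h_dev.
Proof. by apply: measurable_on_cells => k; exact: measurable_funB. Qed.

Let myt : measurable_fun setT y_dev.
Proof.
by apply: measurable_on_cells => k; apply: measurable_funM => //; exact: measurable_funB.
Qed.

Let meps : measurable_fun setT eps.
Proof.
by apply: measurable_on_cells => k; apply: measurable_funM => //; exact: measurable_funB.
Qed.

Let gam_dev_osc u : `|gam_dev u| <= dg.
Proof. by apply: on_cells_bounded => [|k uk]; [exact: rd_dg design|exact: gc_osc]. Qed.

Let alp_dev_osc u : `|alp_dev u| <= da.
Proof. by apply: on_cells_bounded => [|k uk]; [exact: rd_da design|exact: ac_osc]. Qed.

Let gam_dev_bound u : `|gam_dev u| <= 2 * Cg.
Proof.
apply: on_cells_bounded => [|k uk]; first by rewrite mulr_ge0.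
apply: le_trans (ler_normB _ _) _; rewrite mulr2n mulrDl mul1r lerD//.
exact: rd_gam design _.
Qed.

Let y_devE u : y_dev u = eps u + ind (s u) * gam_dev u.
Proof.
rewrite /y_dev /eps /gam_dev; case uE : (cell u) => [k|].
  by rewrite !(on_cells_in _ uE); ring.
by rewrite !on_cells_out// mulr0 addr0.
Qed.

Let gt_sel k : E F (fun u => ind (insel k u) * gam_dev u) = 0.
Proof.
rewrite (h0 (g := fun u => ind (insel k u) * gam u + (- gam_avg k) * ind (insel k u))); last first.
  move=> u; have [/andP[_ /eqP uk]|_] := boolP (insel k u).
    by rewrite /gam_dev (on_cells_in _ uk); ring.
  by rewrite !mul0r mulr0 addr0.
rewrite ED; [|exact: L1sel|by apply: L1Z; exact: L1_ind].
rewrite EZ; last exact: L1_ind.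
by rewrite /gam_avg mulNr divfK ?subrr// gt_eqF.
Qed.

Let ht_noise : noise_on F incell h_dev Ch.
Proof.
have ht2 : L1 F (fun u => h_dev u ^+ 2).
  apply: (L1_dominated (g := fun u => 2 * (h u ^+ 2 + Ca ^+ 2))).
  - exact: measurable_funX.
  - by apply: L1Z; apply: L1D; [exact: rd_h2 design|exact: L1_cst].
  - move=> u; rewrite ger0_norm ?sqr_ge0// /h_dev.
    have C2 := sqr_ge0 Ca; have H2 := sqr_ge0 (h u).
    case uE : (cell u) => [k|]; last by rewrite on_cells_out// expr0n/= mulr_ge0// addr_ge0.
    rewrite (on_cells_in _ uE); have := sqr_le Ca0 (hc_bound k).
    by have := sqr_ge0 (h u + h_avg k); set x := h u; set v := h_avg k; set w := Ca ^+ 2; nra.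
split => //.
- move=> k; under eq_Rintegral do rewrite on_cells_ind.
  rewrite (h0 (g := fun u => ind (incell k u) * h u + (- h_avg k) * ind (incell k u))); last first.
    by move=> u; ring.
  rewrite ED; [|exact: L1in|by apply: L1Z; exact: L1_ind].
  rewrite EZ; last exact: L1_ind.
  by rewrite /h_avg mulNr divfK ?subrr// gt_eqF ?(rd_p design).
- move=> k; apply: le_trans (rd_h_var design k).
  rewrite (h0 (g := fun u => ind (incell k u) * h u ^+ 2 +
     ((- (2 * h_avg k)) * (ind (incell k u) * h u) + h_avg k ^+ 2 * ind (incell k u)))); last first.
    move=> u; rewrite /incell; case: (eqVneq (cell u)) => [uk|_].
      by rewrite /h_dev (on_cells_in _ uk); ring.
    by rewrite mulr0 !mul0r !mulr0 !addr0.
  have i1 : L1 F (fun u => - (2 * h_avg k) * (ind (incell k u) * h u)) by apply: L1Z; exact: L1in.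
  have i2 : L1 F (fun u => h_avg k ^+ 2 * ind (incell k u)) by apply: L1Z; exact: L1_ind.
  rewrite ED; [|exact/L1in/(rd_h2 design)|exact: L1D].
  rewrite ED// EZ; last exact: L1in.
  rewrite EZ; last exact: L1_ind.
  rewrite -(divfK (p_neq0 k) (E F (fun u => _ * h u))) -/(h_avg k).
  rewrite gerDl; have := sqr_ge0 (h_avg k); have := rd_p design k.
  set x := h_avg k; set q := p k; nra.
- move=> u uN; rewrite /h_dev on_cells_out//; case uE : (cell u) => [k|//].
  by have := uN k; rewrite /incell uE eqxx.
Qed.

Definition dev_var := 2 * Ce / c1 + 8 * Cg ^+ 2.

Let yt_noise : noise_on F insel y_dev dev_var.
Proof.
have ytle u : y_dev u ^+ 2 <= 2 * eps u ^+ 2 + 8 * Cg ^+ 2 * ind (s u).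
  rewrite y_devE; have := sqr_le _ (gam_dev_bound u); rewrite mulr_ge0// => /(_ isT).
  have := sqr_ge0 (eps u - ind (s u) * gam_dev u).
  by case: (s u); rewrite ?mulr1 ?mulr0 ?mul1r ?mul0r; set x := eps u; set v := gam_dev u; set w := Cg; nra.
have yt2 : L1 F (fun u => y_dev u ^+ 2).
  apply: (L1_dominated (g := fun u => 2 * eps u ^+ 2 + 8 * Cg ^+ 2 * ind (s u))).
  - exact: measurable_funX.
  - by apply: L1D; apply: L1Z; [exact: rd_eps2 design|exact: L1_ind].
  - by move=> u; rewrite ger0_norm ?sqr_ge0.
have epsi : L1 F eps by apply: L1_sqr => //; exact: rd_eps2 design.
split => //.
- move=> k.
  rewrite (h0 (g := fun u => ind (incell k u) * eps u + ind (insel k u) * gam_dev u)); last first.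
    move=> u; rewrite y_devE /insel /incell mulrDl.
    case uE : (cell u == Some k); rewrite ?andbT ?andbF ?mulr0 ?mul0r ?mul1r ?addr0//.
    case sE : (s u); rewrite ?mulr1 ?mul1r ?mul0r ?mulr0//.
    by rewrite /eps (on_cells_in _ (eqP uE)) sE mul0r.
  rewrite ED; [|exact: L1in|]; last first.
    by apply: L1sel; apply: (@L1_bounded _ _ _ F _ dg).
  by rewrite gt_sel rd_eps// addr0.
- move=> k.
  apply: (@le_trans _ _ (E F (fun u => 2 * (ind (incell k u) * eps u ^+ 2) +
      8 * Cg ^+ 2 * ind (insel k u)))).
    apply: E_le.
    + by under eq_fun do rewrite mulrC; apply: L1sel.
    + by apply: L1D; apply: L1Z; [exact/L1in/(rd_eps2 design)|exact: L1_ind].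
    move=> u; rewrite /insel /incell; have := ytle u.
    have e2 := sqr_ge0 (eps u).
    case: (cell u == Some k); rewrite ?andbT ?andbF ?mulr0 ?mul0r ?mulr0 ?addr0 ?mul1r//.
    by case: (s u); rewrite ?mulr1 ?mulr0 ?addr0// mulr_ge0.
  rewrite ED; [|by apply: L1Z; exact/L1in/(rd_eps2 design)|by apply: L1Z; exact: L1_ind].
  rewrite EZ; last exact/L1in/(rd_eps2 design).
  rewrite EZ; last exact: L1_ind.
  rewrite /dev_var [leRHS]mulrDl; apply: lerD; last by [].
  rewrite -!mulrA ler_wpM2l//.
  apply: le_trans (rd_eps_var design k) _.
  have Ce0 : 0 <= Ce by apply: le_trans (rd_eps_var1 design); apply: E_ge0 => u; exact: sqr_ge0.
  rewrite ler_wpM2l// mulrC ler_pdivlMr ?(rd_c1 design)// mulrC; exact: rd_mu design k.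
- move=> u uN; rewrite y_devE; case uE : (cell u) => [k|].
    have := uN k; rewrite /insel uE eqxx andbT => /negPf sE.
    by rewrite /eps (on_cells_in _ uE) sE !mul0r addr0.
  by rewrite /eps /gam_dev !on_cells_out// mulr0 addr0.
Qed.

Definition cell_mean A k t := total A (fun u => ind (insel k u) * y u) t / tally A (insel k) t.

Let totalD A (f g : Z -> R) t : total A (fun u => f u + g u) t = total A f t + total A g t.
Proof. by rewrite /total big_split. Qed.

Let totalZ A (f : Z -> R) c t : total A (fun u => c * f u) t = c * total A f t.
Proof. by rewrite /total mulr_sumr. Qed.

Let eq_total A (f g : Z -> R) t : f =1 g -> total A f t = total A g t.
Proof. by move=> fg; apply: eq_bigr => i _; rewrite fg. Qed.

Let total_h A k t : total A (fun u => ind (incell k u) * h u) t =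
  total A (fun u => ind (incell k u) * h_dev u) t + h_avg k * tally A (incell k) t.
Proof.
rewrite -totalZ -totalD; apply: eq_total => u.
rewrite mulrC -[in RHS](mulrC (h_dev u)) /h_dev on_cells_ind; ring.
Qed.

Let total_y A k t : total A (fun u => ind (insel k u) * y u) t =
  total A (fun u => ind (insel k u) * y_dev u) t + gam_avg k * tally A (insel k) t.
Proof.
rewrite -totalZ -totalD; apply: eq_total => u.
have [/andP[su /eqP uk]|_] := boolP (insel k u); last by rewrite !mul0r mulr0 addr0.
by rewrite /y_dev (on_cells_in _ uk) su /= !mul1r mulr1 subrK.
Qed.

Let total_cells A (f : 'I_K -> R) (g : Z -> R) t :
  \sum_k f k * total A (fun u => ind (incell k u) * g u) t =
  total A (fun u => on_cells (fun k _ => f k) u * g u) t.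
Proof.
under eq_bigr do rewrite -totalZ.
rewrite exchange_big/=; apply: eq_bigr => i _; rewrite mulr_suml.
by apply: eq_bigr => k _; ring.
Qed.

Let total_sel A k t : total A (fun u => ind (insel k u) * y_dev u) t =
  total A (fun u => ind (incell k u) * y_dev u) t.
Proof.
apply: eq_total => u; rewrite /insel /incell; case sE : (s u) => //=.
have -> : y_dev u = 0; last by rewrite !mulr0.
rewrite /y_dev; case uE : (cell u) => [l|]; last by rewrite on_cells_out.
by rewrite (on_cells_in _ uE) sE mul0r.
Qed.

Let cell_meanE A k t : 0 < tally A (insel k) t ->
  cell_mean A k t = total A (fun u => ind (insel k u) * y_dev u) t / tally A (insel k) t + gam_avg k.
Proof. by move=> M0; rewrite /cell_mean total_y mulrDl mulfK// gt_eqF. Qed.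

(** On a single observation it costs only deviations to replace alp by its cell
   average as the coefficient of the noise, and gam as that of the multiplier. *)
Let noise_identity u : cell u != None ->
  on_cells (fun k _ => alp_avg k) u * y_dev u + on_cells (fun k _ => gam_avg k) u * h u
    - h u * gam u - alp u * eps u =
  gam_dev u * (alp u * ind (s u) - h u) - gam_dev u * (alp_dev u * ind (s u)) - alp_dev u * eps u.
Proof.
case uE : (cell u) => [k|//] _.
rewrite y_devE /gam_dev /alp_dev /eps !(on_cells_in _ uE); ring.
Qed.

Let noise_identity' u :
  on_cells (fun k _ => alp_avg k) u * y_dev u - ind (cell u != None) * (alp u * eps u) =
  on_cells (fun k _ => alp_avg k) u * (ind (s u) * gam_dev u) - alp_dev u * eps u.
Proof.
case uE : (cell u) => [k|]; last first.
  by rewrite /alp_dev !on_cells_out// !mul0r.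
rewrite y_devE /gam_dev /alp_dev /eps !(on_cells_in _ uE)/=; ring.
Qed.

Let sum_sqr_le (J : finType) (x : J -> R) :
  (\sum_l x l) ^+ 2 <= #|J|%:R * \sum_l x l ^+ 2.
Proof.
rewrite expr2 big_distrlr/=.
apply: (@le_trans _ _ (\sum_l \sum_m (2^-1 * x l ^+ 2 + 2^-1 * x m ^+ 2))).
  apply: ler_sum => l _; apply: ler_sum => m _.
  by have := sqr_ge0 (x l - x m); nra.
rewrite (eq_bigr (fun l => #|J|%:R * 2^-1 * x l ^+ 2 + 2^-1 * \sum_m x m ^+ 2)); last first.
  by move=> l _; rewrite big_split/= sumr_const mulr_sumr -mulrA mulr_natl.
rewrite big_split/= sumr_const -mulr_sumr -[X in _ + X]mulr_natl.
by rewrite le_eqVlt; apply/orP; left; apply/eqP; field.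
Qed.

Let sum_ord_le m (f : 'I_m -> R) c : (forall k, f k <= c) -> \sum_k f k <= c * m%:R.
Proof.
move=> fc; apply: le_trans (ler_sum _ (fun k _ => fc k)) _.
by rewrite sumr_const card_ord mulr_natr.
Qed.

Let sqr_sum5 (a b c e f : R) : (a + b + (c - e - f)) ^+ 2 <=
  5 * (a ^+ 2 + b ^+ 2 + c ^+ 2 + e ^+ 2 + f ^+ 2).
Proof.
have h1 := sqr_ge0 (a - b); have h2 := sqr_ge0 (a - c); have h3 := sqr_ge0 (a + e).
have h4 := sqr_ge0 (a + f); have h5 := sqr_ge0 (b - c); have h6 := sqr_ge0 (b + e).
have h7 := sqr_ge0 (b + f); have h8 := sqr_ge0 (c + e); have h9 := sqr_ge0 (c + f).
have h10 := sqr_ge0 (e - f); nra.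
Qed.

Let vy0 : 0 <= dev_var.
Proof.
have Ce0 : 0 <= Ce by apply: le_trans (rd_eps_var1 design); apply: E_ge0 => u; exact: sqr_ge0.
apply: addr_ge0; last by rewrite mulr_ge0 ?sqr_ge0.
by apply: divr_ge0; [rewrite mulr_ge0|exact: ltW (rd_c1 design)].
Qed.

Let Ch0 : 0 <= Ch.
Proof. by apply: le_trans (rd_h_var1 design); apply: E_ge0 => u; exact: sqr_ge0. Qed.

Let Ce0 : 0 <= Ce.
Proof. by apply: le_trans (rd_eps_var1 design); apply: E_ge0 => u; exact: sqr_ge0. Qed.

Let centred_sum (f : Z -> R) c : measurable_fun setT f ->
  L1 F (fun u => f u ^+ 2) -> E F f = 0 -> E F (fun u => f u ^+ 2) <= c ->
  let X t := \sum_(i < n) f (z i t) in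
  L1 P (fun t => X t ^+ 2) /\ E P (fun t => X t ^+ 2) <= n%:R * c.
Proof.
move=> mf f2 f0 fc.
have [i1 e1] := centred_sum_moment z_iid (n := n) (fun=> mf) (fun=> f2) (fun=> f0) (fun=> fc).
split => //; apply: le_trans e1 _.
by rewrite sumr_const card_ord mulr_natl.
Qed.

Let E_bounded_mul (f g : Z -> R) c e : measurable_fun setT f -> measurable_fun setT g ->
  0 <= c -> (forall u, `|f u| <= c) -> L1 F (fun u => g u ^+ 2) -> E F (fun u => g u ^+ 2) <= e ->
  L1 F (fun u => (f u * g u) ^+ 2) /\ E F (fun u => (f u * g u) ^+ 2) <= c ^+ 2 * e.
Proof.
move=> mf mg c0 fc g2 ge.
have i1 : L1 F (fun u => (f u * g u) ^+ 2) by apply: L1_sqr_scale g2.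
split => //; apply: (@le_trans _ _ (c ^+ 2 * E F (fun u => g u ^+ 2))); last first.
  by rewrite ler_wpM2l ?sqr_ge0.
rewrite -EZ//; apply: E_le => //; first exact: L1Z.
by move=> u; rewrite exprMn ler_wpM2r ?sqr_ge0//; exact: sqr_le.
Qed.

Let E_split_cells (f : Z -> R) : L1 F f -> (forall u, cell u = None -> f u = 0) ->
  E F f = \sum_k E F (fun u => ind (incell k u) * f u).
Proof.
move=> fi f0; have [_ <-] := E_on_cells (fun=> fi); apply: h0 => u.
by case uE : (cell u) => [k|]; [rewrite (on_cells_in _ uE)|rewrite on_cells_out ?f0].
Qed.

Let epsi : L1 F eps.
Proof. by apply: L1_sqr => //; exact: rd_eps2 design. Qed.

Let at_eps_mean : E F (fun u => alp_dev u * eps u) = 0.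
Proof.
have ai : L1 F (fun u => alp u * eps u).
  apply: L1_mul => //; last exact: rd_eps2 design.
  exact: bounded_sqr (rd_alp design).
rewrite E_split_cells; last 2 first.
- apply: L1_mul => //; last exact: rd_eps2 design.
  exact: bounded_sqr alp_dev_osc.
- by move=> u uN; rewrite /eps on_cells_out// mulr0.
rewrite big1// => k _.
rewrite (h0 (g := fun u => ind (incell k u) * (alp u * eps u) +
   (- alp_avg k) * (ind (incell k u) * eps u))); last first.
  move=> u; rewrite /incell; case: (eqVneq (cell u)) => [uk|_]; last by rewrite !mul0r mulr0 addr0.
  by rewrite /alp_dev (on_cells_in _ uk); ring.
rewrite ED; [|exact: L1in|by apply: L1Z; exact: L1in].
by rewrite EZ ?rd_eps_alp ?rd_eps ?mulr0 ?addr0//; exact: L1in.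
Qed.

(** The Riesz identity survives the subtraction of cell averages from gam. *)
Let h_gt_mean k : E F (fun u => ind (incell k u) * (h u * gam_dev u)) =
  E F (fun u => ind (insel k u) * (alp u * gam_dev u)).
Proof.
have hg : L1 F (fun u => h u * gam u).
  apply: L1_mul => //; [exact: rd_h2 design|exact: bounded_sqr (rd_gam design)].
have ag : L1 F (fun u => alp u * gam u).
  by apply: L1_mul => //; [exact: bounded_sqr (rd_alp design)|exact: bounded_sqr (rd_gam design)].
transitivity (E F (fun u => ind (incell k u) * (h u * gam u) +
   (- gam_avg k) * (ind (incell k u) * h u))).
  apply: h0 => u.
  rewrite /incell; case: (eqVneq (cell u)) => [uk|_]; last by rewrite !mul0r mulr0 addr0.
  by rewrite /gam_dev (on_cells_in _ uk); ring.
rewrite ED; [|exact: L1in|by apply: L1Z; exact: L1in].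
rewrite EZ; last exact: L1in.
rewrite rd_riesz_gam// rd_riesz// -EZ; last exact: L1sel.
rewrite -ED; [|exact: L1sel|by apply: L1Z; exact: L1sel].
apply: h0 => u; have [/andP[su /eqP uk]|_] := boolP (insel k u); last by rewrite !mul0r mulr0 addr0.
by rewrite /gam_dev (on_cells_in _ uk); ring.
Qed.

(** The remainder has five pieces, hence the factor 5; the summands are the constants
   in the bounds on their second moments, those of the L folds taken together. *)
Definition moment_constant (L : nat) c2 : R :=
  5 * (L%:R ^+ 2 * (Ch * dev_var * (4 / (c1 * c2)) + dev_var * (40 * Ca ^+ 2 / (c1 * c2))) +
       (2 * Ca ^+ 2 + 2 * Ch) + 1 + Ce).

(** The order of the square of n times the estimation error: noise in K cells, the
   two approximation errors dg and da met with noise, and their product. *)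
Definition moment_rate : R :=
  K%:R + n%:R * dg ^+ 2 + n%:R ^+ 2 * (dg * da) ^+ 2 + n%:R * da ^+ 2.

Section cross_fitting.
Variables (L : nat) (I : 'I_L -> {set 'I_n}) (c2 : R).
Hypothesis L2 : (2 <= L)%N.
Hypothesis I_part : forall i, exists2 l, i \in I l & forall l', i \in I l' -> l' = l.
Hypothesis I_bal : forall l l', (#|I l| <= #|I l'|.+1)%N.
Hypothesis n0 : (0 < n)%N.
Hypothesis c20 : 0 < c2.
Hypothesis I_size : forall l, c2 * n%:R <= #|~: I l|%:R.

Let sum_folds (x : 'I_n -> R) : \sum_l \sum_(i in I l) x i = \sum_i x i.
Proof. exact: sum_partition. Qed.

Let sum_cofolds (x : 'I_n -> R) : \sum_l \sum_(i in ~: I l) x i = (L%:R - 1) * \sum_i x i.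
Proof.
have -> : \sum_l \sum_(i in ~: I l) x i = \sum_l (\sum_i x i - \sum_(i in I l) x i).
  apply: eq_bigr => l _; rewrite [in RHS](bigID (mem (I l)))/= addrAC subrr add0r.
  by apply: eq_bigl => i; rewrite finset.inE.
rewrite sumrB sum_folds sumr_const card_ord -mulr_natl; ring.
Qed.

Let L1gt0 : 0 < L%:R - 1 :> R.
Proof. by rewrite subr_gt0 (_ : 1 = 1%:R)// ltr_nat. Qed.

Let L1neq0 : L%:R - 1 != 0 :> R. Proof. by rewrite gt_eqF. Qed.

Let n0R : 0 < n%:R :> R. Proof. by rewrite ltr0n. Qed.

(* Groups whose sizes differ by at most one make I l a fraction 1 / (L - 1) of
   its complement, up to rounding. *)
Let fold_ratio l : (#|I l|%:R - #|~: I l|%:R / (L%:R - 1)) ^+ 2 <= 4 :> R.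
Proof.
pose a l : R := #|I l|%:R.
have sum_a : \sum_l' a l' = n%:R.
  transitivity (\sum_(l' < L) \sum_(i in I l') (1 : R)).
    by apply: eq_bigr => l' _; rewrite sumr_const.
  by rewrite sum_folds sumr_const card_ord.
have aC : #|~: I l|%:R = n%:R - a l :> R.
  have nE : (#|I l| + #|~: I l|)%N = n by rewrite cardsC card_ord.
  by have := congr1 (fun m => m%:R : R) nE; rewrite natrD /a => <-; ring.
have up : n%:R <= L%:R * (a l + 1).
  rewrite -sum_a mulr_natl -[in leRHS](card_ord L) -sumr_const; apply: ler_sum => l' _.
  by rewrite /a -(natrD _ _ 1) ler_nat addn1.
have lo : L%:R * (a l - 1) <= n%:R.
  rewrite -sum_a mulr_natl -[in leLHS](card_ord L) -sumr_const; apply: ler_sum => l' _.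
  by rewrite lerBlDr /a -(natrD _ _ 1) ler_nat addn1.
have L2R : 2 <= L%:R :> R by rewrite (ler_nat R 2).
have -> : #|I l|%:R - #|~: I l|%:R / (L%:R - 1) = (L%:R * a l - n%:R) / (L%:R - 1).
  rewrite aC /a; field; by rewrite gt_eqF.
rewrite -[4](_ : 2 ^+ 2 = _); last by ring.
apply: sqr_le => //; rewrite normrM normfV (gtr0_norm L1gt0) ler_pdivrMr//.
by rewrite ler_norml; apply/andP; split; nra.
Qed.

Let tau l k : R := #|~: I l|%:R * mu k / 4.

Let tau_ge l k : c2 * n%:R * (c1 * p k) / 4 <= tau l k.
Proof.
rewrite /tau ler_wpM2r ?invr_ge0//; apply: ler_pM => //.
- by rewrite mulr_ge0 ?ltW.
- by rewrite mulr_ge0 ?ltW ?(rd_c1 design) ?(rd_p design).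
- exact: rd_mu design k.
Qed.

Let taulow_gt0 k : 0 < c2 * n%:R * (c1 * p k) / 4.
Proof.
by rewrite divr_gt0// mulr_gt0// mulr_gt0 ?(rd_c1 design) ?(rd_p design).
Qed.

Let tau_gt0 l k : 0 < tau l k.
Proof. exact: lt_le_trans (taulow_gt0 k) (tau_ge l k). Qed.

Definition crossfit_remainder t :=
  \sum_l \sum_k total (I l) (fun u => ind (incell k u) * h u) t * cell_mean (~: I l) k t
  - \sum_(i < n) h (z i t) * gam (z i t) - \sum_(i < n) alp (z i t) * eps (z i t).

Definition fold_event t :=
  [forall i : 'I_n, cell (z i t) != None] &&
  [forall l, enough (~: I l) (fun k => #|~: I l|%:R * mu k / 4) t].

(* Each observation belongs to L - 1 of the complements, so the sum of alp_avg times
   the noise over the sample is 1 / (L - 1) times the total of the same sums over the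
   complements. V compares the corresponding weight with the one that fold l gives to
   the noise in its complement; the two are close because the groups are balanced. *)
Let X1 l t := \sum_k ind (enough (~: I l) (tau l) t) *
    (total (I l) (fun u => ind (incell k u) * h_dev u) t *
     total (~: I l) (fun u => ind (insel k u) * y_dev u) t / tally (~: I l) (insel k) t).

Let V l k t := h_avg k * tally (I l) (incell k) t -
  alp_avg k / (L%:R - 1) * tally (~: I l) (insel k) t.

Let X2 l t := \sum_k ind (enough (~: I l) (tau l) t) *
    (V l k t * total (~: I l) (fun u => ind (insel k u) * y_dev u) t / tally (~: I l) (insel k) t).

Let X3 t := \sum_(i < n) gam_dev (z i t) * (alp (z i t) * ind (s (z i t)) - h (z i t)).
Let X4 t := \sum_(i < n) gam_dev (z i t) * (alp_dev (z i t) * ind (s (z i t))).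
Let X5 t := \sum_(i < n) alp_dev (z i t) * eps (z i t).

(** X1 pairs noise in h with noise in y from different folds, X2 is noise in y with
   weights that depend on counts only, X3 and X5 are centred sums with an
   approximation error as a factor, X4 contains the product of two such errors. *)
Let crossfit_split t : fold_event t ->
  crossfit_remainder t = \sum_l X1 l t + \sum_l X2 l t + (X3 t - X4 t - X5 t).
Proof.
move=> /andP[/forallP cellt /forallP ent].
have -> : X3 t - X4 t - X5 t = \sum_(i < n)
   (on_cells (fun k _ => alp_avg k) (z i t) * y_dev (z i t) +
    on_cells (fun k _ => gam_avg k) (z i t) * h (z i t)
    - h (z i t) * gam (z i t) - alp (z i t) * eps (z i t)).
  rewrite /X3 /X4 /X5 -!sumrB; apply: eq_bigr => i _; rewrite noise_identity//; exact: cellt.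
have -> : \sum_l X1 l t + \sum_l X2 l t = \sum_l \sum_k
    (total (I l) (fun u => ind (incell k u) * h u) t * cell_mean (~: I l) k t
     - gam_avg k * total (I l) (fun u => ind (incell k u) * h u) t
     - (L%:R - 1)^-1 * (alp_avg k * total (~: I l) (fun u => ind (incell k u) * y_dev u) t)).
  rewrite -big_split/=; apply: eq_bigr => l _; rewrite /X1 /X2 -big_split/=.
  apply: eq_bigr => k _; rewrite (ent l)/=.
  have M0 : 0 < tally (~: I l) (insel k) t.
    exact: lt_le_trans (tau_gt0 l k) (enough_ge k (ent l)).
  rewrite cell_meanE// total_h total_sel /V; field.
  by rewrite !gt_eqF.
have -> : \sum_l \sum_k
    (total (I l) (fun u => ind (incell k u) * h u) t * cell_mean (~: I l) k t
     - gam_avg k * total (I l) (fun u => ind (incell k u) * h u) t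
     - (L%:R - 1)^-1 * (alp_avg k * total (~: I l) (fun u => ind (incell k u) * y_dev u) t)) =
    \sum_l \sum_k total (I l) (fun u => ind (incell k u) * h u) t * cell_mean (~: I l) k t
    - \sum_(i < n) on_cells (fun k _ => gam_avg k) (z i t) * h (z i t)
    - \sum_(i < n) on_cells (fun k _ => alp_avg k) (z i t) * y_dev (z i t).
  rewrite -[X in _ - X - _]sum_folds -[X in _ - _ - X](mulKf L1neq0).
  rewrite -sum_cofolds mulr_sumr -!sumrB; apply: eq_bigr => l _.
  rewrite !sumrB -mulr_sumr !total_cells //.
rewrite /crossfit_remainder !sumrB big_split/=; ring.
Qed.

Let X1_moment l : L1 P (fun t => X1 l t ^+ 2) /\
  E P (fun t => X1 l t ^+ 2) <= Ch * dev_var * (4 / (c1 * c2)) * K%:R.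
Proof.
have disj j : j \in ~: I l -> j \notin I l by rewrite finset.inE.
have [i1 e1] := cross_noise_moment z_iid mcell ms disj Ch0 vy0 ht_noise yt_noise (tau_gt0 l).
split => //; apply: le_trans e1 _.
rewrite -[leRHS]mulrA ler_wpM2l ?mulr_ge0//.
apply: sum_ord_le => k; rewrite ler_pdivrMr//.
apply: (@le_trans _ _ (4 / (c1 * c2) * (c2 * n%:R * (c1 * p k) / 4))); last first.
  by rewrite ler_wpM2l// divr_ge0// mulr_ge0 ?ltW ?(rd_c1 design).
have -> : 4 / (c1 * c2) * (c2 * n%:R * (c1 * p k) / 4) = n%:R * p k.
  by field; rewrite !gt_eqF ?(rd_c1 design).
rewrite ler_wpM2r ?(ltW (rd_p design k))// ler_nat -[leqRHS](card_ord n).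
exact: max_card.
Qed.

Let V_moment l k : E P (fun t => V l k t ^+ 2) <= 10 * n%:R * Ca ^+ 2 * p k.
Proof.
pose g (i : 'I_n) u : R := if i \in I l then h_avg k * ind (incell k u) else
   - (alp_avg k / (L%:R - 1)) * ind (insel k u).
have mg i : measurable_fun setT (g i).
  by rewrite /g; case: (i \in I l); apply: measurable_funM.
have Lac : `|alp_avg k / (L%:R - 1)| <= Ca.
  rewrite normrM normfV (gtr0_norm L1gt0) ler_pdivrMr//.
  apply: le_trans (ac_bound k) _; rewrite ler_peMr// lerBrDr -(natrD _ 1 1) ler_nat//.
have gb i u : `|g i u| <= Ca.
  rewrite /g; case: (i \in I l); rewrite normrM normr_nat.
    by case: (incell k u); rewrite ?mulr1 ?mulr0 ?hc_bound.
  by rewrite normrN; case: (insel k u); rewrite ?mulr1 ?mulr0.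
have g2 i : L1 F (fun u => g i u ^+ 2) by exact: bounded_sqr.
have VE t : V l k t = \sum_(i < n) g i (z i t).
  rewrite (bigID (mem (I l)))/= /V -mulNr -!totalZ; congr (_ + _).
    by apply: eq_bigr => i iI; rewrite /g iI.
  apply: eq_big => [i|i]; first by rewrite finset.inE.
  by rewrite finset.inE => /negPf iI; rewrite /g iI.
have gv i : E F (fun u => g i u ^+ 2) <= Ca ^+ 2 * p k.
  rewrite -EZ; last exact: L1_ind.
  apply: E_le => //; first by apply: L1Z; exact: L1_ind.
  move=> u; have := sqr_le Ca0 (gb i u); rewrite /g /insel /incell.
  case: (cell u == Some k); rewrite ?mulr1//.
  by rewrite andbF !mulr0 if_same expr0n.
have mean : \sum_(i < n) E F (g i) =
    h_avg k * p k * (#|I l|%:R - #|~: I l|%:R / (L%:R - 1)).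
  rewrite (bigID (mem (I l)))/=.
  rewrite (eq_bigr (fun=> h_avg k * p k)); last first.
    by move=> i iI; rewrite -EZ ?/g ?iI//; exact: L1_ind.
  rewrite [X in _ + X](eq_bigr (fun=> - (alp_avg k / (L%:R - 1)) * mu k)); last first.
    by move=> i /negPf iI; rewrite -EZ ?/g ?iI//; exact: L1_ind.
  rewrite sumr_const -[X in X + _]mulr_natl.
  have -> : \sum_(i < n | i \notin I l) - (alp_avg k / (L%:R - 1)) * mu k =
      #|~: I l|%:R * (- (alp_avg k / (L%:R - 1)) * mu k).
    rewrite mulr_natl -sumr_const; apply: eq_bigl => i; by rewrite finset.inE.
  rewrite hc_ac; ring.
have [i1 e1] := sum_moment z_iid mg g2.
under eq_Rintegral => t _ do rewrite VE.
apply: le_trans e1 _; rewrite mean exprMn.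
have s1 : \sum_(i < n) E F (fun u => g i u ^+ 2) <= n%:R * (Ca ^+ 2 * p k).
  by rewrite mulrC; exact: sum_ord_le.
have hp : (h_avg k * p k) ^+ 2 <= Ca ^+ 2 * p k.
  rewrite exprMn ler_pM ?sqr_ge0//; first exact: sqr_le.
  by rewrite expr2 ger_pMr ?(rd_p design).
have nn : Ca ^+ 2 * p k <= n%:R * (Ca ^+ 2 * p k).
  rewrite ler_peMl ?mulr_ge0 ?sqr_ge0 ?(ltW (rd_p design k))//.
  by rewrite (_ : 1 = 1%:R)// ler_nat.
have fr := fold_ratio l.
have hpf : (h_avg k * p k) ^+ 2 * (#|I l|%:R - #|~: I l|%:R / (L%:R - 1)) ^+ 2 <=
    Ca ^+ 2 * p k * 4 by rewrite ler_pM ?sqr_ge0.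
have -> : 10 * n%:R * Ca ^+ 2 * p k = 10 * (n%:R * (Ca ^+ 2 * p k)) by ring.
move: s1 hpf nn; set q := Ca ^+ 2 * p k; set r := n%:R * q.
set a := \sum_(i < n) _; set e := (h_avg k * p k) ^+ 2 * _; lra.
Qed.

Let V_bins l k : exists Vk, forall t, V l k t =
  Vk (bins z (cell_bin cell s (finset.set0 : {set 'I_n})) t).
Proof.
exists (fun kk : {ffun 'I_n -> option 'I_K * bool} =>
  h_avg k * (\sum_(i in I l) ind ((kk i).1 == Some k)) -
  alp_avg k / (L%:R - 1) * (\sum_(i in ~: I l) ind ((kk i).2 && ((kk i).1 == Some k)))) => t.
rewrite /V; congr (_ * _ - _ * _); apply: eq_bigr => i _; rewrite ffunE//=.
by rewrite finset.inE.
Qed.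

Let X2_moment l : L1 P (fun t => X2 l t ^+ 2) /\
  E P (fun t => X2 l t ^+ 2) <= dev_var * (40 * Ca ^+ 2 / (c1 * c2)) * K%:R.
Proof.
have [i1 e1] := averaged_noise_moment z_iid mcell ms (~: I l) vy0 yt_noise (tau_gt0 l) (V_bins l).
split => //; apply: le_trans e1 _.
rewrite -[leRHS]mulrA ler_wpM2l//.
apply: sum_ord_le => k; rewrite ler_pdivrMr//.
apply: le_trans (V_moment l k) _.
apply: (@le_trans _ _ (40 * Ca ^+ 2 / (c1 * c2) * (c2 * n%:R * (c1 * p k) / 4))); last first.
  by rewrite ler_wpM2l// divr_ge0// mulr_ge0 ?sqr_ge0 ?ltW ?(rd_c1 design).
rewrite le_eqVlt; apply/orP; left; apply/eqP.
by field; rewrite !gt_eqF ?(rd_c1 design).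
Qed.

Let X3_moment : L1 P (fun t => X3 t ^+ 2) /\
  E P (fun t => X3 t ^+ 2) <= n%:R * (dg ^+ 2 * (2 * Ca ^+ 2 + 2 * Ch)).
Proof.
pose g u := alp u * ind (s u) - h u.
have mg : measurable_fun setT g by apply: measurable_funB => //; exact: measurable_funM.
have as2 : L1 F (fun u => (alp u * ind (s u)) ^+ 2).
  apply: (bounded_sqr (c := Ca)); first exact: measurable_funM.
  by move=> u; have := rd_alp design u; case: (s u); rewrite ?mulr1 ?mulr0 ?normr0.
have gle u : g u ^+ 2 <= 2 * Ca ^+ 2 + 2 * h u ^+ 2.
  have := sqr_le Ca0 (rd_alp design u); have := sqr_ge0 Ca; have := sqr_ge0 (alp u + h u).
  rewrite /g; case: (s u); rewrite ?mulr1 ?mulr0 ?sub0r ?sqrrN.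
    by set x := alp u; set v := h u; set w := Ca ^+ 2; nra.
  by have := sqr_ge0 (h u); set v := h u ^+ 2; set w := Ca ^+ 2; lra.
have h2i := rd_h2 design.
have bi : L1 F (fun u => 2 * Ca ^+ 2 + 2 * h u ^+ 2).
  by apply: L1D; [exact: L1_cst|exact: L1Z].
have g2 : L1 F (fun u => g u ^+ 2).
  apply: L1_dominated bi _; first exact: measurable_funX.
  by move=> u; rewrite ger0_norm ?sqr_ge0.
have gv : E F (fun u => g u ^+ 2) <= 2 * Ca ^+ 2 + 2 * Ch.
  apply: le_trans (E_le g2 bi gle) _.
  rewrite ED; [|exact: L1_cst|exact: L1Z].
  by rewrite E_cst EZ// lerD2l ler_wpM2l// rd_h_var1.
have [i1 e1] := E_bounded_mul mgt mg (rd_dg design) gam_dev_osc g2 gv.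
refine (@centred_sum (fun u => gam_dev u * g u) _ _ i1 _ e1); first exact: measurable_funM.
rewrite E_split_cells; last 2 first.
- by apply: L1_mul => //; exact: bounded_sqr gam_dev_osc.
- by move=> u uN; rewrite /gam_dev on_cells_out// mul0r.
rewrite big1// => k _.
have ag : L1 F (fun u => alp u * gam_dev u).
  by apply: L1_mul => //; [exact: bounded_sqr (rd_alp design)|exact: bounded_sqr gam_dev_osc].
have hg : L1 F (fun u => h u * gam_dev u).
  by apply: L1_mul => //; exact: bounded_sqr gam_dev_osc.
transitivity (E F (fun u => ind (insel k u) * (alp u * gam_dev u) -
   ind (incell k u) * (h u * gam_dev u))).
  apply: h0 => u; rewrite /insel /incell /g -mulnb natrM; ring.
rewrite RintegralB//; [|exact: L1sel|exact: L1in].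
by rewrite h_gt_mean subrr.
Qed.

Let X5_moment : L1 P (fun t => X5 t ^+ 2) /\
  E P (fun t => X5 t ^+ 2) <= n%:R * (da ^+ 2 * Ce).
Proof.
have [i1 e1] := E_bounded_mul mat meps (rd_da design) alp_dev_osc (rd_eps2 design) (rd_eps_var1 design).
refine (@centred_sum (fun u => alp_dev u * eps u) _ _ i1 at_eps_mean e1).
exact: measurable_funM.
Qed.

Let X4_bound t : X4 t ^+ 2 <= n%:R ^+ 2 * (dg * da) ^+ 2.
Proof.
rewrite -exprMn; apply: sqr_le.
  by rewrite mulr_ge0 ?mulr_ge0 ?(rd_dg design) ?(rd_da design).
apply: le_trans (ler_norm_sum _ _ _) _; rewrite mulrC; apply: sum_ord_le => i.
rewrite normrM ler_pM//; apply: le_trans (alp_dev_osc (z i t)).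
by case: (s _); rewrite ?mulr1 ?mulr0 ?normr0.
Qed.

Theorem crossfit_remainder_moment : exists Y : T -> R,
  [/\ L1 P Y, forall t, 0 <= Y t,
      forall t, fold_event t -> crossfit_remainder t ^+ 2 <= Y t &
      E P Y <= moment_constant L c2 * moment_rate].
Proof.
pose Y t := 5 * (L%:R * (\sum_l X1 l t ^+ 2) + L%:R * (\sum_l X2 l t ^+ 2) + X3 t ^+ 2 +
  n%:R ^+ 2 * (dg * da) ^+ 2 + X5 t ^+ 2).
have i1 l := (X1_moment l).1; have i2 l := (X2_moment l).1.
have i3 := X3_moment.1; have i5 := X5_moment.1.
have j1 : L1 P (fun t => L%:R * (\sum_l X1 l t ^+ 2)) by apply: L1Z; exact: L1_sum.
have j2 : L1 P (fun t => L%:R * (\sum_l X2 l t ^+ 2)) by apply: L1Z; exact: L1_sum.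
have j12 := L1D j1 j2; have j123 := L1D j12 i3.
have j1234 := L1D j123 (L1_cst P (n%:R ^+ 2 * (dg * da) ^+ 2)).
have j := L1D j1234 i5.
exists Y; split.
- exact: L1Z.
- move=> t; rewrite mulr_ge0// -exprMn !addr_ge0 ?sqr_ge0// mulr_ge0// sumr_ge0// => l _.
  exact: sqr_ge0.
  exact: sqr_ge0.
- move=> t ft; rewrite crossfit_split//; apply: le_trans (sqr_sum5 _ _ _ _ _) _.
  rewrite ler_wpM2l// !lerD//.
  + by apply: le_trans (sum_sqr_le _) _; rewrite card_ord.
  + by apply: le_trans (sum_sqr_le _) _; rewrite card_ord.
rewrite EZ// ED// ED//; last exact: L1_cst.
rewrite E_cst ED// ED// EZ; last exact: L1_sum.
rewrite EZ; last exact: L1_sum.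
rewrite !E_sum//.
have s1 := sum_ord_le (fun l => (X1_moment l).2).
have s2 := sum_ord_le (fun l => (X2_moment l).2).
have e3 := X3_moment.2; have e5 := X5_moment.2.
have L0 : 0 <= L%:R :> R by rewrite ler0n.
have {}s1 := ler_wpM2l L0 s1; have {}s2 := ler_wpM2l L0 s2.
have c12 : 0 <= (c1 * c2)^-1 by rewrite invr_ge0 mulr_ge0 ?ltW ?(rd_c1 design).
rewrite /moment_constant -mulrA ler_wpM2l//.
pose k1 := Ch * dev_var * (4 / (c1 * c2)); pose k2 := dev_var * (40 * Ca ^+ 2 / (c1 * c2)).
have k10 : 0 <= k1 by rewrite !mulr_ge0.
have k20 : 0 <= k2 by rewrite !mulr_ge0 ?sqr_ge0.
have k30 : 0 <= 2 * Ca ^+ 2 + 2 * Ch by rewrite addr_ge0 ?mulr_ge0 ?sqr_ge0.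
apply: (@le_trans _ _ (L%:R ^+ 2 * (k1 + k2) * K%:R + (2 * Ca ^+ 2 + 2 * Ch) * (n%:R * dg ^+ 2)
   + n%:R ^+ 2 * (dg * da) ^+ 2 + Ce * (n%:R * da ^+ 2))).
  apply: lerD; last by apply: le_trans e5 _; rewrite mulrA mulrC.
  rewrite lerD2r; apply: lerD; last by apply: le_trans e3 _; rewrite mulrA mulrC.
  move: s1 s2; rewrite -/k1 -/k2; lra.
have q1 : 0 <= K%:R :> R by rewrite ler0n.
have q2 : 0 <= n%:R * dg ^+ 2 by rewrite mulr_ge0 ?sqr_ge0.
have q3 : 0 <= n%:R ^+ 2 * (dg * da) ^+ 2 by rewrite mulr_ge0 ?sqr_ge0.
have q4 : 0 <= n%:R * da ^+ 2 by rewrite mulr_ge0 ?sqr_ge0.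
have q5 : 0 <= L%:R ^+ 2 * (k1 + k2) by rewrite mulr_ge0 ?sqr_ge0 ?addr_ge0.
rewrite /moment_rate -/k1 -/k2; move: q1 q2 q3 q4 q5 k30 Ce0.
move: (K%:R) (n%:R * dg ^+ 2) (n%:R ^+ 2 * _) (n%:R * da ^+ 2) (L%:R ^+ 2 * _) (2 * Ca ^+ 2 + _) (Ce).
by move=> a b c' e a' b' e' *; nra.
Qed.

End cross_fitting.

(** An estimator that uses all observations at once and the population mean of the
   multiplier h in each cell in place of its sum over a fold. There is no noise in h,
   and the product of the two approximation errors enters through its mean. *)
Section full_sample.
Hypothesis n0 : (0 < n)%N.

Let n0R : 0 < n%:R :> R. Proof. by rewrite ltr0n. Qed.

Let all : {set 'I_n} := [set: 'I_n]%SET.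

Let tau k : R := n%:R * mu k / 4.

Let tau_ge k : n%:R * (c1 * p k) / 4 <= tau k.
Proof. by rewrite /tau ler_wpM2r ?invr_ge0// ler_wpM2l// (rd_mu design). Qed.

Let tau_gt0 k : 0 < tau k.
Proof. by rewrite /tau divr_gt0// mulr_gt0. Qed.

Definition plugin_remainder t :=
  n%:R * (\sum_k E F (fun u => ind (incell k u) * h u) * cell_mean all k t
          - \sum_k E F (fun u => ind (incell k u) * (h u * gam u)))
  - \sum_(i < n) alp (z i t) * eps (z i t).

Definition full_event t :=
  [forall i : 'I_n, cell (z i t) != None] && enough all (fun k => n%:R * mu k / 4) t.

Let V k t := n%:R * (h_avg k * p k) - alp_avg k * tally all (insel k) t.

Let X2 t := \sum_k ind (enough all tau t) *
    (V k t * total all (fun u => ind (insel k u) * y_dev u) t / tally all (insel k) t).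

Let X3 t := \sum_(i < n) on_cells (fun k _ => alp_avg k) (z i t) * (ind (s (z i t)) * gam_dev (z i t)).
Let X5 t := \sum_(i < n) alp_dev (z i t) * eps (z i t).
Let c4 := n%:R * \sum_k E F (fun u => ind (incell k u) * (h u * gam_dev u)).

Let plugin_split t : full_event t ->
  plugin_remainder t = 0 + X2 t + (X3 t - c4 - X5 t).
Proof.
move=> /andP[/forallP cellt ent].
have X35 : X3 t - X5 t = \sum_(i < n) on_cells (fun k _ => alp_avg k) (z i t) * y_dev (z i t)
    - \sum_(i < n) alp (z i t) * eps (z i t).
  rewrite /X3 /X5 -!sumrB; apply: eq_bigr => i _.
  by rewrite -noise_identity' cellt mul1r.
have sumac : \sum_(i < n) on_cells (fun k _ => alp_avg k) (z i t) * y_dev (z i t) =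
    \sum_k alp_avg k * total all (fun u => ind (insel k u) * y_dev u) t.
  under [RHS]eq_bigr do rewrite total_sel.
  by rewrite total_cells /total; apply: eq_bigl => i; rewrite finset.inE.
have hg : L1 F (fun u => h u * gam u).
  apply: L1_mul => //; [exact: rd_h2 design|exact: bounded_sqr (rd_gam design)].
have c4E : c4 = n%:R * (\sum_k E F (fun u => ind (incell k u) * (h u * gam u)) -
    \sum_k gam_avg k * (h_avg k * p k)).
  rewrite /c4 -sumrB; congr (_ * _); apply: eq_bigr => k _.
  rewrite /h_avg divfK// -EZ; last exact: L1in.
  rewrite -RintegralB//; [|exact: L1in|by apply: L1Z; exact: L1in].
  apply: h0 => u.
  rewrite /incell; case: (eqVneq (cell u)) => [uk|_]; last by rewrite !mul0r mulr0 subr0.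
  by rewrite /gam_dev (on_cells_in _ uk); ring.
have X2E : X2 t = n%:R * \sum_k E F (fun u => ind (incell k u) * h u) * cell_mean all k t -
    n%:R * (\sum_k gam_avg k * (h_avg k * p k)) -
    \sum_k alp_avg k * total all (fun u => ind (insel k u) * y_dev u) t.
  rewrite !mulr_sumr -!sumrB; apply: eq_bigr => k _; rewrite ent/=.
  have M0 : 0 < tally all (insel k) t by exact: lt_le_trans (tau_gt0 k) (enough_ge k ent).
  rewrite cell_meanE// /V /h_avg divfK//; field.
  by rewrite gt_eqF.
rewrite /plugin_remainder X2E c4E -sumac.
have -> : \sum_(i < n) on_cells (fun k _ => alp_avg k) (z i t) * y_dev (z i t) =
   X3 t - X5 t + \sum_(i < n) alp (z i t) * eps (z i t) by rewrite X35 subrK.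
ring.
Qed.

Let V_moment k : E P (fun t => V k t ^+ 2) <= 10 * n%:R * Ca ^+ 2 * p k.
Proof.
pose g (i : 'I_n) u : R := h_avg k * p k - alp_avg k * ind (insel k u).
have mg i : measurable_fun setT (g i).
  by apply: measurable_funB => //; apply: measurable_funM.
have gb i u : `|g i u| <= Ca + Ca.
  apply: le_trans (ler_normB _ _) _; apply: lerD.
    rewrite normrM (gtr0_norm (rd_p design k)) -[leRHS]mulr1 ler_pM ?normr_ge0//.
    exact: ltW (rd_p design k).
  by rewrite normrM normr_nat; case: (insel k u); rewrite ?mulr1 ?mulr0.
have g2 i : L1 F (fun u => g i u ^+ 2) by exact: bounded_sqr.
have VE t : V k t = \sum_(i < n) g i (z i t).
  rewrite sumrB sumr_const card_ord -mulr_natl /V; congr (_ - _).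
  rewrite -totalZ /total; apply: eq_bigl => i; by rewrite finset.inE.
have insel1 u : ind (insel k u) ^+ 2 = ind (insel k u).
  by case: (insel k u); rewrite ?expr1n ?expr0n.
have hp : (h_avg k * p k) ^+ 2 <= Ca ^+ 2 * p k.
  rewrite exprMn ler_pM ?sqr_ge0//; first exact: sqr_le.
  by rewrite expr2 ger_pMr ?(rd_p design).
have gv i : E F (fun u => g i u ^+ 2) <= 4 * (Ca ^+ 2 * p k).
  apply: (@le_trans _ _ (E F (fun u => 2 * (h_avg k * p k) ^+ 2 + 2 * Ca ^+ 2 * ind (insel k u)))).
    apply: E_le => //.
      by apply: L1D; [exact: L1_cst|by apply: L1Z; exact: L1_ind].
    move=> u; rewrite -insel1 /g; have := sqr_le Ca0 (ac_bound k).
    have := sqr_ge0 (h_avg k * p k + alp_avg k * ind (insel k u)).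
    have i0 : 0 <= ind (insel k u) ^+ 2 by exact: sqr_ge0.
    move: i0; set x := h_avg k * p k; set a := alp_avg k; set e := ind _; set w := Ca ^+ 2; nra.
  rewrite ED; [|exact: L1_cst|by apply: L1Z; exact: L1_ind].
  rewrite E_cst EZ; last exact: L1_ind.
  have := ler_wpM2l (sqr_ge0 Ca) (mu_le_p k); rewrite -mulrA; lra.
have mean i : E F (g i) = 0.
  rewrite RintegralB//; [|exact: L1_cst|by apply: L1Z; exact: L1_ind].
  rewrite E_cst EZ; last exact: L1_ind.
  by rewrite hc_ac subrr.
have [i1 e1] := centred_sum_moment z_iid mg g2 mean gv.
under eq_Rintegral => t _ do rewrite VE.
apply: le_trans e1 _; rewrite sumr_const card_ord -mulr_natl.
have : 0 <= n%:R * (Ca ^+ 2 * p k) by rewrite !mulr_ge0 ?sqr_ge0 ?(ltW (rd_p design k)).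
have -> : 10 * n%:R * Ca ^+ 2 * p k = 10 * (n%:R * (Ca ^+ 2 * p k)) by ring.
rewrite mulrCA; lra.
Qed.

Let V_bins k : exists Vk, forall t, V k t =
  Vk (bins z (cell_bin cell s (finset.set0 : {set 'I_n})) t).
Proof.
exists (fun kk : {ffun 'I_n -> option 'I_K * bool} =>
  n%:R * (h_avg k * p k) - alp_avg k * (\sum_(i in all) ind ((kk i).2 && ((kk i).1 == Some k)))) => t.
rewrite /V; congr (_ - _ * _); apply: eq_bigr => i _; rewrite ffunE//=.
by rewrite finset.inE.
Qed.

Let X2_moment : L1 P (fun t => X2 t ^+ 2) /\
  E P (fun t => X2 t ^+ 2) <= dev_var * (40 * Ca ^+ 2 / (c1 * 1)) * K%:R.
Proof.
have [i1 e1] := averaged_noise_moment z_iid mcell ms all vy0 yt_noise tau_gt0 V_bins.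
split => //; apply: le_trans e1 _.
rewrite -[leRHS]mulrA ler_wpM2l//.
apply: sum_ord_le => k; rewrite ler_pdivrMr//.
apply: le_trans (V_moment k) _.
apply: (@le_trans _ _ (40 * Ca ^+ 2 / (c1 * 1) * (n%:R * (c1 * p k) / 4))); last first.
  by rewrite ler_wpM2l// mulr1 divr_ge0// ?mulr_ge0 ?sqr_ge0// (ltW (rd_c1 design)).
rewrite le_eqVlt; apply/orP; left; apply/eqP.
by field; rewrite gt_eqF// (rd_c1 design).
Qed.

Let X3_moment : L1 P (fun t => X3 t ^+ 2) /\
  E P (fun t => X3 t ^+ 2) <= n%:R * (Ca ^+ 2 * dg ^+ 2).
Proof.
have mac : measurable_fun setT (on_cells (fun k _ => alp_avg k)).
  exact: measurable_on_cells.
have acb u : `|on_cells (fun k _ => alp_avg k) u| <= Ca by apply: on_cells_bounded.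
have msg : measurable_fun setT (fun u => ind (s u) * gam_dev u) by exact: measurable_funM.
have sgb u : `|ind (s u) * gam_dev u| <= dg.
  apply: le_trans (gam_dev_osc u).
  by case: (s u); rewrite ?mul1r ?mul0r ?normr0.
have sg2 : L1 F (fun u => (ind (s u) * gam_dev u) ^+ 2) by exact: bounded_sqr sgb.
have sgv : E F (fun u => (ind (s u) * gam_dev u) ^+ 2) <= dg ^+ 2.
  rewrite -[leRHS](E_cst F); apply: E_le => //; first exact: L1_cst.
  by move=> u; exact: sqr_le (rd_dg design) (sgb u).
have [i1 e1] := E_bounded_mul mac msg Ca0 acb sg2 sgv.
refine (@centred_sum (fun u => on_cells (fun k _ => alp_avg k) u * (ind (s u) * gam_dev u)) _ _ i1 _ e1).
  exact: measurable_funM.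
have sgi : L1 F (fun u => ind (s u) * gam_dev u) by apply: L1_sqr.
rewrite E_split_cells; last 2 first.
- by apply: L1_mul => //; exact: bounded_sqr acb.
- by move=> u uN; rewrite on_cells_out// mul0r.
rewrite big1// => k _.
transitivity (E F (fun u => alp_avg k * (ind (insel k u) * gam_dev u))).
  apply: h0 => u; rewrite /insel /incell.
  case: (eqVneq (cell u)) => [uk|_]; last by rewrite andbF !mul0r mulr0.
  by rewrite (on_cells_in _ uk) andbT mul1r.
rewrite EZ ?gt_sel ?mulr0//; apply: L1sel.
exact: L1_sqr (bounded_sqr mgt gam_dev_osc).
Qed.

Let X5_moment : L1 P (fun t => X5 t ^+ 2) /\
  E P (fun t => X5 t ^+ 2) <= n%:R * (da ^+ 2 * Ce).
Proof.
have [i1 e1] := E_bounded_mul mat meps (rd_da design) alp_dev_osc (rd_eps2 design) (rd_eps_var1 design).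
refine (@centred_sum (fun u => alp_dev u * eps u) _ _ i1 at_eps_mean e1).
exact: measurable_funM.
Qed.

Let c4_bound : c4 ^+ 2 <= n%:R ^+ 2 * (dg * da) ^+ 2.
Proof.
rewrite -exprMn; apply: sqr_le.
  by rewrite mulr_ge0 ?mulr_ge0 ?(rd_dg design) ?(rd_da design).
rewrite /c4 normrM normr_nat ler_wpM2l//.
have gti : L1 F gam_dev by exact: L1_sqr (bounded_sqr mgt gam_dev_osc).
have ag : L1 F (fun u => alp_dev u * gam_dev u).
  by apply: L1_mul => //; [exact: bounded_sqr alp_dev_osc|exact: bounded_sqr gam_dev_osc].
have term k : E F (fun u => ind (incell k u) * (h u * gam_dev u)) =
    E F (fun u => ind (insel k u) * (alp_dev u * gam_dev u)).
  rewrite h_gt_mean.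
  rewrite (h0 (g := fun u => ind (insel k u) * (alp_dev u * gam_dev u) +
     alp_avg k * (ind (insel k u) * gam_dev u))); last first.
    move=> u; have [/andP[su /eqP uk]|_] := boolP (insel k u); last by rewrite !mul0r mulr0 addr0.
    by rewrite /alp_dev (on_cells_in _ uk); ring.
  rewrite ED; [|exact: L1sel|by apply: L1Z; exact: L1sel].
  by rewrite EZ ?gt_sel ?mulr0 ?addr0//; exact: L1sel.
rewrite (eq_bigr _ (fun k _ => term k)) -E_sum; last by move=> k; exact: L1sel.
have fi : L1 F (fun u => \sum_k ind (insel k u) * (alp_dev u * gam_dev u)).
  by apply: L1_sum => k; exact: L1sel.
apply: le_trans (le_normr_Rintegral measurableT fi) _.
rewrite -[leRHS](E_cst F); apply: E_le; [exact: integrable_norm|exact: L1_cst|].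
move=> u; rewrite -mulr_suml normrM.
have s1 : `|\sum_k ind (insel k u)| <= 1.
  case uE : (cell u) => [k|]; last first.
    by rewrite big1 ?normr0// => k _; rewrite /insel uE andbF.
  rewrite (bigD1 k)//= big1 ?addr0.
    by rewrite normr_nat; case: (insel k u).
  move=> l lk; rewrite /insel uE; case: eqP => [[kl]|_]; last by rewrite andbF.
  by rewrite kl eqxx in lk.
rewrite -[leRHS]mul1r ler_pM//.
by rewrite normrM mulrC ler_pM.
Qed.

Theorem plugin_remainder_moment : exists Y : T -> R,
  [/\ L1 P Y, forall t, 0 <= Y t,
      forall t, full_event t -> plugin_remainder t ^+ 2 <= Y t &
      E P Y <= moment_constant 1 1 * moment_rate].
Proof.
pose Y t := 5 * (X2 t ^+ 2 + X3 t ^+ 2 + n%:R ^+ 2 * (dg * da) ^+ 2 + X5 t ^+ 2).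
have i2 := X2_moment.1; have i3 := X3_moment.1; have i5 := X5_moment.1.
have j23 := L1D i2 i3.
have j234 := L1D j23 (L1_cst P (n%:R ^+ 2 * (dg * da) ^+ 2)).
have j := L1D j234 i5.
exists Y; split.
- exact: L1Z.
- by move=> t; rewrite mulr_ge0// -exprMn !addr_ge0 ?sqr_ge0.
- move=> t ft; rewrite plugin_split//; apply: le_trans (sqr_sum5 _ _ _ _ _) _.
  by rewrite ler_wpM2l// expr0n add0r !lerD// c4_bound.
rewrite EZ// ED// ED//; last exact: L1_cst.
rewrite E_cst ED//.
have s2 := X2_moment.2; have e3 := X3_moment.2; have e5 := X5_moment.2.
have c12 : 0 <= (c1 * 1)^-1 by rewrite mulr1 invr_ge0 ltW ?(rd_c1 design).
rewrite /moment_constant -mulrA ler_wpM2l// expr1n mul1r.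
pose k1 := Ch * dev_var * (4 / (c1 * 1)); pose k2 := dev_var * (40 * Ca ^+ 2 / (c1 * 1)).
have k10 : 0 <= k1 by rewrite !mulr_ge0.
have k20 : 0 <= k2 by rewrite !mulr_ge0 ?sqr_ge0.
have Ca2 : 0 <= Ca ^+ 2 by rewrite sqr_ge0.
apply: (@le_trans _ _ (k2 * K%:R + Ca ^+ 2 * (n%:R * dg ^+ 2)
   + n%:R ^+ 2 * (dg * da) ^+ 2 + Ce * (n%:R * da ^+ 2))).
  apply: lerD; last by apply: le_trans e5 _; rewrite mulrA mulrC.
  rewrite lerD2r; apply: lerD => //.
  by apply: le_trans e3 _; rewrite mulrCA.
have q1 : 0 <= K%:R :> R by rewrite ler0n.
have q2 : 0 <= n%:R * dg ^+ 2 by rewrite mulr_ge0 ?sqr_ge0.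
have q3 : 0 <= n%:R ^+ 2 * (dg * da) ^+ 2 by rewrite mulr_ge0 ?sqr_ge0.
have q4 : 0 <= n%:R * da ^+ 2 by rewrite mulr_ge0 ?sqr_ge0.
rewrite /moment_rate -/k1 -/k2; move: q1 q2 q3 q4 k10 k20 Ca2 Ch0 Ce0.
move: (K%:R) (n%:R * dg ^+ 2) (n%:R ^+ 2 * _) (n%:R * da ^+ 2) k1 k2 (Ca ^+ 2) (Ch) (Ce).
by move=> a b c' e a' b' e' *; nra.
Qed.

End full_sample.

End remainder.

(** * Stochastic order and the occupation of cells *)

Section probability_bounds.
Context (R : realType) d (T : measurableType d) (P : probability T R).

Local Notation L1 f := (P.-integrable setT (EFin \o f)).
Local Notation E f := (\int[P]_t f t).

Lemma union_bound (J : finType) (B : J -> set T) (b : J -> R) :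
  (forall j, measurable (B j)) -> (forall j, (P (B j) <= (b j)%:E)%E) ->
  measurable [set t | exists j, B j t] /\
  (P [set t | exists j, B j t] <= (\sum_j b j)%:E)%E.
Proof.
move=> mB bB.
have -> : [set t | exists j, B j t] = [set t | exists2 j, j \in enum J & B j t].
  by apply/seteqP; split => t /= [j]; [exists j => //; rewrite mem_enum|move=> _; exists j].
have -> : \sum_j b j = \sum_(j <- enum J) b j by rewrite big_enum.
elim: (enum J) => [|j js [mI IH]].
  rewrite (_ : [set t | _] = set0); first by rewrite measure0 big_nil.
  by apply/seteqP; split => t // -[].
have -> : [set t | exists2 j0, j0 \in j :: js & B j0 t] =
    B j `|` [set t | exists2 j0, j0 \in js & B j0 t].
  apply/seteqP; split => t /=.
    by move=> [i]; rewrite in_cons => /predU1P[-> ?|ijs ?]; [left|right; exists i].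
  move=> [Bj|[i ijs Bi]]; first by exists j => //; rewrite mem_head.
  by exists i => //; rewrite in_cons ijs orbT.
split; first exact: measurableU.
apply: le_trans (measureU2 _ _ _) _ => //.
by rewrite big_cons EFinD; exact: leeD (bB j) IH.
Qed.

End probability_bounds.

Section stochastic_order.
Context (R : realType) d (T : measurableType d) (P : probability T R).

Local Notation L1 f := (P.-integrable setT (EFin \o f)).
Local Notation E f := (\int[P]_t f t).

(** Markov's inequality for Y on the good event. The cover that the definition of
   O_p asks for consists of the bad event and a level set of Y, so that V may fail to
   be measurable. *)
Lemma bigO_p_of_moment (V : nat -> T -> R) (a : nat -> R) (C : R) (delta : nat -> R) :
  0 <= C -> delta @ \oo --> (0 : R) ->
  (\forall n \near \oo, 0 < a n /\ exists G Y,
     [/\ measurable (~` G), (P (~` G) <= (delta n)%:E)%E, L1 Y, forall t, 0 <= Y t &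
         (forall t, G t -> V n t ^+ 2 <= Y t) /\ E Y <= C * a n ^+ 2]) ->
  bigO_p P V a.
Proof.
move=> C0 d0 H e e0.
pose M := Num.sqrt (2 * (C + 1) / e).
have M2 : M ^+ 2 = 2 * (C + 1) / e.
  by rewrite sqr_sqrtr//; apply: divr_ge0; [rewrite mulr_ge0 ?addr_ge0|exact: ltW].
have M0 : 0 < M by rewrite sqrtr_gt0 divr_gt0// mulr_gt0// ltr_wpDl.
exists M.
have dsmall : \forall n \near \oo, delta n < e / 2.
  by apply: (cvgr_lt (0 : R)) => //; rewrite divr_gt0.
near=> n.
have [an [G [Y [mG PG iY Y0 [VY EY]]]]] : 0 < a n /\ exists G Y,
     [/\ measurable (~` G), (P (~` G) <= (delta n)%:E)%E, L1 Y, forall t, 0 <= Y t &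
         (forall t, G t -> V n t ^+ 2 <= Y t) /\ E Y <= C * a n ^+ 2].
  by near: n.
have Ma : 0 < M ^+ 2 * a n ^+ 2 by rewrite mulr_gt0 ?exprn_gt0.
have mY := L1_measurable iY.
have mA : measurable [set t | (M ^+ 2 * a n ^+ 2 <= Y t)%R].
  by rewrite -[X in measurable X]setTI; apply: (measurable_fun_le (f := cst _)).
exists (~` G `|` [set t | (M ^+ 2 * a n ^+ 2 <= Y t)%R]); split.
- exact: measurableU.
- move=> t /= MV; have [Gt|] := pselect (G t); last by left.
  right => /=; apply: le_trans (VY t Gt).
  rewrite -exprMn -[V n t ^+ 2]real_normK ?num_real// lerXn2r ?nnegrE ?normr_ge0//; last exact: ltW.
  by rewrite mulr_ge0 ?(ltW M0) ?(ltW an).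
- apply: le_trans (measureU2 _ _ _) _ => //.
  apply: le_trans (leeD PG (markov_ineq iY Y0 Ma)) _.
  rewrite -EFinD lee_fin.
  have dn : delta n < e / 2 by near: n.
  rewrite [leRHS](splitr e); apply: lerD; first exact: ltW.
  apply: ltW.
  apply: le_lt_trans (_ : C / M ^+ 2 < _).
    rewrite invfM mulrA ler_pdivrMr ?exprn_gt0// mulrAC ler_pM2r ?invr_gt0 ?exprn_gt0//.
  rewrite M2 invf_div mulrA ltr_pdivrMr ?mulr_gt0 ?ltr_wpDl//.
  rewrite (_ : e / 2 * (2 * (C + 1)) = (C + 1) * e); last by field.
  by rewrite ltr_pM2r// ltrDl.
Unshelve. all: by end_near.
Qed.

End stochastic_order.

Section design_events.
Context (R : realType) d d' (T : measurableType d) (Z : measurableType d').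
Variables (P : probability T R) (F : probability Z R) (z : nat -> {RV P >-> Z}).
Hypothesis z_iid : iid F z.
Variables (n K : nat) (cell : Z -> option 'I_K) (s : Z -> bool).

Local Notation ind b := (b%:R : R).
Local Notation E P f := (\int[P]_t f t).
Local Notation mu k := (E F (fun u => ind (insel cell s k u))).

Hypothesis mcell : forall o, measurable_fun setT (fun u => ind (cell u == o)).
Hypothesis ms : measurable_fun setT (fun u => ind (s u)).
Hypothesis cell_total : F [set u | cell u = None] = 0%E.

Let mtally A (Q : Z -> bool) : measurable_fun setT (fun u => ind (Q u)) ->
  measurable_fun setT (tally z (n := n) A Q).
Proof. by move=> mQ; exact: measurable_total. Qed.

Lemma measurable_bool_set (Q : Z -> bool) : measurable_fun setT (fun u => ind (Q u)) ->
  measurable [set u | Q u].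
Proof.
move=> mQ; rewrite (_ : [set u | Q u] = setT `&` [set u | (1 <= ind (Q u))%R]).
  exact: (measurable_fun_le (f := cst 1)).
by rewrite setTI; apply/seteqP; split => u /=; case: (Q u); rewrite ?ler10.
Qed.

Let outside i : measurable [set t | cell (z i t) = None] /\
  (P [set t | cell (z i t) = None] <= 0%:E)%E.
Proof.
have mN : measurable [set u | cell u = None].
  rewrite (_ : [set u | _] = [set u | cell u == None]).
    exact: measurable_bool_set (mcell None).
  by apply/seteqP; split => u /=; [move=> ->|move/eqP].
split.
  rewrite -[X in measurable X]setTI.
  by apply: (measurable_funP (z i) measurableT [set u | cell u = None]).
have [/(_ i _ mN) + _] := z_iid; rewrite cell_total => h.
exact: (eq_ind _ (fun x => (x <= 0%:E)%E) (lexx _) _ (esym h)).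
Qed.

(** One lower tail bound per cell and index set, and the union bound. *)
Lemma sampling_event (J : finType) (A : J -> {set 'I_n}) (x : R) :
  (forall j k, x <= #|A j|%:R * mu k / 4) ->
  let G := [set t | (forall i : 'I_n, cell (z i t) != None) /\
     forall j, enough z cell s (A j) (fun k => #|A j|%:R * mu k / 4) t] in
  measurable (~` G) /\ (P (~` G) <= (#|J|%:R * K%:R * expR (- x))%:E)%E.
Proof.
move=> xA G.
pose low jk : set T := [set t | (tally z (A jk.1) (insel cell s jk.2) t <=
  #|A jk.1|%:R * mu jk.2 / 4)%R].
have mlow jk : measurable (low jk).
  rewrite -[X in measurable X]setTI; apply: (measurable_fun_le (g := cst _)) => //.
  exact/mtally/measurable_insel.
have Plow jk : (P (low jk) <= (expR (- x))%:E)%E.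
  apply: le_trans (tally_lower_tail z_iid (A jk.1) (measurable_insel mcell ms jk.2) erefl) _.
  by rewrite lee_fin ler_expR lerN2.
have [mU1 PU1] := union_bound (fun i : 'I_n => (outside i).1) (fun i => (outside i).2).
pose low' jk : set T := [set t | (tally z (A jk.1) (insel cell s jk.2) t <
  #|A jk.1|%:R * mu jk.2 / 4)%R].
have mlow' jk : measurable (low' jk).
  rewrite (_ : low' jk = ~` (setT `&` [set t | (#|A jk.1|%:R * mu jk.2 / 4 <=
      tally z (A jk.1) (insel cell s jk.2) t)%R])).
    apply/measurableC/(measurable_fun_le (f := cst _)) => //.
    exact/mtally/measurable_insel.
  rewrite /low' setTI; apply/seteqP; split => t /=; first by rewrite ltNge => /negP.
  by move=> /negP; rewrite -ltNge.
have Plow' jk : (P (low' jk) <= (expR (- x))%:E)%E.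
  apply: le_trans (Plow jk); apply: le_measure; rewrite ?inE// => t /=; exact: ltW.
have [mU2 PU2] := union_bound (J := (J * 'I_K)%type) mlow' Plow'.
have -> : ~` G = [set t | exists i : 'I_n, cell (z i t) = None] `|`
    [set t | exists jk : J * 'I_K, low' jk t].
  apply/seteqP; split => t /=.
    move=> /not_andP[/existsNP[i /negP]|/existsNP[j /negP]].
      by rewrite negbK => /eqP ?; left; exists i.
    by rewrite negb_forall => /existsP[k]; rewrite -ltNge => ?; right; exists (j, k).
  move=> [[i it]|[[j k] low_jk]] [G1 G2].
    by have := G1 i; rewrite it.
  by have /forallP/(_ k) := G2 j; rewrite leNgt => /negP; exact.
split; first exact: measurableU.
apply: le_trans (measureU2 _ _ _) _ => //.
apply: le_trans (leeD PU1 PU2) _; rewrite -EFinD lee_fin !sumr_const mul0rn add0r.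
by rewrite card_prod card_ord -natrM mulr_natl.
Qed.

End design_events.

(** * Oscillation of Hoelder functions *)

Section holder_oscillation.
Context (R : realType) (r : nat).
Implicit Types (x y : r.-tuple R) (g : r.-tuple R -> R).

Lemma edist_le x y (e : R) : 0 <= e -> (forall i, `|tnth x i - tnth y i| <= e) ->
  Defs.edist x y <= Num.sqrt r%:R * e.
Proof.
move=> e0 xy; rewrite /Defs.edist.
rewrite -[X in _ <= _ * X](ger0_norm e0) -sqrtr_sqr -sqrtrM ?ler0n//.
apply: ler_wsqrtr; rewrite mulr_natl -[in leRHS](card_ord r) -sumr_const.
apply: ler_sum => i _.
by rewrite -real_normK ?num_real// lerXn2r.
Qed.

Lemma cube_dist x y i : cube x -> cube y -> `|tnth x i - tnth y i| <= 1.
Proof.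
move=> /(_ i) /andP[x0 x1] /(_ i) /andP[y0 y1].
by rewrite ler_norml; apply/andP; split; lra.
Qed.

Lemma replace_coordE x j h i : tnth (replace_coord x j h) i = if i == j then h else tnth x i.
Proof. by rewrite tnth_mktuple. Qed.

Lemma replace_coord_twice x j h h' :
  replace_coord (replace_coord x j h) j h' = replace_coord x j h'.
Proof. by apply: eq_from_tnth => i; rewrite !replace_coordE; case: eqP. Qed.

Lemma replace_coord_id x j : replace_coord x j (tnth x j) = x.
Proof. by apply: eq_from_tnth => i; rewrite !replace_coordE; case: eqP => [->|]. Qed.

(** The mean value theorem in one coordinate. *)
Lemma partial_lipschitz g j (dg : r.-tuple R -> R) (B : R) x (h : R) :
  has_partial j g dg -> (forall v, open_cube v -> `|dg v| <= B) ->
  open_cube x -> 0 < h < 1 ->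
  `|g (replace_coord x j h) - g x| <= B * `|h - tnth x j|.
Proof.
move=> dgP dgB xo h01.
have open_repl (u : R) : 0 < u < 1 -> open_cube (replace_coord x j u).
  by move=> u01 i; rewrite replace_coordE; case: eqP.
pose phi (u : R) : R := g (replace_coord x j u).
have der (u : R) : 0 < u < 1 -> is_derive u (1 : R) phi (dg (replace_coord x j u)).
  move=> u01; have := dgP _ (open_repl u u01).
  rewrite replace_coordE eqxx.
  rewrite (_ : (fun h0 => g (replace_coord (replace_coord x j u) j h0)) = phi)//.
  by apply/funext => h0; rewrite replace_coord_twice.
have lip (a b : R) : 0 < a < 1 -> 0 < b < 1 -> a < b -> `|phi b - phi a| <= B * (b - a).
  move=> /andP[a0 a1] /andP[b0 b1] ab.
  have sub (u : R) : u \in `[a, b] -> 0 < u < 1.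
    by rewrite in_itv/= => /andP[au ub]; rewrite (lt_le_trans a0 au) (le_lt_trans ub b1).
  have [||c cab ->] := @MVT _ phi (fun u => dg (replace_coord x j u)) a b ab.
  - move=> u uab; apply: der; apply: sub; exact: subset_itv_oo_cc uab.
  - apply: derivable_within_continuous => u uab.
    by have [] := der u (sub u uab).
  rewrite normrM (gtr0_norm (_ : 0 < b - a)) ?subr_gt0// ler_wpM2r ?subr_ge0 ?(ltW ab)//.
  by apply: dgB; apply: open_repl; apply: sub; exact: subset_itv_oo_cc cab.
have -> : g x = phi (tnth x j) by rewrite /phi replace_coord_id.
rewrite -/(phi h).
have xj : 0 < tnth x j < 1 := xo j.
have [hx|xh|->] := ltgtP h (tnth x j).
- by rewrite distrC (distrC h) (gtr0_norm (_ : 0 < _ - h)) ?subr_gt0// lip.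
- by rewrite (gtr0_norm (_ : 0 < h - _)) ?subr_gt0// lip.
- by rewrite !subrr normr0 mulr0.
Qed.

(** The coordinates are changed one at a time. *)
Lemma open_cube_lipschitz g (B : R) x y (e : R) :
  (forall j, exists2 dg, has_partial j g dg & forall v, open_cube v -> `|dg v| <= B) ->
  open_cube x -> open_cube y -> 0 <= B ->
  (forall i, `|tnth y i - tnth x i| <= e) -> `|g y - g x| <= B * r%:R * e.
Proof.
move=> gP xo yo B0 xy.
pose path k : r.-tuple R := [tuple if (i < k)%N then tnth y i else tnth x i | i < r].
have patho k : open_cube (path k).
  by move=> i; rewrite tnth_mktuple; case: ifP.
suff claim k : (k <= r)%N -> `|g (path k) - g x| <= B * k%:R * e.
  have := claim r (leqnn r); congr (`|g _ - _| <= _).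
  by apply: eq_from_tnth => i; rewrite tnth_mktuple ltn_ord.
elim: k => [_|k IH kr].
  rewrite (_ : path 0 = x) ?subrr ?normr0 ?mulr0 ?mul0r//.
  by apply: eq_from_tnth => i; rewrite tnth_mktuple.
pose j := Ordinal kr.
have [dg dgP dgB] := gP j.
have -> : path k.+1 = replace_coord (path k) j (tnth y j).
  apply: eq_from_tnth => i; rewrite replace_coordE !tnth_mktuple ltnS leq_eqVlt.
  have [->|ij] := eqVneq i j; first by rewrite eqxx.
  by rewrite (_ : (i == k :> nat) = false)//; apply: contra_neqF ij => /eqP ik; exact: val_inj.
have := partial_lipschitz dgP dgB (patho k) (yo j).
rewrite [tnth (path k) j]tnth_mktuple ltnn => step.
rewrite -(subrK (g (path k)) (g (replace_coord _ _ _))) -addrA.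
apply: le_trans (ler_normD _ _) _.
rewrite -natr1 mulrDr mulr1 mulrDl [leRHS]addrC; apply: lerD; last exact: IH (ltnW kr).
by apply: le_trans step _; rewrite ler_wpM2l.
Qed.

(** Partial derivatives exist in the open cube only: the points are pulled towards
   the centre, and continuity on the closed cube accounts for the difference. *)
Lemma cube_lipschitz g (B : R) x y (e : R) :
  cube_continuous g ->
  (forall j, exists2 dg, has_partial j g dg & forall v, open_cube v -> `|dg v| <= B) ->
  cube x -> cube y -> 0 <= B ->
  (forall i, `|tnth y i - tnth x i| <= e) -> `|g y - g x| <= B * r%:R * e.
Proof.
move=> gc gP xc yc B0 xy.
apply/ler_addgt0Pr => eta eta0.
have eta2 : 0 < eta / 2 by rewrite divr_gt0.
have [dx dx0 gx] := gc x xc _ eta2; have [dy dy0 gy] := gc y yc _ eta2.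
pose m := Num.min 1 (Num.min dx dy) / (2 * (Num.sqrt r%:R + 1)).
have sq0 : 0 <= Num.sqrt r%:R :> R by rewrite sqrtr_ge0.
have mn0 : 0 < Num.min 1 (Num.min dx dy) by rewrite !lt_min ltr01 dx0.
have m0 : 0 < m by rewrite divr_gt0// mulr_gt0// ltr_wpDl.
have msq : Num.sqrt r%:R * m < Num.min 1 (Num.min dx dy).
  rewrite /m mulrA ltr_pdivrMr ?mulr_gt0 ?ltr_wpDl// mulrC ltr_pM2l//; lra.
have m1 : m < 1.
  rewrite /m ltr_pdivrMr ?mulr_gt0 ?ltr_wpDl// mul1r.
  apply: (@le_lt_trans _ _ 1); last lra.
  by rewrite ge_min lexx.
pose pull v : r.-tuple R := [tuple (1 - m) * tnth v i + m / 2 | i < r].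
have pullo v : cube v -> open_cube (pull v).
  move=> vc i; rewrite tnth_mktuple; have /andP[v0 v1] := vc i.
  by apply/andP; split; nra.
have pulld v : cube v -> forall i, `|tnth v i - tnth (pull v) i| <= m.
  move=> vc i; rewrite tnth_mktuple; have /andP[v0 v1] := vc i.
  by rewrite ler_norml; apply/andP; split; nra.
have open_sub v : open_cube v -> cube v.
  by move=> vo i; have /andP[v0 v1] := vo i; rewrite !ltW.
have dpull v : cube v -> Defs.edist v (pull v) < Num.min 1 (Num.min dx dy).
  by move=> vc; apply: le_lt_trans (edist_le (ltW m0) (pulld v vc)) msq.
have gxp : `|g x - g (pull x)| < eta / 2.
  apply: gx; first exact/open_sub/pullo.
  by apply: lt_le_trans (dpull x xc) _; rewrite !ge_min lexx orbT.
have gyp : `|g y - g (pull y)| < eta / 2.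
  apply: gy; first exact/open_sub/pullo.
  by apply: lt_le_trans (dpull y yc) _; rewrite !ge_min lexx !orbT.
have mid : `|g (pull y) - g (pull x)| <= B * r%:R * e.
  apply: open_cube_lipschitz gP (pullo _ xc) (pullo _ yc) B0 _ => i.
  rewrite !tnth_mktuple opprD addrACA subrr addr0 -mulrBr normrM.
  apply: le_trans (xy i); rewrite ler_piMl// ger0_norm; lra.
have -> : g y - g x = (g y - g (pull y)) + (g (pull y) - g (pull x)) - (g x - g (pull x)).
  by ring.
apply: le_trans (ler_normB _ _) _.
have := ler_normD (g y - g (pull y)) (g (pull y) - g (pull x)); lra.
Qed.

Lemma oscillation_bounded (t : R) g (C : R) : 0 <= t ->
  (forall x y, cube x -> cube y -> `|g y - g x| <= C * Defs.edist y x `^ t) ->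
  exists B, forall v, open_cube v -> `|g v| <= B.
Proof.
move=> t0 gC; pose x0 : r.-tuple R := [tuple 2^-1 | i < r].
have x0c : cube x0 by move=> i; rewrite tnth_mktuple; apply/andP; split; lra.
exists (`|g x0| + `|C| * Num.sqrt r%:R `^ t) => v vo.
have vc : cube v by move=> i; have /andP[v0 v1] := vo i; rewrite !ltW.
rewrite -(subrK (g x0) (g v)); apply: le_trans (ler_normD _ _) _; rewrite addrC lerD2l.
apply: le_trans (gC _ _ x0c vc) _.
apply: (@le_trans _ _ (`|C| * Defs.edist v x0 `^ t)).
  by rewrite ler_wpM2r ?powR_ge0// ler_norm.
rewrite ler_wpM2l// ge0_ler_powR ?nnegrE ?sqrtr_ge0//.
by rewrite -[leRHS]mulr1; apply: edist_le => // i; exact: cube_dist.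
Qed.

Lemma bounded_partials_lipschitz g : cube_continuous g ->
  (forall j, exists2 dg, has_partial j g dg & exists B, forall v, open_cube v -> `|dg v| <= B) ->
  exists2 C, 0 <= C & forall x y (e : R), cube x -> cube y ->
    (forall i, `|tnth y i - tnth x i| <= e) -> `|g y - g x| <= C * e.
Proof.
move=> gc gP.
have /choice[dg dgP] j : exists dg, has_partial j g dg /\
    exists B, forall v, open_cube v -> `|dg v| <= B.
  by have [dg dgP dgB] := gP j; exists dg.
have /choice[B BP] j : exists B, forall v, open_cube v -> `|dg j v| <= B := (dgP j).2.
exists ((\sum_j `|B j|) * r%:R) => [|x y e xc yc xy]; first by rewrite mulr_ge0 ?sumr_ge0.
apply: cube_lipschitz gc _ xc yc _ xy; last exact: sumr_ge0.
move=> j; exists (dg j) => [|v vo]; first exact: (dgP j).1.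
apply: le_trans (BP j v vo) _; apply: le_trans (ler_norm _) _.
by rewrite (bigD1 j)//= lerDl sumr_ge0.
Qed.

(** By induction on the order the partial derivatives are Lipschitz or Hoelder, in
   either case bounded. *)
Lemma holder_rec_lipschitz k (t : R) g : 0 <= t -> holder_rec k.+1 t g ->
  exists2 C, 0 <= C & forall x y (e : R), cube x -> cube y ->
    (forall i, `|tnth y i - tnth x i| <= e) -> `|g y - g x| <= C * e.
Proof.
move=> t0.
elim: k g => [|k IH] g /= [gc gP].
  have gP' j : exists2 dg, has_partial j g dg &
      exists B, forall v, open_cube v -> `|dg v| <= B.
    have [dg dgP [_ [C dgC]]] := gP j; exists dg => //; exact: oscillation_bounded t0 dgC.
  exact: bounded_partials_lipschitz gc gP'.
apply: bounded_partials_lipschitz gc _ => j.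
have [dg dgP /IH[C C0 dgC]] := gP j; exists dg => //.
pose x0 : r.-tuple R := [tuple 2^-1 | i < r].
exists (`|dg x0| + C) => v vo; rewrite -(subrK (dg x0) (dg v)).
apply: le_trans (ler_normD _ _) _; rewrite addrC lerD2l.
rewrite -[leRHS]mulr1; apply: dgC.
- by move=> i; rewrite tnth_mktuple; apply/andP; split; lra.
- by move=> i; have /andP[v0 v1] := vo i; rewrite !ltW.
- move=> i; apply: cube_dist => i'; last by rewrite tnth_mktuple; apply/andP; split; lra.
  by have /andP[v0 v1] := vo i'; rewrite !ltW.
Qed.

(** Smoothness beyond order one is of no use to piecewise constant approximation: it
   is bounded first derivatives that control the oscillation on a small box. *)
Lemma holder_oscillation (s : R) g : holder s g ->
  exists2 C, 0 <= C & forall x y (e : R), 0 <= e -> cube x -> cube y ->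
    (forall i, `|tnth y i - tnth x i| <= e) -> `|g y - g x| <= C * e `^ Num.min 1 s.
Proof.
move=> [s0]; case: (Num.truncn s) (truncn_itv (ltW s0)) => [|k] /andP[ks sk] gs.
  have -> : Num.min 1 s = s by rewrite min_r// ltW.
  move: gs => [_ [C gC]]; rewrite subr0 in gC.
  exists (`|C| * Num.sqrt r%:R `^ s); first by rewrite mulr_ge0 ?powR_ge0.
  move=> x y e e0 xc yc xy; apply: le_trans (gC x y xc yc) _.
  rewrite -mulrA -powRM ?sqrtr_ge0//.
  apply: (@le_trans _ _ (`|C| * Defs.edist y x `^ s)).
    by rewrite ler_wpM2r ?powR_ge0// ler_norm.
  rewrite ler_wpM2l// ge0_ler_powR ?nnegrE ?sqrtr_ge0 ?mulr_ge0 ?sqrtr_ge0 ?(ltW s0)//.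
  exact: edist_le.
have -> : Num.min 1 s = 1 by rewrite min_l// (le_trans _ ks)// (ler_nat R 1).
have t0 : 0 <= s - k.+1%:R by rewrite subr_ge0.
have [C C0 gC] := holder_rec_lipschitz t0 gs.
by exists C => // x y e e0 xc yc xy; rewrite powRr1//; exact: gC.
Qed.

Lemma holder_bounded (s : R) g : holder s g ->
  exists2 C, 0 <= C & forall x, cube x -> `|g x| <= C.
Proof.
move=> /holder_oscillation[C C0 gC].
pose x0 : r.-tuple R := [tuple 2^-1 | i < r].
have x0c : cube x0 by move=> i; rewrite tnth_mktuple; apply/andP; split; lra.
exists (`|g x0| + C) => [|x xc]; first by rewrite addr_ge0.
rewrite -(subrK (g x0) (g x)); apply: le_trans (ler_normD _ _) _; rewrite addrC lerD2l.
have -> : C = C * 1 `^ Num.min 1 s by rewrite powR1 mulr1.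
by apply: gC => // i; exact: cube_dist.
Qed.

End holder_oscillation.

(** * Splines of order zero and the cells of the cube *)

Section haar_cells.
Context (R : realType).

(** The spline of order zero, as a boolean. *)
Definition in_interval (t : nat -> R) (j : nat) (x : R) : bool :=
  if x == 1 then (t j < 1) && (t j.+1 == 1) else t j <= x < t j.+1.

Lemma measurable_in_interval t j :
  measurable_fun setT (fun x : R => (in_interval t j x)%:R : R).
Proof.
rewrite (_ : (fun _ => _) = fun x =>
    ((t j < 1) && (t j.+1 == 1))%:R * \1_[set 1] x +
    (1 - \1_[set 1] x) * \1_`[t j, t j.+1[ x).
  apply: measurable_funD; apply: measurable_funM => //.
  by apply: measurable_funB.
apply/funext => x; rewrite /in_interval !indicE.
have [->|x1] := eqVneq x 1.
  by rewrite mem_set// subrr mul0r addr0 mulr1.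
rewrite memNset; last by move=> /= /eqP; rewrite (negPf x1).
rewrite mulr0 add0r subr0 mul1r; congr (nat_of_bool _)%:R.
by apply/idP/idP; rewrite inE /= in_itv.
Qed.

Section knots.
Variables (t : nat -> R) (m : nat).
Hypotheses (t0 : t 0 = 0) (tm : t m = 1).
Hypothesis tmon : {homo t : j l / (j <= l)%N >-> j <= l}.

Lemma in_interval_inj j l x : in_interval t j x -> in_interval t l x -> j = l.
Proof.
wlog jl : j l / (j < l)%N => [wl jx lx|].
  by have [/wl|/wl|//] := ltngtP j l; [exact|move=> wl'; exact/esym/wl'].
have tjl : t j.+1 <= t l by exact: tmon.
rewrite /in_interval; case: eqP => _.
  by move=> /andP[_ /eqP tj1] /andP[tl _]; move: tjl; rewrite tj1 leNgt tl.
by move=> /andP[_ xj] /andP[lx _]; have := le_lt_trans (le_trans tjl lx) xj; rewrite ltxx.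
Qed.

Lemma in_interval_exists x : 0 <= x <= 1 -> exists2 j, (j < m)%N & in_interval t j x.
Proof.
move=> /andP[x0 x1].
pose A j : bool := if x == 1 then t j < 1 else t j <= x.
have A0 : A 0 by rewrite /A t0 ltr01; case: ifP.
have Am : ~~ A m.
  rewrite /A tm ltxx; case: eqP => // /eqP xn1.
  by rewrite -ltNge lt_neqAle xn1.
(* The interval begins at the last knot that is not beyond x. *)
have jump k : ~~ A k -> exists2 j, (j < k)%N & A j && ~~ A j.+1.
  elim: k => [|m' IH]; first by rewrite A0.
  have [Am' Am1|/IH[j jm' Aj] _] := boolP (A m').
    by exists m' => //; rewrite Am'.
  by exists j => //; exact: ltnW.
have [j jm /andP[Aj Aj1]] := jump m Am.
exists j => //; move: Aj Aj1; rewrite /in_interval /A; case: eqP => _.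
  by move=> -> /=; rewrite -leNgt => tj1; rewrite eq_le tj1 andbT -tm tmon.
by move=> ->; rewrite -ltNge.
Qed.

Lemma in_interval_closed j x : (j < m)%N -> in_interval t j x -> t j <= x <= t j.+1.
Proof.
move=> jm; rewrite /in_interval; case: eqP => [->|_].
  by move=> /andP[tj /eqP ->]; rewrite lexx andbT ltW.
by move=> /andP[-> /ltW].
Qed.

Lemma in_interval_01 j x : (j < m)%N -> in_interval t j x -> 0 <= x <= 1.
Proof.
move=> jm /(in_interval_closed jm)/andP[xj xj1]; apply/andP; split.
  by apply: le_trans xj; rewrite -t0 tmon.
by apply: le_trans xj1 _; rewrite -tm tmon.
Qed.

End knots.

Variable r : nat.

(** Splines of order zero are, up to scale, the indicator functions of the boxes
   of a rectangular partition of the cube. *)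
Record cell_basis K (q : r.-tuple R -> 'cV[R]_K) (cell : r.-tuple R -> option 'I_K)
    (sc : 'I_K -> R) (width : R) : Prop := CellBasis {
  cb_measurable : forall co, measurable_fun setT (fun w => (cell w == co)%:R : R);
  cb_cube : forall w, cell w = None <-> ~ cube w;
  cb_width : forall w v k, cell w = Some k -> cell v = Some k ->
    forall i, `|tnth v i - tnth w i| <= width;
  cb_basis : forall w k, q w k 0 = sc k * (cell w == Some k)%:R }.

Lemma tensor_bsplines_cells (K : nat -> nat) (q : forall n, r.-tuple R -> 'cV[R]_(K n)) :
  tensor_bsplines 0 q -> exists (cell : forall n, r.-tuple R -> option 'I_(K n))
    (sc : forall n, 'I_(K n) -> R) (C : R), forall n,
    (0 < K n)%N /\ cell_basis (q n) (cell n) (sc n) (C * (K n)%:R `^ (- r%:R^-1)).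
Proof.
move=> [m [t [idx [sc [c [C [c0 H]]]]]]].
pose in_cell n (k : 'I_(K n)) (w : r.-tuple R) :=
  [forall i, in_interval (t n i) (idx n k i) (tnth w i)].
exists (fun n w => [pick k | in_cell n k w]), sc, C => n.
have [knots widths idxI idxP qE] := H n.
have idx_lt k i : (idx n k i < m n i)%N.
  by have /(_ i) := (idxP (idx n k)).2 (ex_intro _ k erefl); rewrite addn0.
have K0 : (0 < K n)%N.
  have [k _] := (idxP [ffun=> 0%N]).1 (fun i => let: And4 mi _ _ _ := knots i in
    eq_ind _ (fun j => (j < m n i + 0)%N) (leq_trans mi (leq_addr 0 _)) _ (esym (ffunE _ i))).
  by case: k => j jK; exact: leq_ltn_trans jK.
split => //.
have cell_inj k l w : in_cell n k w -> in_cell n l w -> k = l.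
  move=> /forallP kw /forallP lw; apply: idxI; apply/ffunP => i.
  have [_ _ _ tmon] := knots i.
  exact: in_interval_inj tmon _ _ _ (kw i) (lw i).
have cellP w k : ([pick k' | in_cell n k' w] == Some k) = in_cell n k w.
  case: pickP => [k' k'w|noc].
    apply/eqP/idP => [[<-]//|kw]; congr Some; exact: cell_inj k'w kw.
  by rewrite noc.
have cellN w : [pick k' | in_cell n k' w] = None <-> forall k, ~~ in_cell n k w.
  case: pickP => [k' k'w|noc]; last by split=> // _ k; rewrite noc.
  by split=> // /(_ k'); rewrite k'w.
have mcell k : measurable_fun setT (fun w => (in_cell n k w)%:R : R).
  rewrite (_ : (fun _ => _) = fun w => \prod_(i < r)
      ((in_interval (t n i) (idx n k i) (tnth w i))%:R : R)).
    apply: measurable_prod => i _.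
    exact: (measurableT_comp (measurable_in_interval _ _) (measurable_tnth i)).
  apply/funext => w; rewrite /in_cell.
  have [/forallP kw|] := boolP [forall i, in_interval (t n i) (idx n k i) (tnth w i)].
    by rewrite big1// => i _; rewrite kw.
  by rewrite negb_forall => /existsP[i /negPf iw]; rewrite (bigD1 i)//= iw mul0r.
split.
- case=> [k|]; first by under eq_fun do rewrite cellP; exact: mcell.
  rewrite (_ : (fun _ => _) = fun w => 1 - \sum_k (in_cell n k w)%:R).
    by apply: measurable_funB => //; exact: measurable_sum.
  apply/funext => w; case: pickP => [k kw|noc].
    rewrite (bigD1 k)//= kw big1 ?addr0 ?subrr// => l lk.
    by case: (boolP (in_cell n l w)) => // lw; rewrite (cell_inj _ _ _ lw kw) eqxx in lk.
  by rewrite big1 ?subr0// => k _; rewrite noc.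
- move=> w; rewrite cellN; split.
    move=> noc wc.
    have /choice[f fP] i : exists j, (j < m n i)%N && in_interval (t n i) j (tnth w i).
      have [mi ti0 tim tmon] := knots i.
      have [j jm jw] := in_interval_exists ti0 tim tmon (wc i).
      by exists j; rewrite jm.
    have [k kf] : exists k, idx n k = [ffun i => f i].
      apply/idxP => i; rewrite ffunE addn0; by have /andP[] := fP i.
    move/negP: (noc k); apply; apply/forallP => i; rewrite kf ffunE.
    by have /andP[] := fP i.
  move=> wc k; apply/negP => /forallP kw; apply: wc => i.
  have [mi ti0 tim tmon] := knots i.
  exact: (@in_interval_01 (t n i) (m n i) ti0 tim tmon (idx n k i) _ (idx_lt k i) (kw i)).
- move=> w v k /eqP + /eqP; rewrite !cellP => /forallP kw /forallP kv i.
  have /andP[w1 w2] := @in_interval_closed _ (m n i) _ _ (idx_lt k i) (kw i).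
  have /andP[v1 v2] := @in_interval_closed _ (m n i) _ _ (idx_lt k i) (kv i).
  have := widths i (idx n k i); rewrite leq0n add0n idx_lt => /(_ isT)/andP[_ wd].
  by apply: le_trans wd; rewrite ler_norml; apply/andP; split; lra.
- move=> w k; rewrite qE cellP; congr (_ * _); rewrite /in_cell.
  have [/forallP kw|] := boolP [forall i, in_interval (t n i) (idx n k i) (tnth w i)].
    by rewrite big1// => i _; have := kw i; rewrite /in_interval /= => ->.
  rewrite negb_forall => /existsP[i /negPf iw]; rewrite (bigD1 i)//=.
  by move: iw; rewrite /in_interval => ->; rewrite mul0r.
Qed.

End haar_cells.

Section cell_probability.
Context (R : realType) (r : nat) (F0 : probability (obs R r) R).
Variables (K : nat) (q : r.-tuple R -> 'cV[R]_K) (cell : r.-tuple R -> option 'I_K).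
Variables (sc : 'I_K -> R) (width : R).
Hypothesis qcell : cell_basis q cell sc width.

Local Notation E f := (\int[F0]_u f u).
Local Notation p k := (E (fun u => (cell (obs_w u) == Some k)%:R)).

Lemma measurable_obs_w : measurable_fun setT (@obs_w R r).
Proof. exact: measurable_snd. Qed.

Lemma measurable_cell_obs co : measurable_fun setT (fun u => (cell (obs_w u) == co)%:R : R).
Proof. exact: (measurableT_comp (cb_measurable qcell co) measurable_obs_w). Qed.

Let p_ge0 k : 0 <= p k.
Proof. by apply: E_ge0 => u; exact: ler0n. Qed.

Let second_momentE i j :
  second_moment F0 q i j = (i == j)%:R * (sc i ^+ 2 * p i).
Proof.
rewrite mxE unlock -/(Rintegral _ _ _).
transitivity (E (fun u => (i == j)%:R * sc i ^+ 2 * (cell (obs_w u) == Some i)%:R)).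
  apply: eq_Rintegral => u _; rewrite !(cb_basis qcell).
  case: (eqVneq (cell (obs_w u))) => [->|_]; last by rewrite !mulr0 mul0r.
  rewrite !mulr1; case: (eqVneq i j) => [->|ij]; first by rewrite eqxx mul1r mulr1.
  rewrite (_ : (Some i == Some j) = false) ?mul0r ?mulr0//.
  by apply/eqP => -[ijE]; rewrite ijE eqxx in ij.
rewrite EZ ?mulrA//; apply: L1_ind; exact: measurable_cell_obs.
Qed.

Let diag_le_lambda_min k : lambda_min (second_moment F0 q) <= sc k ^+ 2 * p k.
Proof.
apply: ge_inf.
  exists 0 => l /= /eigenvalueP[v vA v0].
  have /existsP[j vj] : [exists j, v 0 j != 0].
    apply: contraR v0; rewrite negb_exists => /forallP vz.
    by apply/eqP/rowP => j; rewrite mxE; have := vz j; rewrite negbK => /eqP.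
  have := congr1 (fun M : 'rV_K => M 0 j) vA; rewrite /= mxE [in RHS]mxE.
  rewrite (bigD1 j)//= big1 ?addr0; last first.
    by move=> i ij; rewrite second_momentE (negPf ij) mul0r mulr0.
  rewrite second_momentE eqxx mul1r mulrC => /(mulIf vj) <-.
  by rewrite mulr_ge0 ?sqr_ge0.
rewrite /=; apply/eigenvalueP; exists (delta_mx 0 k).
  apply/rowP => j; rewrite mxE (bigD1 k)//= big1 ?addr0; last first.
    by move=> i ik; rewrite mxE eqxx (negPf ik) mul0r.
  rewrite second_momentE !mxE !eqxx mul1r.
  by case: (eqVneq k j) => [->|kj]; rewrite ?eqxx ?mulr1 ?mul1r ?mul0r ?mulr0.
apply/eqP => /rowP/(_ k); rewrite !mxE !eqxx => /eqP; by rewrite oner_eq0.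
Qed.

(** The two normalizations of the basis together keep every cell from being less
   likely than a multiple of 1 / K. *)
Lemma cell_probability (c C : R) : 0 < c -> c <= lambda_min (second_moment F0 q) ->
  (forall w, cube w -> enorm (q w) <= C * Num.sqrt K%:R) ->
  forall k, sc k != 0 /\ c <= C ^+ 2 * K%:R * p k.
Proof.
move=> c0 cl qC k.
have cp := le_trans cl (diag_le_lambda_min k).
have pos : 0 < sc k ^+ 2 * p k := lt_le_trans c0 cp.
have sc0 : sc k != 0.
  by apply/eqP => s0; move: pos; rewrite s0 expr0n/= mul0r ltxx.
split => //.
have [w wk] : exists w, cell w = Some k.
  apply: contrapT => /forallNP noc; move: pos.
  rewrite (_ : p k = 0) ?mulr0 ?ltxx//.
  rewrite -[RHS](E_cst F0 0); apply: eq_Rintegral => u _.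
  by case: eqP => // /noc.
have wc : cube w.
  by apply: contrapT => /(cb_cube qcell w).2; rewrite wk.
have := qC w wc; rewrite /enorm (bigD1 k)//= big1 ?addr0; last first.
  move=> l lk; rewrite (cb_basis qcell) wk; case: eqP => [[kl]|_].
    by rewrite kl eqxx in lk.
  by rewrite mulr0 expr0n.
rewrite (cb_basis qcell) wk eqxx mulr1 sqrtr_sqr => sck.
apply: le_trans cp _; rewrite ler_wpM2r//.
rewrite -[leLHS]real_normK ?num_real//.
have -> : C ^+ 2 * K%:R = (C * Num.sqrt K%:R) ^+ 2 by rewrite exprMn sqr_sqrtr.
rewrite lerXn2r ?nnegrE ?normr_ge0//; exact: le_trans (normr_ge0 _) sck.
Qed.

End cell_probability.

(** * Series regression on cells *)

Section diagonal_inverse.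
Context (R : realType) (ginv : forall k, 'M[R]_k -> 'M[R]_k).
Hypothesis ginvP : is_ginv ginv.

(** An invertible matrix has only one generalized inverse, whatever ginv picks
   for singular ones. *)
Lemma diagonal_quadratic K (A : 'M[R]_K) (a : 'I_K -> R) (v h : 'cV[R]_K) :
  (forall i j, A i j = (i == j)%:R * a i) -> (forall i, a i != 0) ->
  ((v^T *m ginv A) *m h) 0 0 = \sum_k v k 0 * h k 0 / a k.
Proof.
move=> AE a0.
have gE i j : ginv A i j = (i == j)%:R / a i.
  have := congr1 (fun M : 'M[R]_K => M i j) (ginvP A).
  rewrite /= mxE (bigD1 j)//= big1 ?addr0; last first.
    by move=> l lj; rewrite AE (negPf lj) mul0r mulr0.
  rewrite mxE (bigD1 i)//= big1 ?addr0; last first.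
    by move=> l li; rewrite AE eq_sym (negPf li) !mul0r.
  rewrite !AE !eqxx !mul1r; case: (eqVneq i j) => [<-|_].
    by rewrite !mul1r -[X in _ = X]mulr1 -mulrA => /(mulfI (a0 i)) h1; rewrite -[LHS](mulfK (a0 i)) h1 mul1r.
  rewrite !mul0r => /eqP; rewrite !mulf_eq0 (negPf (a0 i)) (negPf (a0 j)) orbF/=.
  by move/eqP.
rewrite mxE; apply: eq_bigr => k _; rewrite mxE (bigD1 k)//= big1 ?addr0; last first.
  by move=> l lk; rewrite gE (negPf lk) !mul0r mulr0.
rewrite gE eqxx mul1r !mxE; ring.
Qed.

End diagonal_inverse.

Section regressogram.
Context (R : realType) d (T : measurableType d) (r : nat) (P : probability T R).
Variables (ginv : forall k, 'M[R]_k -> 'M[R]_k) (z : nat -> {RV P >-> obs R r}).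
Hypothesis ginvP : is_ginv ginv.
Variables (n K : nat) (q : r.-tuple R -> 'cV[R]_K) (cell : r.-tuple R -> option 'I_K).
Variables (sc : 'I_K -> R) (width : R) (s : obs R r -> bool).
Hypothesis qcell : cell_basis q cell sc width.
Hypothesis sc0 : forall k, sc k != 0.

Let cellw (u : obs R r) := cell (obs_w u).

(** Distinct cells are disjoint, which makes the Gram matrix diagonal with the counts
   of the cells on the diagonal; the factors c cancel, as do the scale factors of the
   basis except for one. *)
Lemma regressogram (A : {set 'I_n}) (v : 'cV[R]_K) (c : R) t : c != 0 ->
  (forall k, 0 < tally z A (insel cellw s k) t) ->
  ((v^T *m ginv (c *: \sum_(i in A) (s (z i t))%:R *: (q (obs_w (z i t)) *m (q (obs_w (z i t)))^T)))
    *m (c *: \sum_(i in A) ((s (z i t))%:R * obs_y (z i t)) *: q (obs_w (z i t)))) 0 0 =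
  \sum_k v k 0 / sc k * cell_mean z cellw s (@obs_y R r) A k t.
Proof.
move=> c0 M0.
have qE i k : q (obs_w (z i t)) k 0 = sc k * (cellw (z i t) == Some k)%:R.
  exact: cb_basis qcell _ _.
rewrite (diagonal_quadratic ginvP (a := fun k => c * (sc k ^+ 2 * tally z A (insel cellw s k) t))).
- apply: eq_bigr => k _; rewrite mxE summxE.
  rewrite (eq_bigr (fun i : 'I_n => sc k * ((insel cellw s k (z i t))%:R * obs_y (z i t)))).
    rewrite -mulr_sumr -[\sum_(i in A) _]/(total z A (fun u => (insel cellw s k u)%:R * obs_y u) t).
    rewrite /cell_mean; field.
    by rewrite c0 sc0 gt_eqF// M0.
  by move=> i _; rewrite mxE qE /insel -mulnb natrM; ring.
- move=> i j; rewrite mxE summxE /tally /total.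
  case: (eqVneq i j) => [<-|ij]; last first.
    rewrite mul0r big1 ?mulr0// => l _; rewrite !mxE big_ord_recl big_ord0 addr0 mxE !qE.
    case: (eqVneq (cellw (z l t))) => [->|_]; last by rewrite !mulr0 mul0r mulr0.
    by rewrite (_ : (Some i == Some j) = false) ?mulr0//; apply/eqP => -[] /eqP; rewrite (negPf ij).
  rewrite mul1r !mulr_sumr; apply: eq_bigr => l _.
  rewrite !mxE big_ord_recl big_ord0 addr0 mxE !qE /insel -mulnb natrM.
  case: (eqVneq (cellw (z l t))) => _; rewrite ?mulr0 ?mulr1//; ring.
- move=> k; rewrite !mulf_neq0 ?expf_neq0//; by rewrite gt_eqF.
Qed.

End regressogram.

(** * Conditional expectations *)

Section conditional_expectation.
Context (R : realType) d d' (T : measurableType d) (X : measurableType d').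
Variables (P : probability T R) (x : T -> X).
Hypothesis mx : measurable_fun setT x.

Local Notation L1 f := (P.-integrable setT (EFin \o f)).
Local Notation E f := (\int[P]_t f t).
Local Notation ind b := (b%:R : R).

Lemma E_restrict (f : T -> R) (Q : X -> bool) :
  \int[P]_(t in x @^-1` [set u | Q u]) f t = E (fun t => ind (Q (x t)) * f t).
Proof.
rewrite Rintegral_mkcond; apply: eq_Rintegral => t _; rewrite patchE.
case: ifPn; rewrite ?inE ?notin_setE/=; first by move=> ->; rewrite mul1r.
by move=> /negP/negPf ->; rewrite mul0r.
Qed.

Lemma cond_exp_ind (Y : T -> R) (g : X -> R) (Q : X -> bool) : cond_exp P x Y g ->
  measurable [set u | Q u] ->
  E (fun t => ind (Q (x t)) * Y t) = E (fun t => ind (Q (x t)) * g (x t)).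
Proof. by move=> [_ _ _ h] mQ; rewrite -!E_restrict /Rintegral h. Qed.

Let measurable_ind (Q : X -> bool) : measurable [set u | Q u] ->
  measurable_fun setT (fun u => ind (Q u)).
Proof.
move=> mQ; rewrite (_ : (fun _ => _) = \1_[set u | Q u]); first exact: measurable_indic.
by apply/funext => u; rewrite indicE; case: (boolP (Q u)) => Qu;
  [rewrite mem_set|rewrite memNset//=; exact/negP].
Qed.

Lemma L1_ind_fun (Q : X -> bool) (f : T -> R) : measurable [set u | Q u] -> L1 f ->
  L1 (fun t => ind (Q (x t)) * f t).
Proof.
move=> mQ fi; apply: (L1_dominated (g := fun t => `|f t|)).
- apply: measurable_funM; last exact: L1_measurable fi.
  exact: measurableT_comp (measurable_ind mQ) mx.
- exact: integrable_norm.
- by move=> t; case: (Q _); rewrite ?mul1r ?mul0r ?normr0.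
Qed.

Lemma cond_exp_orthogonal (Y : T -> R) (g : X -> R) (Q : X -> bool) : cond_exp P x Y g ->
  measurable [set u | Q u] -> E (fun t => ind (Q (x t)) * (Y t - g (x t))) = 0.
Proof.
move=> gP mQ; have [_ iY ig _] := gP.
transitivity (E (fun t => ind (Q (x t)) * Y t - ind (Q (x t)) * g (x t))).
  by apply: eq_Rintegral => t _; rewrite mulrBr.
by rewrite RintegralB ?(cond_exp_ind gP mQ) ?subrr//; exact: L1_ind_fun.
Qed.

(** A residual orthogonal to all indicators of x is orthogonal to all bounded
   functions of x, because these are uniform limits of step functions. *)
Lemma orthogonal_bounded (W : T -> R) (phi : X -> R) (c : R) :
  L1 W -> (forall Q : X -> bool, measurable [set u | Q u] ->
    E (fun t => ind (Q (x t)) * W t) = 0) ->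
  measurable_fun setT phi -> (forall u, `|phi u| <= c) ->
  E (fun t => phi (x t) * W t) = 0.
Proof.
move=> iW W0 mphi phic.
have mphix : measurable_fun setT (fun t => phi (x t)) by exact: measurableT_comp.
have iphiW : L1 (fun t => phi (x t) * W t).
  apply: (L1_dominated (g := fun t => c * `|W t|)).
  - by apply: measurable_funM => //; exact: L1_measurable iW.
  - by apply: L1Z; exact: integrable_norm.
  - by move=> t; rewrite normrM ler_wpM2r.
have EW : E W = 0.
  have := W0 xpredT; rewrite (_ : [set u | xpredT u] = setT); last by apply/seteqP; split.
  by move=> /(_ measurableT) <-; apply: eq_Rintegral => t _; rewrite mul1r.
apply/eqP; rewrite -normr_eq0; apply/eqP/le_anti; rewrite normr_ge0 andbT.
apply/ler_addgt0Pr => e e0; rewrite add0r.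
have iaW : L1 (fun t => `|W t|) by exact: integrable_norm.
have EaW : 0 <= E (fun t => `|W t|) by apply: E_ge0.
pose m : R := (E (fun t => `|W t|) + 1) / e.
have m0 : 0 < m by rewrite divr_gt0// ltr_wpDl.
pose psi u := m * (phi u + c).
have psi0 u : 0 <= psi u.
  rewrite mulr_ge0 ?(ltW m0)// -lerBlDr sub0r; have := phic u.
  by rewrite ler_norml => /andP[].
pose N := (Num.truncn (m * (c + c))).+1.
have psiN u : (Num.truncn (psi u) < N)%N.
  rewrite ltnS; apply: le_truncn; rewrite ler_wpM2l ?(ltW m0)// lerD2r.
  by apply: le_trans (phic u); rewrite ler_norm.
have mpsi : measurable_fun setT psi.
  by apply: measurable_funM => //; exact: measurable_funD.
pose Q (j : 'I_N) u := Num.truncn (psi u) == j.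
have mQ j : measurable [set u | Q j u].
  rewrite (_ : [set u | _] = (setT `&` [set u | (j%:R <= psi u)%R]) `\`
      (setT `&` [set u | (j.+1%:R <= psi u)%R])).
    by apply: measurableD; apply: (measurable_fun_le (f := cst _)).
  rewrite !setTI; apply/seteqP; split => u; rewrite /Q/=.
    move=> /eqP <-; have /andP[a b] := truncn_itv (psi0 u); split => //.
    by apply/negP; rewrite -ltNge.
  move=> [a /negP]; rewrite -ltNge => b; apply/eqP.
  by apply: truncn_def; rewrite a.
pose step u := \sum_(j < N) (j%:R / m) * ind (Q j u).
have step_close u : `|phi u + c - step u| <= m^-1.
  rewrite /step (bigD1 (Ordinal (psiN u)))//= /Q/= eqxx mulr1 big1 ?addr0; last first.
    move=> j ju; rewrite (_ : (_ == _) = false) ?mulr0//; apply: contra_neqF ju => /eqP uj.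
    exact/val_inj/esym.
  have -> : phi u + c = psi u / m by rewrite /psi mulrC mulKf// gt_eqF.
  rewrite -mulrBl normrM normfV (gtr0_norm m0) ler_piMl ?invr_ge0 ?(ltW m0)//.
  have /andP[a b] := truncn_itv (psi0 u).
  rewrite ger0_norm ?subr_ge0// lerBlDr addrC natr1; exact: ltW.
have iQ j : L1 (fun t => ind (Q j (x t)) * W t) by exact: L1_ind_fun.
have Estep : E (fun t => step (x t) * W t) = 0.
  transitivity (E (fun t => \sum_(j < N) (j%:R / m) * (ind (Q j (x t)) * W t))).
    by apply: eq_Rintegral => t _; rewrite mulr_suml; apply: eq_bigr => j _; rewrite mulrA.
  rewrite E_sum; last by move=> j; exact: L1Z.
  by rewrite big1// => j _; rewrite EZ// W0// mulr0.
have istep : L1 (fun t => step (x t) * W t).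
  under eq_fun do rewrite mulr_suml.
  by apply: L1_sum => j; under eq_fun do rewrite -mulrA; exact: L1Z.
have -> : E (fun t => phi (x t) * W t) = E (fun t => (phi (x t) + c - step (x t)) * W t).
  transitivity (E (fun t => phi (x t) * W t + (c * W t - step (x t) * W t))); last first.
    by apply: eq_Rintegral => t _; ring.
  rewrite ED//; last by apply: L1B => //; exact: L1Z.
  rewrite RintegralB//; last exact: L1Z.
  by rewrite EZ// EW Estep mulr0 subr0 addr0.
have id : L1 (fun t => (phi (x t) + c - step (x t)) * W t).
  rewrite (_ : (fun t => _) = fun t => phi (x t) * W t + (c * W t - step (x t) * W t)).
    by apply: L1D => //; apply: L1B => //; exact: L1Z.
  by apply/funext => t; ring.
apply: le_trans (le_normr_Rintegral measurableT id) _.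
apply: (@le_trans _ _ (m^-1 * E (fun t => `|W t|))).
  rewrite -EZ//; apply: E_le; [exact: integrable_norm|exact: L1Z|].
  by move=> t; rewrite normrM ler_wpM2r.
rewrite /m invf_div mulrAC ler_pdivrMr ?ltr_wpDl//; nra.
Qed.

Lemma cond_exp_bounded_moment (V : T -> R) : cond_exp_bounded P x V ->
  exists2 C, 0 <= C & L1 V /\ forall Q : X -> bool, measurable [set u | Q u] ->
    E (fun t => ind (Q (x t)) * V t) <= C * E (fun t => ind (Q (x t))).
Proof.
move=> [g [C [gP gC]]]; exists `|C| => //.
have [mg iV ig _] := gP; split => // Q mQ.
rewrite (cond_exp_ind gP mQ) -EZ; last first.
  have := L1_ind_fun mQ (L1_cst P 1); by under eq_fun do rewrite mulr1.
apply: E_le.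
- exact: L1_ind_fun.
- apply: L1Z; have := L1_ind_fun mQ (L1_cst P 1); by under eq_fun do rewrite mulr1.
move=> t; rewrite mulrC ler_wpM2r ?ler0n//.
by apply: le_trans (ler_norm _) _; apply: le_trans (gC _) (ler_norm _).
Qed.

End conditional_expectation.

(** * Rates of the expansions *)

Section asymptotics.
Context (R : realType).

(** Since K ln K is negligible before n, the exponent eventually exceeds 2 ln K, which
   leaves a bound of order 1 / K. *)
Lemma empty_cell_rate (K : nat -> nat) (c b : R) : 0 < c ->
  (fun n => (K n)%:R : R) @ \oo --> +oo ->
  (fun n => (K n)%:R * ln (K n)%:R / n%:R : R) @ \oo --> (0 : R) ->
  (fun n => b * (K n)%:R * expR (- (c * n%:R / (K n)%:R))) @ \oo --> (0 : R).
Proof.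
move=> c0 hK hKln.
have KV : (fun n => `|b| / (K n)%:R) @ \oo --> (0 : R).
  rewrite -[X in _ --> X](mulr0 `|b|); apply: cvgMr.
  by apply/gtr0_cvgV0 => //; exact: cvgry_gt hK _.
have KV' : (fun n => - (`|b| / (K n)%:R)) @ \oo --> (0 : R).
  by rewrite -[X in _ --> X]oppr0; exact: cvgN.
apply: squeeze_cvgr KV' KV.
near=> n.
have K0 : 0 < (K n)%:R :> R by near: n; exact: cvgry_gt.
have n0 : 0 < n%:R :> R by rewrite ltr0n; near: n; exact: nbhs_infty_gt.
have small : (K n)%:R * ln (K n)%:R / n%:R <= c / 2.
  near: n; apply: (cvgr_le (0 : R)) => //; by rewrite divr_gt0.
rewrite -ler_norml !normrM (gtr0_norm K0) (gtr0_norm (expR_gt0 _)) -[leLHS]mulrA ler_wpM2l//.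
have KE : (K n)%:R^-1 = (K n)%:R * expR (- (2 * ln (K n)%:R)) :> R.
  rewrite expRN mulr2n mulrDl mul1r expRD lnK ?posrE//; field; by rewrite gt_eqF.
rewrite [leRHS]KE ler_wpM2l ?(ltW K0)// ler_expR lerN2.
rewrite ler_pdivlMr// mulrAC.
move: small; rewrite ler_pdivrMr//; lra.
Unshelve. all: by end_near.
Qed.

(** Up to constants moment_rate / n is the sum of the squares of the four rates. *)
Lemma moment_rate_le (n k : nat) (zg za A B rho : R) : (0 < n)%N -> 0 <= A -> 0 <= B ->
  Num.sqrt n%:R * k%:R `^ (- zg - za) + k%:R `^ (- zg) + k%:R `^ (- za) +
    Num.sqrt (k%:R / n%:R) <= rho -> (0 < k)%N ->
  n%:R^-1 * moment_rate n k (A * k%:R `^ (- zg)) (B * k%:R `^ (- za)) <=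
  (1 + A ^+ 2 + B ^+ 2 + (A * B) ^+ 2) * rho ^+ 2.
Proof.
move=> n0 A0 B0 hrho k0.
have n0R : 0 < n%:R :> R by rewrite ltr0n.
have e1 : k%:R / n%:R = Num.sqrt (k%:R / n%:R) ^+ 2 :> R by rewrite sqr_sqrtr ?divr_ge0.
have e2 : n%:R = Num.sqrt n%:R ^+ 2 :> R by rewrite sqr_sqrtr.
have e3 : k%:R `^ (- zg - za) = k%:R `^ (- zg) * k%:R `^ (- za) :> R.
  by rewrite powRD// (_ : (k%:R == 0) = false) ?implybT// pnatr_eq0 gtn_eqF.
move: hrho; rewrite e3.
have := powR_ge0 (k%:R : R) (- zg); have := powR_ge0 (k%:R : R) (- za).
have := sqrtr_ge0 (n%:R : R); have := sqrtr_ge0 (k%:R / n%:R : R).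
rewrite /moment_rate.
have -> : n%:R^-1 * (k%:R + n%:R * (A * k%:R `^ (- zg)) ^+ 2 +
    n%:R ^+ 2 * (A * k%:R `^ (- zg) * (B * k%:R `^ (- za))) ^+ 2 +
    n%:R * (B * k%:R `^ (- za)) ^+ 2) =
   Num.sqrt (k%:R / n%:R) ^+ 2 + A ^+ 2 * (k%:R `^ (- zg)) ^+ 2 +
   (A * B) ^+ 2 * (Num.sqrt n%:R * (k%:R `^ (- zg) * k%:R `^ (- za))) ^+ 2 +
   B ^+ 2 * (k%:R `^ (- za)) ^+ 2.
  rewrite -e1 (exprMn _ (Num.sqrt n%:R)) -e2; field; by rewrite gt_eqF.
set a := Num.sqrt (_ / _); set sn := Num.sqrt _; set g := _ `^ (- zg); set e := _ `^ (- za).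
move=> a0 sn0 e0 g0.
set f := sn * (g * e) => hrho; have f0 : 0 <= f by rewrite !mulr_ge0.
have rho0 : 0 <= rho by apply: le_trans hrho; rewrite !addr_ge0.
have sq x : 0 <= x -> x <= rho -> x ^+ 2 <= rho ^+ 2 by move=> x0 xr; rewrite lerXn2r.
have := sq a a0; have := sq g g0; have := sq f f0; have := sq e e0.
move=> /(_ ltac:(lra)) h1 /(_ ltac:(lra)) h2 /(_ ltac:(lra)) h3 /(_ ltac:(lra)) h4.
have A2 := sqr_ge0 A; have B2 := sqr_ge0 B; have AB2 := sqr_ge0 (A * B).
rewrite !mulrDl mul1r -!addrA; apply: lerD => //; apply: lerD; first exact: ler_wpM2l.
by rewrite addrC; apply: lerD; exact: ler_wpM2l.
Qed.

End asymptotics.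

Section expansions.
Context (R : realType) d d' (Omega : measurableType d) (Z : measurableType d').
Variables (P : probability Omega R) (F : probability Z R) (z : nat -> {RV P >-> Z}).
Hypothesis z_iid : iid F z.
Variables (K : nat -> nat) (cell : forall n, Z -> option 'I_(K n)) (s : Z -> bool).
Variables (y h gam alp : Z -> R) (c1 c3 Ce Ch Cg Ca A B zg za : R) (rate : nat -> R).
Hypothesis hK : (fun n => (K n)%:R : R) @ \oo --> +oo.
Hypothesis hKln : (fun n => (K n)%:R * ln (K n)%:R / n%:R : R) @ \oo --> (0 : R).
Hypothesis mcell : forall n co, measurable_fun setT (fun u => (cell n u == co)%:R : R).
Hypothesis ms : measurable_fun setT (fun u => (s u)%:R : R).
Hypothesis cell_total : forall n, F [set u | cell n u = None] = 0%E.
Hypotheses (A0 : 0 <= A) (B0 : 0 <= B) (c30 : 0 < c3).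
Hypothesis cell_prob : forall n k,
  c3 <= (K n)%:R * \int[F]_u (incell (cell n) k u)%:R.
Hypothesis design : forall n, regression_design F (cell n) s y h gam alp c1 Ce Ch Cg Ca
  (A * (K n)%:R `^ (- zg)) (B * (K n)%:R `^ (- za)).
Hypothesis rate_ge : forall n, (0 < n)%N ->
  Num.sqrt n%:R * (K n)%:R `^ (- zg - za) + (K n)%:R `^ (- zg) + (K n)%:R `^ (- za) +
    Num.sqrt ((K n)%:R / n%:R) <= rate n.

Let mu_low n k (m : nat) c2 : (0 < K n)%N -> 0 <= c2 -> c2 * n%:R <= m%:R :> R ->
  c1 * c2 * c3 / 4 * n%:R / (K n)%:R <=
  m%:R * \int[F]_u (insel (cell n) s k u)%:R / 4.
Proof.
move=> K0 c20 mn; have K0R : 0 < (K n)%:R :> R by rewrite ltr0n.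
have c10 := rd_c1 (design n).
have pk : c3 / (K n)%:R <= \int[F]_u (incell (cell n) k u)%:R.
  by rewrite ler_pdivrMr// mulrC.
have mk : c1 * (c3 / (K n)%:R) <= \int[F]_u (insel (cell n) s k u)%:R.
  by apply: le_trans (rd_mu (design n) k); rewrite ler_wpM2l ?(ltW c10).
have -> : c1 * c2 * c3 / 4 * n%:R / (K n)%:R =
    (c2 * n%:R) * (c1 * (c3 / (K n)%:R)) / 4.
  by field; rewrite gt_eqF.
rewrite ler_wpM2r ?invr_ge0//; apply: ler_pM => //; first by rewrite mulr_ge0.
by rewrite mulr_ge0 ?(ltW c10)// divr_ge0 ?(ltW c30).
Qed.

Let scaled_moment n (V : Omega -> R) (X Y : Omega -> R) (C : R) (G : set Omega) : (0 < n)%N ->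
  (0 < K n)%N -> 0 <= C ->
  P.-integrable setT (EFin \o Y) -> (forall t, 0 <= Y t) ->
  (forall t, G t -> X t ^+ 2 <= Y t) ->
  \int[P]_t Y t <= C * moment_rate n (K n) (A * (K n)%:R `^ (- zg)) (B * (K n)%:R `^ (- za)) ->
  (forall t, G t -> V t = (Num.sqrt n%:R)^-1 * X t) ->
  let Y' t := n%:R^-1 * Y t in
  [/\ P.-integrable setT (EFin \o Y'), forall t, 0 <= Y' t,
     forall t, G t -> V t ^+ 2 <= Y' t &
     \int[P]_t Y' t <= C * (1 + A ^+ 2 + B ^+ 2 + (A * B) ^+ 2) * rate n ^+ 2].
Proof.
move=> n0 K0 C0 iY Y0 XY EY VX Y'; split.
- exact: L1Z.
- by move=> t; rewrite mulr_ge0 ?invr_ge0.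
- move=> t Gt; rewrite VX// exprMn exprVn sqr_sqrtr ?ler0n// ler_wpM2l ?invr_ge0//.
  exact: XY.
rewrite EZ//; apply: (@le_trans _ _ (C * (n%:R^-1 * moment_rate n (K n)
    (A * (K n)%:R `^ (- zg)) (B * (K n)%:R `^ (- za))))).
  by rewrite mulrCA ler_wpM2l ?invr_ge0.
rewrite -[leRHS]mulrA ler_wpM2l//; apply: moment_rate_le => //; exact: rate_ge.
Qed.

Let rate_gt0 n : (0 < n)%N -> (0 < K n)%N -> 0 < rate n.
Proof.
move=> n0 K0; apply: lt_le_trans (rate_ge n0).
have kg : 0 < (K n)%:R `^ (- zg) by apply: powR_gt0; rewrite ltr0n.
rewrite -!addrA addrCA ltr_pwDl// !addr_ge0 ?mulr_ge0 ?sqrtr_ge0 ?powR_ge0//.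
Qed.

Let K_gt0 : \forall n \near \oo, (0 < K n)%N.
Proof.
near=> n; rewrite -(ltr0n R); near: n; exact: cvgry_gt hK _.
Unshelve. all: by end_near.
Qed.

Let moment_constant_ge0 L c2 : 0 <= c2 -> 0 <= moment_constant c1 Ce Ch Cg Ca L c2.
Proof.
move=> c20; have c10 := rd_c1 (design 0).
have Ce0 : 0 <= Ce.
  by apply: le_trans (rd_eps_var1 (design 0)); apply: E_ge0 => u; exact: sqr_ge0.
have Ch0 : 0 <= Ch.
  by apply: le_trans (rd_h_var1 (design 0)); apply: E_ge0 => u; exact: sqr_ge0.
have vy0 : 0 <= dev_var c1 Ce Cg.
  apply: addr_ge0; last by rewrite mulr_ge0 ?sqr_ge0.
  by apply: divr_ge0; [rewrite mulr_ge0|exact: ltW c10].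
have c12 : 0 <= c1 * c2 by rewrite mulr_ge0 ?(ltW c10).
have t1 : 0 <= Ch * dev_var c1 Ce Cg * (4 / (c1 * c2)).
  by apply: mulr_ge0; [exact: mulr_ge0|exact: divr_ge0].
have t2 : 0 <= dev_var c1 Ce Cg * (40 * Ca ^+ 2 / (c1 * c2)).
  by apply: mulr_ge0 => //; apply: divr_ge0 => //; rewrite mulr_ge0 ?sqr_ge0.
have t3 : 0 <= 2 * Ca ^+ 2 + 2 * Ch by apply: addr_ge0; [rewrite mulr_ge0 ?sqr_ge0|rewrite mulr_ge0].
rewrite /moment_constant mulr_ge0//.
by rewrite !addr_ge0// mulr_ge0 ?sqr_ge0// addr_ge0.
Qed.

Theorem crossfit_expansion (L : nat) (I : forall n, 'I_L -> {set 'I_n})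
    (V : nat -> Omega -> R) :
  (2 <= L)%N -> balanced_partition R I ->
  (\forall n \near \oo, forall t, fold_event F z (cell n) s (I n) t ->
    V n t = (Num.sqrt n%:R)^-1 * crossfit_remainder z (cell n) s y h gam alp (I n) t) ->
  bigO_p P V rate.
Proof.
move=> L2 [disj cover [c2 c20 size] bal] VE.
pose MC := moment_constant c1 Ce Ch Cg Ca L c2.
apply: (bigO_p_of_moment (C := MC * (1 + A ^+ 2 + B ^+ 2 + (A * B) ^+ 2))
  (delta := fun n => L%:R * (K n)%:R * expR (- (c1 * c2 * c3 / 4 * n%:R / (K n)%:R)))).
- by rewrite mulr_ge0 ?(moment_constant_ge0 _) ?(ltW c20)// !addr_ge0 ?sqr_ge0.
- apply: empty_cell_rate => //.
  by rewrite divr_gt0// !mulr_gt0// (rd_c1 (design 0)).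
near=> n.
have n0 : (0 < n)%N by near: n; exact: nbhs_infty_gt.
have K0 : (0 < K n)%N by near: n; exact: K_gt0.
have Isize : forall l, c2 * n%:R <= #|~: I n l|%:R :> R.
  have : forall l, c2 * n%:R <= #|I n l|%:R /\ c2 * n%:R <= #|~: I n l|%:R by near: n.
  by move=> h' l; have [] := h' l.
have part (i : 'I_n) : exists2 l, i \in I n l & forall l', i \in I n l' -> l' = l.
  have : i \in (\bigcup_l I n l)%SET by rewrite cover finset.inE.
  move=> /finset.bigcupP[l _ il]; exists l => // l' il'.
  apply/eqP/negPn/negP => ll'; have /setP/(_ i) := disj n _ _ ll'.
  by rewrite !finset.inE il il'.
split; first exact: rate_gt0.
have [Y [iY Y0 XY EY]] := crossfit_remainder_moment z_iid (@mcell n) ms (design n) L2 part (bal n)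
  n0 c20 Isize.
have VX : forall t, fold_event F z (cell n) s (I n) t ->
    V n t = (Num.sqrt n%:R)^-1 * crossfit_remainder z (cell n) s y h gam alp (I n) t by near: n.
have [iY' Y'0 VY' EY'] := scaled_moment (V := V n)
  (G := [set t | fold_event F z (cell n) s (I n) t]) n0 K0
  (moment_constant_ge0 L (ltW c20)) iY Y0 XY EY VX.
have [mG PG] := sampling_event z_iid (@mcell n) ms (cell_total n) (A := fun l => ~: I n l)
  (fun l k => mu_low k K0 (ltW c20) (Isize l)).
exists [set t | fold_event F z (cell n) s (I n) t], (fun t => n%:R^-1 * Y t).
have GE : [set t | fold_event F z (cell n) s (I n) t] = [set t | (forall i : 'I_n, cell n (z i t) != None) /\
     forall j, enough z (cell n) s (~: I n j) (fun k => #|~: I n j|%:R *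
       \int[F]_u (insel (cell n) s k u)%:R / 4) t].
  by apply/seteqP; split => t /=;
    [move=> /andP[/forallP ? /forallP ?]|move=> [? ?]; apply/andP; split; apply/forallP].
split => //.
- by rewrite GE.
- by rewrite GE; apply: le_trans PG _; rewrite card_ord.
Unshelve. all: by end_near.
Qed.

Theorem plugin_expansion (V : nat -> Omega -> R) :
  (\forall n \near \oo, forall t, full_event F z n (cell n) s t ->
    V n t = (Num.sqrt n%:R)^-1 * plugin_remainder F z n (cell n) s y h gam alp t) ->
  bigO_p P V rate.
Proof.
move=> VE.
pose MC := moment_constant c1 Ce Ch Cg Ca 1 1.
apply: (bigO_p_of_moment (C := MC * (1 + A ^+ 2 + B ^+ 2 + (A * B) ^+ 2))
  (delta := fun n => 1%:R * (K n)%:R * expR (- (c1 * 1 * c3 / 4 * n%:R / (K n)%:R)))).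
- by rewrite mulr_ge0 ?(moment_constant_ge0 _)// !addr_ge0 ?sqr_ge0.
- apply: empty_cell_rate => //.
  by rewrite divr_gt0// !mulr_gt0// (rd_c1 (design 0)).
near=> n.
have n0 : (0 < n)%N by near: n; exact: nbhs_infty_gt.
have K0 : (0 < K n)%N by near: n; exact: K_gt0.
split; first exact: rate_gt0.
have [Y [iY Y0 XY EY]] := plugin_remainder_moment z_iid (@mcell n) ms (design n) n0.
have VX : forall t, full_event F z n (cell n) s t ->
    V n t = (Num.sqrt n%:R)^-1 * plugin_remainder F z n (cell n) s y h gam alp t by near: n.
have [iY' Y'0 VY' EY'] := scaled_moment (V := V n)
  (G := [set t | full_event F z n (cell n) s t]) n0 K0
  (moment_constant_ge0 1 ler01) iY Y0 XY EY VX.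
have cardT : #|[set: 'I_n]%SET| = n by rewrite cardsT card_ord.
have low (j : 'I_1) k : c1 * 1 * c3 / 4 * n%:R / (K n)%:R <=
   #|[set: 'I_n]%SET|%:R * \int[F]_u (insel (cell n) s k u)%:R / 4.
  by apply: mu_low => //; rewrite cardT mul1r.
have [mG PG] := sampling_event z_iid (@mcell n) ms (cell_total n) (A := fun _ : 'I_1 => [set: 'I_n]%SET) low.
exists [set t | full_event F z n (cell n) s t], (fun t => n%:R^-1 * Y t).
have GE : [set t | full_event F z n (cell n) s t] = [set t | (forall i : 'I_n, cell n (z i t) != None) /\
     forall j : 'I_1, enough z (cell n) s [set: 'I_n]%SET (fun k => #|[set: 'I_n]%SET|%:R *
       \int[F]_u (insel (cell n) s k u)%:R / 4) t].
  rewrite cardT; apply/seteqP; split => t /=; first by move=> /andP[/forallP ? ?].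
  by move=> [? /(_ ord0) ?]; apply/andP; split => //; apply/forallP.
split => //.
- by rewrite GE.
- by rewrite GE; apply: le_trans PG _; rewrite card_ord.
Unshelve. all: by end_near.
Qed.

End expansions.

(** * Designs with covariates in the cube *)

Section cube_regression.
Context (R : realType) (r : nat).

Local Notation ind b := (b%:R : R).

(** Real powers are measurable, and t^-1 = t (t^2)^-1 holds at zero as well. *)
Lemma measurable_funV d (T : measurableType d) (f : T -> R) :
  measurable_fun setT f -> measurable_fun setT (fun t => (f t)^-1).
Proof.
move=> mf; rewrite (_ : (fun _ => _) = fun t => f t * (f t ^+ 2) `^ (-1)).
  apply: measurable_funM => //.
  by apply: (@measurableT_comp _ _ _ _ _ _ (fun x : R => x `^ (-1)) _ (fun x => f x ^+ 2)) => //;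
    exact: measurable_funX.
apply/funext => t; rewrite powR_inv1 ?sqr_ge0//.
have [->|ft0] := eqVneq (f t) 0; first by rewrite mul0r invr0.
by rewrite expr2 invfM mulrA divff// mul1r.
Qed.

Variables (K : nat -> nat) (q : forall n, r.-tuple R -> 'cV[R]_(K n)).
Variables (cell : forall n, r.-tuple R -> option 'I_(K n)) (sc : forall n, 'I_(K n) -> R) (Cw : R).
Hypothesis K0 : forall n, (0 < K n)%N.
Hypothesis cells : forall n,
  cell_basis (q n) (@cell n) (@sc n) (Cw * (K n)%:R `^ (- r%:R^-1)).

(** Any of the partitions into cells defines the indicator function of the cube;
   taking the first one makes its measurability immediate. *)
Definition on_cube (w : r.-tuple R) : R := (cell 0 w != None)%:R.

Lemma cell_cube n w k : cell n w = Some k -> cube w.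
Proof. by move=> wk; apply: contrapT => /(cb_cube (cells n) w).2; rewrite wk. Qed.

Lemma on_cubeE w : cube w -> on_cube w = 1.
Proof.
rewrite /on_cube => wc; case: eqP => // wN.
by have := (cb_cube (cells 0) w).1 wN.
Qed.

Lemma on_cube_out w : ~ cube w -> on_cube w = 0.
Proof. by move=> /(cb_cube (cells 0) w).2; rewrite /on_cube => ->. Qed.

Lemma measurable_on_cube : measurable_fun setT on_cube.
Proof.
rewrite (_ : on_cube = fun w => 1 - ind (cell 0 w == None)).
  by apply: measurable_funB => //; exact: cb_measurable (cells 0) _.
by apply/funext => w; rewrite /on_cube; case: eqP; rewrite ?subrr ?subr0.
Qed.

Lemma measurable_cell_set n k : measurable [set w | cell n w == Some k].
Proof. exact: measurable_bool_set (cb_measurable (cells n) (Some k)). Qed.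

Lemma holder_cells (s : R) g : holder s g -> exists2 A, 0 <= A &
  forall n w v k, cell n w = Some k -> cell n v = Some k ->
    `|g w - g v| <= A * (K n)%:R `^ (- zeta r 0 s).
Proof.
move=> gs; have [C C0 gC] := holder_oscillation gs.
exists (C * `|Cw| `^ Num.min 1 s) => [|n w v k wk vk]; first by rewrite mulr_ge0 ?powR_ge0.
have w0 : 0 <= `|Cw| * (K n)%:R `^ (- r%:R^-1) by rewrite mulr_ge0 ?powR_ge0.
apply: le_trans (gC v w _ w0 (cell_cube vk) (cell_cube wk) _) _.
  move=> i; apply: le_trans (cb_width (cells n) vk wk i) _.
  by rewrite ler_wpM2r ?powR_ge0// ler_norm.
rewrite powRM ?powR_ge0// mulrA -powRrM.
by rewrite /zeta addn0 mulNr mulrC [_^-1 * _]mulrC mulrC.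
Qed.

End cube_regression.

Section cube_design.
Context (R : realType) (r : nat) (F0 : probability (obs R r) R).
Variables (K : nat -> nat) (q : forall n, r.-tuple R -> 'cV[R]_(K n)).
Variables (cell : forall n, r.-tuple R -> option 'I_(K n)) (sc : forall n, 'I_(K n) -> R) (Cw : R).
Hypothesis cells : forall n,
  cell_basis (q n) (@cell n) (@sc n) (Cw * (K n)%:R `^ (- r%:R^-1)).

Local Notation L1 f := (F0.-integrable setT (EFin \o f)).
Local Notation E f := (\int[F0]_u f u).
Local Notation ind b := (b%:R : R).
Local Notation w := (@obs_w R r).

Variables (s : obs R r -> bool) (y h : obs R r -> R) (gam alp : r.-tuple R -> R).
Variables (c1 Ce Ch Cg Ca Ag Aa zg za : R).
Let W u := ind (s u) * (y u - gam (w u)).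

Hypotheses (my : measurable_fun setT y) (mh : measurable_fun setT h).
Hypothesis ms : measurable_fun setT (fun u => ind (s u)).
Hypotheses (mgam : measurable_fun setT gam) (malp : measurable_fun setT alp).
Hypotheses (Cg0 : 0 <= Cg) (Ca0 : 0 <= Ca) (Ag0 : 0 <= Ag) (Aa0 : 0 <= Aa) (c10 : 0 < c1).
Hypothesis gam_bound : forall v, cube v -> `|gam v| <= Cg.
Hypothesis alp_bound : forall v, cube v -> `|alp v| <= Ca.
Hypothesis gam_osc : forall n v v' k, cell n v = Some k -> cell n v' = Some k ->
    `|gam v - gam v'| <= Ag * (K n)%:R `^ (- zg).
Hypothesis alp_osc : forall n v v' k, cell n v = Some k -> cell n v' = Some k ->
    `|alp v - alp v'| <= Aa * (K n)%:R `^ (- za).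
Hypothesis W2 : L1 (fun u => W u ^+ 2).
Hypothesis W_orth : forall Q : r.-tuple R -> bool, measurable [set v | Q v] ->
  E (fun u => ind (Q (w u)) * W u) = 0.
Hypothesis W_var : forall Q : r.-tuple R -> bool, measurable [set v | Q v] ->
  E (fun u => ind (Q (w u)) * W u ^+ 2) <= Ce * E (fun u => ind (Q (w u))).
Hypothesis h2 : L1 (fun u => h u ^+ 2).
Hypothesis h_var : forall Q : r.-tuple R -> bool, measurable [set v | Q v] ->
  E (fun u => ind (Q (w u)) * h u ^+ 2) <= Ch * E (fun u => ind (Q (w u))).
Hypothesis riesz : forall (g : r.-tuple R -> R) (c : R), measurable_fun setT g ->
  (forall v, `|g v| <= c) ->
  E (fun u => h u * g (w u)) = E (fun u => alp (w u) * (ind (s u) * g (w u))).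
Hypothesis cell_pos : forall n k, 0 < E (fun u => ind (incell (fun u => cell n (w u)) k u)).
Hypothesis cell_sel : forall n k, c1 * E (fun u => ind (incell (fun u => cell n (w u)) k u)) <=
  E (fun u => ind (insel (fun u => cell n (w u)) s k u)).

Let Dg u := on_cube cell (w u) * gam (w u).
Let Da u := on_cube cell (w u) * alp (w u).

Let mon_cube : measurable_fun setT (on_cube cell) := measurable_on_cube cells.

Let mw : measurable_fun setT w := @measurable_obs_w R r.

Let mDgw : measurable_fun setT (fun v => on_cube cell v * gam v).
Proof. exact: measurable_funM. Qed.

Let mDaw : measurable_fun setT (fun v => on_cube cell v * alp v).
Proof. exact: measurable_funM. Qed.

Let cut_bound (g : r.-tuple R -> R) c v : 0 <= c -> (forall v, cube v -> `|g v| <= c) ->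
  `|on_cube cell v * g v| <= c.
Proof.
move=> c0 gc; have [vc|vc] := pselect (cube v).
  by rewrite (on_cubeE cells)// mul1r gc.
by rewrite (on_cube_out cells)// mul0r normr0.
Qed.

Let eps_in n u k : cell n (w u) = Some k ->
  eps (fun u => cell n (w u)) s y Dg u = W u.
Proof.
move=> uk; rewrite /eps (on_cells_in _ (uk : (fun u => cell n (w u)) u = _)).
by rewrite /W /Dg (on_cubeE cells)// ?mul1r//; exact: (cell_cube cells uk).
Qed.

Let eps_ind n k u : ind (incell (fun u => cell n (w u)) k u) * eps (fun u => cell n (w u)) s y Dg u =
  ind (incell (fun u => cell n (w u)) k u) * W u.
Proof.
by rewrite /incell; case: eqP => [/eps_in ->|_]; rewrite ?mul0r.
Qed.

Let iW : L1 W.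
Proof.
apply: L1_sqr W2; apply: measurable_funM => //; apply: measurable_funB => //.
exact: measurableT_comp mgam mw.
Qed.

Let mcell n co : measurable_fun setT (fun u => ind (cell n (w u) == co)).
Proof. exact: (measurableT_comp (cb_measurable (cells n) co) mw). Qed.

Let mcut (g : r.-tuple R -> R) n k : measurable_fun setT g ->
  measurable_fun setT (fun v => ind (cell n v == Some k) * g v).
Proof. by move=> mg; apply: measurable_funM => //; exact: cb_measurable (cells n) _. Qed.

Let cut_cell_bound (g : r.-tuple R -> R) c n k v : (forall v, `|g v| <= c) ->
  `|ind (cell n v == Some k) * g v| <= c.
Proof.
move=> gc; apply: le_trans (gc v).
by case: (_ == _); rewrite ?mul1r ?mul0r ?normr0.
Qed.

(** Nothing bounds gam and alp outside the cube, where no observation falls; so they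
   are cut off there. *)
Lemma cube_design n :
  regression_design F0 (fun u => cell n (w u)) s y h Dg Da c1 Ce Ch Cg Ca
    (Ag * (K n)%:R `^ (- zg)) (Aa * (K n)%:R `^ (- za)).
Proof.
have meps : measurable_fun setT (eps (fun u => cell n (w u)) s y Dg).
  apply: measurable_on_cells => // k; apply: measurable_funM => //.
  by apply: measurable_funB => //; exact: measurableT_comp mDgw mw.
have eps_le u : eps (fun u => cell n (w u)) s y Dg u ^+ 2 <= W u ^+ 2.
  case uk : (cell n (w u)) => [k|]; first by rewrite (eps_in uk).
  by rewrite /eps on_cells_out// expr0n sqr_ge0.
have eps2 : L1 (fun u => eps (fun u => cell n (w u)) s y Dg u ^+ 2).
  apply: L1_dominated W2 _; first exact: measurable_funX.
  by move=> u; rewrite ger0_norm ?sqr_ge0.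
split => //.
- exact: measurableT_comp mDgw mw.
- exact: measurableT_comp mDaw mw.
- by move=> u; exact: cut_bound.
- by move=> u; exact: cut_bound.
- move=> u v k uk vk; rewrite /Dg !(on_cubeE cells) ?mul1r; first exact: gam_osc uk vk.
    exact: (cell_cube cells vk).
  exact: (cell_cube cells uk).
- move=> u v k uk vk; rewrite /Da !(on_cubeE cells) ?mul1r; first exact: alp_osc uk vk.
    exact: (cell_cube cells vk).
  exact: (cell_cube cells uk).
- by rewrite mulr_ge0 ?powR_ge0.
- by rewrite mulr_ge0 ?powR_ge0.
- move=> k; transitivity (E (fun u => ind (cell n (w u) == Some k) * W u)).
    by apply: eq_Rintegral => u _; rewrite eps_ind.
  exact: W_orth (measurable_cell_set cells k).
- move=> k.
  transitivity (E (fun u => (ind (cell n (w u) == Some k) * (on_cube cell (w u) * alp (w u))) * W u)).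
    by apply: eq_Rintegral => u _; rewrite mulrCA eps_ind /incell /Da; ring.
  apply: (orthogonal_bounded mw iW W_orth
    (phi := fun v => ind (cell n v == Some k) * (on_cube cell v * alp v)) (c := Ca)).
    exact: mcut.
  by move=> v; apply: (@cut_cell_bound (fun v => on_cube cell v * alp v)) => v'; exact: cut_bound.
- move=> k.
  have -> : E (fun u => ind (incell (fun u => cell n (w u)) k u) * eps (fun u => cell n (w u)) s y Dg u ^+ 2) =
      E (fun u => ind (cell n (w u) == Some k) * W u ^+ 2).
    apply: eq_Rintegral => u _; rewrite /incell.
    by case: eqP => [/eps_in ->|_]; rewrite ?mul0r.
  exact: W_var (measurable_cell_set cells k).
- apply: le_trans (E_le eps2 W2 eps_le) _.
  have := W_var (Q := xpredT); rewrite (_ : [set v | xpredT v] = setT); last by apply/seteqP; split.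
  move=> /(_ measurableT); rewrite E_cst mulr1; apply: le_trans.
  by rewrite le_eqVlt; apply/orP; left; apply/eqP/eq_Rintegral => u _; rewrite mul1r.
- move=> k; exact: h_var (measurable_cell_set cells k).
- have := h_var (Q := xpredT); rewrite (_ : [set v | xpredT v] = setT); last by apply/seteqP; split.
  move=> /(_ measurableT); rewrite E_cst mulr1; apply: le_trans.
  by rewrite le_eqVlt; apply/orP; left; apply/eqP/eq_Rintegral => u _; rewrite mul1r.
- move=> k.
  have := riesz (c := 1) (cb_measurable (cells n) (Some k)).
  have b1 v : `|ind (cell n v == Some k)| <= 1 by rewrite normr_nat; case: (_ == _); rewrite ?ler01.
  move=> /(_ b1) e.
  transitivity (E (fun u => h u * ind (cell n (w u) == Some k))).
    by apply: eq_Rintegral => u _; rewrite mulrC.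
  rewrite e; apply: eq_Rintegral => u _; rewrite /insel /Da -mulnb natrM.
  case: (eqVneq (cell n (w u))) => [uk|_]; last by rewrite !mulr0 mul0r.
  by rewrite (on_cubeE cells) ?mul1r ?mulr1; [rewrite mulrC|exact: (cell_cube cells uk)].
- move=> k.
  have b1 v : `|ind (cell n v == Some k) * (on_cube cell v * gam v)| <= Cg.
    by apply: (@cut_cell_bound (fun v => on_cube cell v * gam v)) => v'; exact: cut_bound.
  have e := riesz (mcut k mDgw) b1.
  transitivity (E (fun u => h u * (ind (cell n (w u) == Some k) * (on_cube cell (w u) * gam (w u))))).
    by apply: eq_Rintegral => u _; rewrite mulrCA.
  rewrite e; apply: eq_Rintegral => u _; rewrite /insel /Da /Dg -mulnb natrM.
  case: (eqVneq (cell n (w u))) => [uk|_]; last by rewrite !(mulr0, mul0r).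
  by rewrite (on_cubeE cells) ?mul1r ?mulr1; [rewrite mulrCA|exact: (cell_cube cells uk)].
Qed.

End cube_design.

(** * The three estimators *)

Section root_scaling.
Context (R : realType).

Lemma root_scaling n (S beta0 : R) (psi : 'I_n -> R) : (0 < n)%N ->
  Num.sqrt n%:R * (n%:R^-1 * S - beta0) - (Num.sqrt n%:R)^-1 * \sum_i psi i =
  (Num.sqrt n%:R)^-1 * (S - \sum_i (beta0 + psi i)).
Proof.
move=> n0; have n0R : 0 < n%:R :> R by rewrite ltr0n.
have sn0 : Num.sqrt n%:R != 0 :> R by rewrite gt_eqF// sqrtr_gt0.
have e : n%:R = Num.sqrt n%:R ^+ 2 :> R by rewrite sqr_sqrtr.
rewrite big_split/= sumr_const card_ord -[beta0 *+ n]mulr_natr.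
rewrite [X in X^-1 * S]e [X in beta0 * X]e; field; exact: sn0.
Qed.

End root_scaling.

Section regression_cells.
Context (R : realType) (r : nat) (F0 : probability (obs R r) R).
Variables (K : nat -> nat) (q : forall n, r.-tuple R -> 'cV[R]_(K n)).

Local Notation w := (@obs_w R r).

Record regression_cells (cell : forall n, r.-tuple R -> option 'I_(K n))
    (sc : forall n, 'I_(K n) -> R) (Cw c3 : R) : Prop := RegressionCells {
  rc_K : forall n, (0 < K n)%N;
  rc_cells : forall n, cell_basis (q n) (@cell n) (@sc n) (Cw * (K n)%:R `^ (- r%:R^-1));
  rc_sc : forall n k, sc n k != 0;
  rc_c3 : 0 < c3;
  rc_prob : forall n k,
    c3 <= (K n)%:R * \int[F0]_u (incell (fun u => cell n (w u)) k u)%:R;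
  rc_total : forall n, F0 [set u | cell n (w u) = None] = 0%E }.

Lemma density_out (f0 : r.-tuple R -> R) (A : set (r.-tuple R)) : cube_density F0 f0 ->
  measurable A -> (forall v, A v -> ~ cube v) -> F0 (w @^-1` A) = 0%E.
Proof.
move=> [_ F0A _] mA AN; rewrite F0A// (_ : A `&` _ = set0) ?integral_set0//.
by rewrite -subset0 => v [/AN].
Qed.

Lemma regression_cells_exist f0 : cube_density F0 f0 -> tensor_bsplines 0 q ->
  normalized_basis F0 q -> exists cell sc Cw c3, regression_cells cell sc Cw c3.
Proof.
move=> hf0 /tensor_bsplines_cells[cell [sc [Cw H]]] [c [C [c0 norm]]].
have C1 : 0 < C ^+ 2 + 1 by rewrite ltr_wpDl ?sqr_ge0.
(* The summand 1 covers the case C = 0. *)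
exists cell, sc, Cw, (c / (C ^+ 2 + 1)).
have p0 n k : 0 <= (K n)%:R * \int[F0]_u (incell (fun u => cell n (w u)) k u)%:R :> R.
  by rewrite mulr_ge0//; apply: E_ge0.
split => //.
- by move=> n; have [] := H n.
- by move=> n; have [] := H n.
- move=> n k; have [_ qc] := H n; have [cl qC] := norm n.
  by have [] := cell_probability qc c0 cl qC k.
- by rewrite divr_gt0.
- move=> n k; have [_ qc] := H n; have [cl qC] := norm n.
  have [_ cp] := cell_probability qc c0 cl qC k.
  rewrite ler_pdivrMr// mulrC mulrDl mul1r; move: cp; rewrite -mulrA => cp.
  by apply: le_trans cp _; rewrite lerDl.
- move=> n; have [_ qc] := H n.
  apply: (density_out (A := [set v | cell n v = None]) hf0).
    have := measurable_bool_set (cb_measurable qc None).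
    by congr measurable; apply/seteqP; split => v /= /eqP.
  by move=> v /(cb_cube qc).
Qed.

End regression_cells.

Section regressogram_estimators.
Context (R : realType) (r : nat) (F0 : probability (obs R r) R).
Context d (Omega : measurableType d) (P : probability Omega R) (z : nat -> {RV P >-> obs R r}).
Hypothesis z_iid : iid F0 z.
Variables (K : nat -> nat) (q : forall n, r.-tuple R -> 'cV[R]_(K n)).
Variables (cell : forall n, r.-tuple R -> option 'I_(K n)) (sc : forall n, 'I_(K n) -> R) (Cw c3 : R).
Hypothesis cells : regression_cells F0 q cell sc Cw c3.
Hypothesis hK : (fun n => (K n)%:R : R) @ \oo --> +oo.
Hypothesis hKln : (fun n => (K n)%:R * ln (K n)%:R / n%:R : R) @ \oo --> (0 : R).
Variable (ginv : forall k, 'M[R]_k -> 'M[R]_k).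
Hypothesis ginvP : is_ginv ginv.

Local Notation L1 f := (F0.-integrable setT (EFin \o f)).
Local Notation E f := (\int[F0]_u f u).
Local Notation ind b := (b%:R : R).
Local Notation w := (@obs_w R r).
Local Notation x := (@obs_aw R r).
Local Notation cellw n := (fun u => cell n (w u)).
Local Notation lambda := (lebesgue_tuple R r).

Let basis n : cell_basis (q n) (@cell n) (@sc n) (Cw * (K n)%:R `^ (- r%:R^-1)) := rc_cells cells n.

Let sc_neq0 n k : sc (n := n) k != 0 := rc_sc cells k.

Let mw := @measurable_obs_w R r.

Let ma : measurable_fun setT (@obs_a R r).
Proof. by apply: (@measurableT_comp _ _ _ _ _ _ snd _ fst) => //; exact: measurable_snd. Qed.

Let my : measurable_fun setT (@obs_y R r).
Proof. by apply: (@measurableT_comp _ _ _ _ _ _ fst _ fst) => //; exact: measurable_fst. Qed.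

Let L1_event (Q : r.-tuple R -> bool) : measurable [set v | Q v] -> L1 (fun u => ind (Q (w u))).
Proof. by move=> mQ; have := L1_ind_fun mw mQ (L1_cst F0 1); under eq_fun do rewrite mulr1. Qed.

Let L1_bounded_sqr (g : obs R r -> R) c : measurable_fun setT g -> (forall u, `|g u| <= c) ->
  L1 (fun u => g u ^+ 2).
Proof.
move=> mg gc; apply: (@L1_bounded _ _ _ F0 _ (c ^+ 2)); first exact: measurable_funX.
by move=> u; rewrite normrX lerXn2r ?nnegrE// (le_trans (normr_ge0 (g u))).
Qed.

Lemma cell_mass_gt0 n k : 0 < E (fun u => ind (incell (cellw n) k u)).
Proof.
have := lt_le_trans (rc_c3 cells) (rc_prob cells k).
by rewrite pmulr_rgt0// ltr0n (rc_K cells).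
Qed.

Section expansion_of_a_design.
Variables (s : obs R r -> bool) (y h : obs R r -> R) (gam alp : r.-tuple R -> R).
Variables (c1 Ce Ch Cg Ca Ag Aa sg sa : R).
Hypotheses (Ag0 : 0 <= Ag) (Aa0 : 0 <= Aa).
Hypothesis ms : measurable_fun setT (fun u => ind (s u)).

Let Dg u := on_cube cell (w u) * gam (w u).
Let Da u := on_cube cell (w u) * alp (w u).

Hypothesis design : forall n,
  regression_design F0 (cellw n) s y h Dg Da c1 Ce Ch Cg Ca
    (Ag * (K n)%:R `^ (- zeta r 0 sg)) (Aa * (K n)%:R `^ (- zeta r 0 sa)).

(** For the cross-fitted estimators this is the parameter plus the influence function. *)
Definition linearized u := h u * gam (w u) + alp (w u) * (ind (s u) * (y u - gam (w u))).

Let rate n : R := Delta_star r 0 sg sa K n + (K n)%:R `^ (- zeta r 0 sg) * ln n%:R.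

Let rate_ge n : (0 < n)%N ->
  Num.sqrt n%:R * (K n)%:R `^ (- zeta r 0 sg - zeta r 0 sa) + (K n)%:R `^ (- zeta r 0 sg) +
    (K n)%:R `^ (- zeta r 0 sa) + Num.sqrt ((K n)%:R / n%:R) <= rate n.
Proof.
move=> n0; rewrite /rate /Delta_star lerDl mulr_ge0 ?powR_ge0// ln_ge0//.
by rewrite ler1n.
Qed.

Let DgE n u : cell n (w u) != None -> Dg u = gam (w u).
Proof.
move=> uc; rewrite /Dg (on_cubeE basis) ?mul1r//.
by case uk : (cell n (w u)) uc => [k|//] _; exact: (cell_cube basis uk).
Qed.

Let DaE n u : cell n (w u) != None -> Da u = alp (w u).
Proof.
move=> uc; rewrite /Da (on_cubeE basis) ?mul1r//.
by case uk : (cell n (w u)) uc => [k|//] _; exact: (cell_cube basis uk).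
Qed.

Let epsE n u : cell n (w u) != None -> eps (cellw n) s y Dg u = ind (s u) * (y u - gam (w u)).
Proof.
move=> uc; rewrite /eps; case uk : (cell n (w u)) (uc) => [k|//] _.
by rewrite (on_cells_in _ (uk : cellw n u = _)) (DgE uc).
Qed.

Let tally_gt0 n (A : {set 'I_n}) t : (0 < #|A|)%N ->
  enough z (cellw n) s A (fun k => #|A|%:R * E (fun u => ind (insel (cellw n) s k u)) / 4) t ->
  forall k, 0 < tally z A (insel (cellw n) s k) t.
Proof.
move=> A0 ok k; apply: lt_le_trans (enough_ge k ok).
rewrite divr_gt0// mulr_gt0 ?ltr0n//; apply: lt_le_trans (rd_mu (design n) k).
by rewrite mulr_gt0 ?(rd_c1 (design n))// cell_mass_gt0.
Qed.

(** What is left to check for an estimator is an identity on samples for which every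
   cell contains a selected observation outside each fold. *)
Theorem crossfit_regressogram (L : nat) (I : forall n, 'I_L -> {set 'I_n}) (V : nat -> Omega -> R) :
  (2 <= L)%N -> balanced_partition R I ->
  (forall n t, (0 < n)%N -> (forall l, (0 < #|~: I n l|)%N) ->
     (forall x : 'I_n -> R, \sum_l \sum_(i in I n l) x i = \sum_i x i) ->
     (forall l k, 0 < tally z (~: I n l) (insel (cellw n) s k) t) ->
     V n t = (Num.sqrt n%:R)^-1 * \sum_l \sum_(i in I n l)
       (h (z i t) * (\sum_k ind (cell n (w (z i t)) == Some k) *
          cell_mean z (cellw n) s y (~: I n l) k t) - linearized (z i t))) ->
  bigO_p P V rate.
Proof.
move=> L2 Ibal VE.
apply: (crossfit_expansion z_iid hK hKln _ ms (rc_total cells) Ag0 Aa0 (rc_c3 cells)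
  (rc_prob cells) design rate_ge L2 Ibal).
  by move=> n co; exact: (measurable_cell_obs (basis n) co).
have [disj cover [c2 c20 size] bal] := Ibal.
near=> n => t /andP[/forallP incube /forallP ok].
have n0 : (0 < n)%N by near: n; exact: nbhs_infty_gt.
have Isize l : (0 < #|~: I n l|)%N.
  have : forall l, c2 * n%:R <= #|I n l|%:R /\ c2 * n%:R <= #|~: I n l|%:R by near: n.
  move=> /(_ l)[_]; rewrite -(ltr0n R); apply: lt_le_trans.
  by rewrite mulr_gt0// ltr0n.
have part (i : 'I_n) : exists2 l, i \in I n l & forall l', i \in I n l' -> l' = l.
  have : i \in (\bigcup_l I n l)%SET by rewrite cover finset.inE.
  move=> /finset.bigcupP[l _ il]; exists l => // l' il'.
  apply/eqP/negPn/negP => ll'; have /setP/(_ i) := disj n _ _ ll'.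
  by rewrite !finset.inE il il'.
have Isum (x : 'I_n -> R) := sum_partition x part.
rewrite VE//; last by move=> l k; apply: tally_gt0 => //; exact: ok.
congr (_ * _); rewrite /crossfit_remainder -addrA -opprD -big_split/= -Isum -sumrB.
apply: eq_bigr => l _; rewrite big_split/= sumrN; congr (_ - _).
  under [RHS]eq_bigr do rewrite mulr_suml.
  rewrite exchange_big/=; apply: eq_bigr => i _.
  by rewrite mulr_sumr; apply: eq_bigr => k _; rewrite /incell; ring.
by apply: eq_bigr => i _; rewrite (DgE (incube i)) (DaE (incube i)) (epsE (incube i)).
Unshelve. all: by end_near.
Qed.

Theorem plugin_regressogram (V : nat -> Omega -> R) :
  (forall n t, (0 < n)%N ->
     (forall k, 0 < tally z [set: 'I_n]%SET (insel (cellw n) s k) t) ->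
     V n t = (Num.sqrt n%:R)^-1 * (n%:R *
       (\sum_k E (fun u => ind (incell (cellw n) k u) * h u) *
          cell_mean z (cellw n) s y [set: 'I_n]%SET k t - E (fun u => h u * Dg u))
       - \sum_(i < n) alp (w (z i t)) * (ind (s (z i t)) * (y (z i t) - gam (w (z i t)))))) ->
  bigO_p P V rate.
Proof.
move=> VE.
have mcell n co : measurable_fun setT (fun u => ind (cell n (w u) == co)).
  exact: (measurable_cell_obs (basis n) co).
apply: (plugin_expansion z_iid hK hKln _ ms (rc_total cells) Ag0 Aa0 (rc_c3 cells)
  (rc_prob cells) design rate_ge) => //.
near=> n => t /andP[/forallP incube ok].
have n0 : (0 < n)%N by near: n; exact: nbhs_infty_gt.
rewrite VE//; last first.
  by apply: tally_gt0; rewrite cardsT card_ord.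
congr (_ * _); rewrite /plugin_remainder; congr (_ * (_ - _) - _); last first.
  by apply: eq_bigr => i _; rewrite (DaE (incube i)) (epsE (incube i)).
have D := design n.
have hDg : F0.-integrable setT (EFin \o (fun u => h u * Dg u)).
  apply: L1_mul; [exact: rd_mh D|exact: rd_mgam D|exact: rd_h2 D|].
  by apply: (L1_bounded_sqr (c := Cg)) => [|u]; [exact: rd_mgam D|exact: rd_gam D u].
have [_ <-] := E_on_cells (mcell n) (fun _ => hDg).
apply: eq_Rintegral => u _; case uk : (cell n (w u)) => [k|].
  by rewrite (on_cells_in _ (uk : cellw n u = _)).
rewrite on_cells_out// /Dg (on_cube_out basis) ?mul0r ?mulr0//.
exact: (cb_cube (basis n) (w u)).1.
Unshelve. all: by end_near.
Qed.

End expansion_of_a_design.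

Lemma gamma_hat_cells n L (I : 'I_L -> {set 'I_n}) l v t : (0 < #|~: I l|)%N ->
  (forall k, 0 < tally z (~: I l) (insel (cellw n) xpredT k) t) ->
  gamma_hat ginv I (fun i => z i t) w (q n) l v =
  \sum_k ind (cell n v == Some k) * cell_mean z (cellw n) xpredT (@obs_y R r) (~: I l) k t.
Proof.
move=> I0 M0; have nl0 : (#|~: I l|%:R : R)^-1 != 0 by rewrite invr_eq0 pnatr_eq0 -lt0n.
transitivity (\sum_k q n v k 0 / sc k * cell_mean z (cellw n) xpredT (@obs_y R r) (~: I l) k t).
  rewrite -(regressogram ginvP (basis n) (@sc_neq0 n) (q n v) nl0 M0).
  rewrite /gamma_hat /gram /cross; congr ((_ *m ginv (_ *: _) *m (_ *: _)) 0 0).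
    by apply: eq_bigr => i _; rewrite scale1r.
  by apply: eq_bigr => i _; rewrite mul1r.
apply: eq_bigr => k _; rewrite (cb_basis (basis n)).
by rewrite [sc k * _]mulrC mulfK// sc_neq0.
Qed.

(** All observations enter the regression. *)
Lemma full_design (h : obs R r -> R) (gam alp : r.-tuple R -> R) (sg sa Ca Ch Aa : R) :
  cond_exp F0 w (@obs_y R r) gam ->
  cond_exp_bounded F0 w (fun u => (obs_y u - gam (w u)) ^+ 2) ->
  holder sg gam -> measurable_fun setT h -> measurable_fun setT alp ->
  0 <= Ca -> 0 <= Aa -> (forall v, cube v -> `|alp v| <= Ca) ->
  (forall n v v' k, cell n v = Some k -> cell n v' = Some k ->
    `|alp v - alp v'| <= Aa * (K n)%:R `^ (- zeta r 0 sa)) ->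
  L1 (fun u => h u ^+ 2) ->
  (forall Q : r.-tuple R -> bool, measurable [set v | Q v] ->
    E (fun u => ind (Q (w u)) * h u ^+ 2) <= Ch * E (fun u => ind (Q (w u)))) ->
  (forall (g : r.-tuple R -> R) (c : R), measurable_fun setT g -> (forall v, `|g v| <= c) ->
    E (fun u => h u * g (w u)) = E (fun u => alp (w u) * g (w u))) ->
  exists Ce Cg Ag, 0 <= Ag /\ forall n,
    regression_design F0 (cellw n) xpredT (@obs_y R r) h
      (fun u => on_cube cell (w u) * gam (w u)) (fun u => on_cube cell (w u) * alp (w u))
      1 Ce Ch Cg Ca (Ag * (K n)%:R `^ (- zeta r 0 sg)) (Aa * (K n)%:R `^ (- zeta r 0 sa)).
Proof.
move=> gamP varP hgam mh malp Ca0 Aa0 alpC alpA h2 hvar riesz.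
have [Ce Ce0 [V1 Vvar]] := cond_exp_bounded_moment mw varP.
have [Cg Cg0 gamC] := holder_bounded hgam.
have [Ag Ag0 gamA] := holder_cells basis hgam.
have [mgam _ _ _] := gamP.
exists Ce, Cg, Ag; split => // n.
apply: (cube_design basis) => //.
- by rewrite (_ : (fun u => _) = fun u => (obs_y u - gam (w u)) ^+ 2)//; apply/funext => u; rewrite mul1r.
- move=> Q mQ; rewrite -[RHS](cond_exp_orthogonal mw gamP mQ).
  by apply: eq_Rintegral => u _; rewrite mul1r.
- move=> Q mQ; apply: le_trans (Vvar Q mQ); rewrite le_eqVlt; apply/orP; left; apply/eqP.
  by apply: eq_Rintegral => u _; rewrite mul1r.
- move=> g c mg gc; rewrite (riesz g c)//.
  by apply: eq_Rintegral => u _; rewrite mul1r.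
- by move=> m k; exact: cell_mass_gt0.
- by move=> m k; rewrite mul1r.
Qed.

Section cross_fitting.
Variables (L : nat) (I : forall n, 'I_L -> {set 'I_n}).
Hypotheses (L_ge2 : (2 <= L)%N) (I_bal : balanced_partition R I).

(** The multiplier is - a, and its conditional mean represents it. *)
Theorem covariance_expansion (sg sa beta0 : R) (gamma0 abar : r.-tuple R -> R) :
  cond_exp F0 w (@obs_y R r) gamma0 ->
  cond_exp F0 w (@obs_a R r) abar ->
  riesz_representer F0 w (@m_cov R r) (fun v => - abar v) ->
  cond_exp_bounded F0 w (fun u => (obs_y u - gamma0 (w u)) ^+ 2) ->
  holder sg gamma0 -> holder sa abar ->
  cond_exp_bounded F0 w (fun u => obs_a u ^+ 2) ->
  expansion z (fun n x => beta_hat_cov ginv (I n) x (q n)) beta0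
    (influence w (@m_cov R r) (fun v => - abar v) gamma0 beta0)
    (fun n => Delta_star r 0 sg sa K n + (K n)%:R `^ (- zeta r 0 sg) * ln n%:R).
Proof.
move=> gamP aP [_ riesz] varP hgam ha avarP.
have [Ch Ch0 [A1 Avar]] := cond_exp_bounded_moment mw avarP.
have [Ca Ca0 aC] := holder_bounded ha.
have [Aa Aa0 aA] := holder_cells basis ha.
have [mabar _ _ _] := aP.
have [] := @full_design (fun u => - obs_a u) gamma0
    (fun v => - abar v) sg sa Ca Ch Aa gamP varP hgam.
- exact: measurableT_comp.
- exact: measurableT_comp.
- exact: Ca0.
- exact: Aa0.
- by move=> v vc; rewrite normrN aC.
- by move=> n v v' k vk v'k; rewrite -opprD normrN (aA n v v' k).
- by under eq_fun do rewrite sqrrN.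
- move=> Q mQ; apply: le_trans (Avar Q mQ); rewrite le_eqVlt; apply/orP; left; apply/eqP.
  by apply: eq_Rintegral => u _; rewrite sqrrN.
- move=> g c mg gc.
  have g2 : L1 (fun u => g (w u) ^+ 2).
    by apply: (L1_bounded_sqr (c := c)) => //; exact: measurableT_comp.
  have := congr1 fine (riesz g mg g2); rewrite unlock -!/(Rintegral _ _ _) => <-.
  by apply: eq_Rintegral => u _; rewrite /m_cov /cst; ring.
move=> Ce [Cg [Ag [Ag0 design]]].
apply: (crossfit_regressogram (gam := gamma0) (alp := fun v => - abar v) Ag0 Aa0 _ design L_ge2 I_bal) => //.
move=> n t n0 Isize Isum M0.
rewrite /beta_hat_cov root_scaling// -Isum -sumrB; congr (_ * _).
apply: eq_bigr => l _; rewrite -sumrB; apply: eq_bigr => i _.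
rewrite (gamma_hat_cells _ (Isize l) (M0 l)).
rewrite /linearized /influence /m_cov mul1r; ring.
Qed.

Section missing_data.
Let s (u : obs R r) := obs_a u == 1.

Hypothesis a01 : forall i o, obs_a (z i o) = 0 \/ obs_a (z i o) = 1.

Let mx : measurable_fun setT x.
Proof. exact: measurable_fun_pair. Qed.

Let measurable_s : measurable [set u | s u].
Proof.
rewrite (_ : [set u | s u] = setT `&` @obs_a R r @^-1` [set 1]); first exact: ma.
by rewrite setTI; apply/seteqP; split => u /= /eqP.
Qed.

Let ms : measurable_fun setT (fun u => ind (s u)).
Proof.
rewrite (_ : (fun _ => _) = \1_[set u | s u]); first exact: measurable_indic.
apply/funext => u; rewrite indicE; case: (boolP (s u)) => su.
  by rewrite mem_set.
by rewrite memNset//=; exact/negP.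
Qed.

(** The law F0 inherits from the sample that a is 0 or 1. *)
Let a_ae : {ae F0, forall u, obs_a u = ind (s u)}.
Proof.
pose N := ~` [set u | s u] `&` ~` (@obs_a R r @^-1` [set 0]).
have mN : measurable N.
  apply: measurableI; apply: measurableC => //.
  by rewrite -[X in measurable X]setTI; exact: ma.
exists N; split => //.
  have := z_iid.1 0 N mN; rewrite (_ : z 0 @^-1` N = set0) ?measure0//.
  rewrite -subset0 => o [/= Ns N0].
  by case: (a01 0 o) => [/N0|/eqP/Ns].
move=> u /= uN; split => /= [su|u0]; apply: uN.
  by rewrite su; exact/eqP.
by rewrite u0 /s u0 eq_sym oner_eq0.
Qed.

(** Selection is a function of the regressors (a, w), which turns integrals over
   selected observations into integrals over events generated by the regressors. *)
Let selected (Q : r.-tuple R -> bool) (p : R * r.-tuple R) := (p.1 == 1) && Q p.2.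

Let measurable_selected (Q : r.-tuple R -> bool) : measurable [set v | Q v] ->
  measurable [set p | selected Q p].
Proof.
move=> mQ; rewrite (_ : [set p | _] = [set 1] `*` [set v | Q v]); first exact: measurableX.
by apply/seteqP; split => p; rewrite /selected/=; [move=> /andP[/eqP]|move=> [/eqP -> ->]].
Qed.

Lemma delta_hat_cells n l v t : (forall k, 0 < tally z (~: I n l) (insel (cellw n) s k) t) ->
  ((q n v)^T *m delta_hat ginv (I n) (fun i => z i t) (q n) l) 0 0 =
  \sum_k ind (cell n v == Some k) * cell_mean z (cellw n) s (@obs_y R r) (~: I n l) k t.
Proof.
move=> M0.
transitivity (\sum_k q n v k 0 / sc k * cell_mean z (cellw n) s (@obs_y R r) (~: I n l) k t).
  rewrite -(regressogram ginvP (basis n) (@sc_neq0 n) (q n v)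
    (oner_neq0 R) M0).
  rewrite /delta_hat mulmxA !scale1r; congr ((_ *m ginv _ *m _) 0 0).
    by apply: eq_bigr => i _; rewrite /s; case: (a01 i t) => ->; rewrite ?eqxx// eq_sym oner_eq0.
  by apply: eq_bigr => i _; rewrite /s; case: (a01 i t) => ->; rewrite ?eqxx// eq_sym oner_eq0.
apply: eq_bigr => k _; rewrite (cb_basis (basis n)).
by rewrite [sc k * _]mulrC mulfK// sc_neq0.
Qed.

(** The multiplier is 1 and the observations with a = 1 are selected; dividing by the
   propensity score makes up for the selection. *)
Theorem missing_expansion (sg sa beta0 : R) (gamma0 : R * r.-tuple R -> R) (pi0 : r.-tuple R -> R) :
  cond_exp F0 x (@obs_y R r) gamma0 ->
  cond_exp F0 w (fun u => ind (obs_a u == 1)) pi0 ->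
  riesz_representer F0 x (@m_missing R r) (fun u => u.1 / pi0 u.2) ->
  cond_exp_bounded F0 x (fun u => (obs_y u - gamma0 (x u)) ^+ 2) ->
  holder sg (fun v => gamma0 (1, v)) ->
  (exists2 c : R, 0 < c & forall v, cube v -> c <= pi0 v) ->
  holder sa pi0 ->
  expansion z (fun n x => beta_hat_missing ginv (I n) x (q n)) beta0
    (influence x (@m_missing R r) (fun u => u.1 / pi0 u.2) gamma0 beta0)
    (fun n => Delta_star r 0 sg sa K n + (K n)%:R `^ (- zeta r 0 sg) * ln n%:R).
Proof.
move=> gamP piP [_ riesz] varP hgam [c c0 pic] hpi.
have [Ce Ce0 [V1 Vvar]] := cond_exp_bounded_moment mx varP.
have [Cg Cg0 gamC] := holder_bounded hgam.
have [Ag Ag0 gamA] := holder_cells basis hgam.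
have [Ap Ap0 piA] := holder_cells basis hpi.
have [mgam _ _ _] := gamP; have [mpi _ ipi _] := piP.
pose gam v := gamma0 (1, v); pose alp v := (pi0 v)^-1.
have mgam1 : measurable_fun setT gam.
  by apply: (measurableT_comp mgam); exact: measurable_fun_pair.
have malp : measurable_fun setT alp by exact: measurable_funV.
have selE u : s u -> x u = (1, w u) by move=> /eqP a1; rewrite /x a1.
have WE (Q : r.-tuple R -> bool) u : ind (Q (w u)) * (ind (s u) * (obs_y u - gam (w u))) =
    ind (selected Q (x u)) * (obs_y u - gamma0 (x u)).
  rewrite /selected /= -/(s u); case: (boolP (s u)) => [su|_]; last by rewrite mul0r mulr0 mul0r.
  by rewrite (selE u su) mul1r.
have W2E (Q : r.-tuple R -> bool) u : ind (Q (w u)) * (ind (s u) * (obs_y u - gam (w u))) ^+ 2 =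
    ind (selected Q (x u)) * (obs_y u - gamma0 (x u)) ^+ 2.
  rewrite /selected /= -/(s u); case: (boolP (s u)) => [su|_]; last by rewrite mul0r expr0n mulr0 mul0r.
  by rewrite (selE u su) mul1r.
have pos v : cube v -> 0 < pi0 v by move=> /pic; exact: lt_le_trans.
have Aa0 : 0 <= Ap / c ^+ 2 by rewrite divr_ge0 ?sqr_ge0.
have design n : regression_design F0 (cellw n) s (@obs_y R r) (fun=> 1)
    (fun u => on_cube cell (w u) * gam (w u)) (fun u => on_cube cell (w u) * alp (w u))
    c Ce 1 Cg c^-1 (Ag * (K n)%:R `^ (- zeta r 0 sg)) (Ap / c ^+ 2 * (K n)%:R `^ (- zeta r 0 sa)).
  apply: (cube_design basis) => //.
  - by rewrite invr_ge0 ltW.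
  - move=> v vc; rewrite /alp normfV (gtr0_norm (pos v vc)) lef_pV2 ?posrE ?pos//.
    exact: pic.
  - move=> m v v' k vk v'k; rewrite /alp.
    have vc := cell_cube basis vk; have v'c := cell_cube basis v'k.
    have -> : (pi0 v)^-1 - (pi0 v')^-1 = (pi0 v' - pi0 v) / (pi0 v * pi0 v').
      by field; rewrite !gt_eqF ?pos.
    rewrite normrM normfV (gtr0_norm (mulr_gt0 (pos v vc) (pos v' v'c))) mulrAC.
    apply: ler_pM => //; first by rewrite invr_ge0 ltW// mulr_gt0 ?pos.
      exact: piA v'k vk.
    rewrite lef_pV2 ?posrE ?exprn_gt0 ?mulr_gt0 ?pos//.
    by rewrite expr2; apply: ler_pM; rewrite ?(ltW c0) ?pic.
  - apply: L1_dominated V1 _.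
      by apply: measurable_funX; apply: measurable_funM => //; apply: measurable_funB => //;
        exact: (measurableT_comp mgam1).
    move=> u; rewrite ger0_norm ?sqr_ge0//.
    have := W2E xpredT u; rewrite mul1r => ->.
    by case: (selected _ _); rewrite ?mul1r// mul0r sqr_ge0.
  - move=> Q mQ; rewrite -[RHS](cond_exp_orthogonal mx gamP (measurable_selected mQ)).
    by apply: eq_Rintegral => u _; rewrite WE.
  - move=> Q mQ.
    have iS : L1 (fun u => ind (selected Q (x u))).
      by have := L1_ind_fun mx (measurable_selected mQ) (L1_cst F0 1); under eq_fun do rewrite mulr1.
    apply: (@le_trans _ _ (Ce * E (fun u => ind (selected Q (x u))))).
      apply: le_trans (Vvar _ (measurable_selected mQ)); rewrite le_eqVlt; apply/orP; left; apply/eqP.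
      by apply: eq_Rintegral => u _; rewrite W2E.
    rewrite ler_wpM2l//; apply: E_le => [||u]; [exact: iS|exact: L1_event|].
    by rewrite /selected; case: (_ == _) => //=; exact: ler0n.
  - by rewrite expr1n; exact: L1_cst.
  - move=> Q mQ; rewrite mul1r le_eqVlt; apply/orP; left; apply/eqP.
    by apply: eq_Rintegral => u _; rewrite expr1n mulr1.
  - move=> g b mg gb.
    have mgw : measurable_fun setT (fun u : obs R r => g (w u)) by exact: measurableT_comp.
    have mg' : measurable_fun setT (fun p : R * r.-tuple R => g p.2).
      by apply: measurableT_comp.
    have g2 : L1 (fun u => g (w u) ^+ 2) by exact: (L1_bounded_sqr (c := b)).
    have malpw : measurable_fun setT (fun u : obs R r => alp (w u)) by exact: measurableT_comp.
    have := congr1 fine (riesz _ mg' g2); rewrite unlock -!/(Rintegral _ _ _) => e.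
    transitivity (E (fun u => obs_a u / pi0 (w u) * g (w u))).
      by rewrite -e; apply: eq_Rintegral => u _; rewrite /m_missing /cst subr0 mul1r.
    rewrite /Rintegral; congr fine; apply: ae_eq_integral => //.
    + by apply/measurable_EFinP; apply: measurable_funM => //; exact: measurable_funM.
    + by apply/measurable_EFinP; apply: measurable_funM => //; exact: measurable_funM.
    + by apply: filterS a_ae => u -> _; rewrite mulrAC /alp mulrC.
  - by move=> m k; exact: cell_mass_gt0.
  - move=> m k.
    have mQ := measurable_cell_set basis (n := m) k.
    have iQ := L1_event mQ.
    have -> : E (fun u => ind (insel (cellw m) s k u)) =
        E (fun u => ind (cell m (w u) == Some k) * pi0 (w u)).
      rewrite -(cond_exp_ind piP mQ); apply: eq_Rintegral => u _.
      by rewrite /insel -mulnb natrM mulrC.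
    rewrite -EZ//; apply: E_le; [exact: L1Z|exact: (L1_ind_fun mw mQ ipi)|].
    move=> u; rewrite /incell; case: eqP => [uk|_]; rewrite ?mulr1 ?mul1r ?mulr0 ?mul0r//.
    by apply: pic; exact: (cell_cube basis uk).
apply: (crossfit_regressogram (gam := gam) (alp := alp) Ag0 Aa0 ms design L_ge2 I_bal).
move=> n t n0 Isize Isum M0.
rewrite /beta_hat_missing root_scaling// -Isum -sumrB; congr (_ * _).
apply: eq_bigr => l _; rewrite -sumrB; apply: eq_bigr => i _.
rewrite (delta_hat_cells _ (M0 l)) mul1r /linearized /influence /m_missing /= mul1r.
rewrite addrA [_ + (_ - _)]addrC subrK; congr (_ - (_ + _)).
have := a01 i t; rewrite /alp /s /obs_aw /=; case => ->.
  by rewrite eq_sym oner_eq0 !mul0r mulr0.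
by rewrite eqxx !mul1r.
Qed.

End missing_data.

End cross_fitting.

Section average_derivative.
Variables (f0 omega : r.-tuple R -> R).
Hypothesis hf0 : cube_density F0 f0.
Hypothesis momega : measurable_fun setT omega.

Local Notation L1 f := (F0.-integrable setT (EFin \o f)).
Local Notation E f := (\int[F0]_u f u).
Local Notation ind b := (b%:R : R).
Local Notation w := (@obs_w R r).
Local Notation cellw n := (fun u => cell n (w u)).
Local Notation lambda := (lebesgue_tuple R r).

Let alp v := omega v / f0 v.

Hypothesis riesz : riesz_representer F0 w (m_deriv omega) alp.

Let malp : measurable_fun setT alp.
Proof. by have [mf _ _] := hf0; apply: measurable_funM => //; exact: measurable_funV. Qed.

Let cube_ae : {ae F0, forall u, on_cube cell (w u) = 1}.
Proof.
exists [set u | cell 0 (w u) = None]; split; last first.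
- move=> u /= uN; apply: contrapT => uc; apply: uN.
  by rewrite (on_cubeE basis)//; apply: contrapT => /(cb_cube (basis 0) (w u)).2.
- exact: rc_total cells 0.
have := measurable_bool_set (measurable_cell_obs (basis 0) None).
by congr measurable; apply/seteqP; split => v /= /eqP.
Qed.

(** By the Riesz identity the integral against omega is a moment of the data, so that
   alp itself serves as the multiplier. *)
Let m_derivE (g : r.-tuple R -> R) c : measurable_fun setT g -> (forall v, `|g v| <= c) ->
  \int[lambda]_(v in @cube R r) (omega v * g v) = E (fun u => alp (w u) * g (w u)).
Proof.
move=> mg gc; have g2 : L1 (fun u => g (w u) ^+ 2).
  by apply: (L1_bounded_sqr (c := c)) => //; exact: measurableT_comp.
have := congr1 fine (riesz.2 g mg g2); rewrite unlock -!/(Rintegral _ _ _) => <-.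
rewrite -[LHS](E_cst F0); apply: eq_Rintegral => u _; rewrite /m_deriv /cst.
rewrite [X in _ - X](_ : _ = 0) ?subr0//.
by rewrite /Rintegral integral0_eq// => v _; rewrite mulr0.
Qed.

Theorem derivative_expansion (sg sa beta0 : R) (gamma0 : r.-tuple R -> R) :
  cond_exp F0 w (@obs_y R r) gamma0 ->
  'E_F0[fun u => m_deriv omega u gamma0]%E = beta0%:E ->
  cond_exp_bounded F0 w (fun u => (obs_y u - gamma0 (w u)) ^+ 2) ->
  holder sg gamma0 -> holder sa omega -> holder sa f0 ->
  expansion z (fun n x => beta_hat_deriv ginv x (q n) omega) beta0
    (influence w (m_deriv omega) alp gamma0 beta0)
    (fun n => Delta_star r 0 sg sa K n + (K n)%:R `^ (- zeta r 0 sg) * ln n%:R).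
Proof.
move=> gamP betaE varP hgam ho hf.
have [Co Co0 oC] := holder_bounded ho.
have [Cg Cg0 gC] := holder_bounded hgam.
have [Ao Ao0 oA] := holder_cells basis ho.
have [Af Af0 fA] := holder_cells basis hf.
have [mf _ [c [C [c0 fc]]]] := hf0.
have {}fc v : cube v -> c <= f0 v by move=> /fc/andP[].
have pos v : cube v -> 0 < f0 v by move=> /fc; exact: lt_le_trans.
have malpw : measurable_fun setT (fun u : obs R r => alp (w u)) by exact: measurableT_comp.
have alpC v : cube v -> `|alp v| <= Co / c.
  move=> vc; rewrite normrM normfV (gtr0_norm (pos v vc)); apply: ler_pM => //.
  - by rewrite invr_ge0 ltW ?pos.
  - exact: oC.
  - by rewrite lef_pV2 ?posrE ?pos ?fc.
have Ca0 : 0 <= Co / c by rewrite divr_ge0 ?(ltW c0).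
have Aa0 : 0 <= Ao / c + Co * Af / c ^+ 2.
  by rewrite addr_ge0 ?divr_ge0 ?mulr_ge0 ?sqr_ge0 ?(ltW c0).
have [] := @full_design (fun u => alp (w u)) gamma0
    alp sg sa (Co / c) ((Co / c) ^+ 2) (Ao / c + Co * Af / c ^+ 2) gamP varP hgam malpw malp
    Ca0 Aa0 alpC.
- move=> n v v' k vk v'k.
  have vc := cell_cube basis vk; have v'c := cell_cube basis v'k.
  have -> : alp v - alp v' = (omega v - omega v') * (f0 v)^-1 +
      omega v' * (f0 v' - f0 v) * (f0 v * f0 v')^-1.
    by rewrite /alp; field; rewrite !gt_eqF ?pos.
  apply: le_trans (ler_normD _ _) _; rewrite [leRHS]mulrDl; apply: lerD.
    rewrite normrM normfV (gtr0_norm (pos v vc)) mulrAC; apply: ler_pM => //.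
    + by rewrite invr_ge0 ltW ?pos.
    + exact: oA vk v'k.
    + by rewrite lef_pV2 ?posrE ?pos ?fc.
  rewrite normrM normfV (gtr0_norm (mulr_gt0 (pos v vc) (pos v' v'c))) mulrAC.
  apply: ler_pM => //; first by rewrite invr_ge0 ltW// mulr_gt0 ?pos.
    by rewrite normrM -mulrA; apply: ler_pM => //; [exact: oC|exact: fA v'k vk].
  rewrite lef_pV2 ?posrE ?exprn_gt0 ?mulr_gt0 ?pos//.
  by rewrite expr2; apply: ler_pM; rewrite ?(ltW c0) ?fc.
- exact: riesz.1.
- move=> Q mQ.
  have iQ := L1_event mQ; have mQw := L1_measurable iQ.
  have -> : E (fun u => ind (Q (w u)) * alp (w u) ^+ 2) =
      E (fun u => ind (Q (w u)) * (on_cube cell (w u) * alp (w u)) ^+ 2).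
    rewrite /Rintegral; congr fine; apply: ae_eq_integral => //.
    + by apply/measurable_EFinP; apply: measurable_funM => //; exact: measurable_funX.
    + apply/measurable_EFinP; apply: measurable_funM => //; apply: measurable_funX.
      apply: measurable_funM => //.
      exact: (measurableT_comp (measurable_on_cube basis) mw).
    + by apply: filterS cube_ae => u -> _; rewrite mul1r.
  have alp_le u : `|on_cube cell (w u) * alp (w u)| <= Co / c.
    have [uc|uc] := pselect (cube (w u)).
      by rewrite (on_cubeE basis)// mul1r alpC.
    by rewrite (on_cube_out basis)// mul0r normr0.
  have mcut : measurable_fun setT (fun u : obs R r => on_cube cell (w u) * alp (w u)).
    apply: measurable_funM => //.
    exact: (measurableT_comp (measurable_on_cube basis) mw).
  rewrite -EZ//; apply: E_le; [|exact: L1Z|].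
    by apply: L1_ind_mul => //; exact: (L1_bounded_sqr (c := Co / c)).
  move=> u; rewrite mulrC ler_wpM2r// -[leLHS]real_normK ?num_real//.
  by rewrite lerXn2r ?nnegrE.
- by [].
move=> Ce [Cg' [Ag [Ag0 design]]].
have betaV u : m_deriv omega u gamma0 = beta0.
  have := congr1 fine betaE; rewrite unlock -!/(Rintegral _ _ _) /= => <-.
  by rewrite -[LHS](E_cst F0); apply: eq_Rintegral.
have cutE : E (fun u => alp (w u) * (on_cube cell (w u) * gamma0 (w u))) = beta0.
  rewrite -(betaV point) -(@m_derivE (fun v => on_cube cell v * gamma0 v) Cg).
  - apply: eq_Rintegral => v; rewrite inE => vc.
    by rewrite (on_cubeE basis)// mul1r.
  - apply: measurable_funM; first exact: measurable_on_cube basis.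
    by have [] := gamP.
  - move=> v; have [vc|vc] := pselect (cube v).
      by rewrite (on_cubeE basis)// mul1r gC.
    by rewrite (on_cube_out basis)// mul0r normr0.
have cellE n k : \int[lambda]_(v in @cube R r) (omega v * q n v k 0) =
    sc k * E (fun u => ind (incell (cellw n) k u) * alp (w u)).
  have -> : (\int[lambda]_(v in @cube R r) (omega v * q n v k 0)) =
      \int[lambda]_(v in @cube R r) (omega v * (sc k * ind (cell n v == Some k))).
    by apply: eq_Rintegral => v _; rewrite (cb_basis (basis n)).
  rewrite (@m_derivE (fun v => sc k * ind (cell n v == Some k)) `|sc k|).
  - rewrite -EZ; first by apply: eq_Rintegral => u _; rewrite /incell; ring.
    apply: L1_ind_mul; first exact: (measurable_cell_obs (basis n) (Some k)).
    exact: L1_sqr malpw riesz.1.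
  - by apply: measurable_funM => //; exact: cb_measurable (basis n) _.
  - by move=> v; rewrite normrM ler_piMr// normr_nat; case: (_ == _); rewrite ?ler01.
apply: (plugin_regressogram (gam := gamma0) (alp := alp) Ag0 Aa0 _ design) => //.
move=> n t n0 M0.
have -> : beta_hat_deriv ginv (fun i : 'I_n => z i t) (q n) omega =
    \sum_k E (fun u => ind (incell (cellw n) k u) * alp (w u)) *
       cell_mean z (cellw n) xpredT (@obs_y R r) [set: 'I_n]%SET k t.
  transitivity (\sum_k (\col_k \int[lambda]_(v in @cube R r) (omega v * q n v k 0)) k 0 / sc k *
      cell_mean z (cellw n) xpredT (@obs_y R r) [set: 'I_n]%SET k t).
    rewrite -(regressogram ginvP (basis n) (@sc_neq0 n) _
      (oner_neq0 R) M0).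
    rewrite /beta_hat_deriv /gram /cross !scale1r; congr ((_ *m ginv _ *m _) 0 0).
      by apply: eq_bigr => i _; rewrite scale1r.
    by apply: eq_bigr => i _; rewrite mul1r.
  by apply: eq_bigr => k _; rewrite mxE cellE [sc k * _]mulrC mulfK// sc_neq0.
rewrite cutE; set S := \sum_k _.
have nK : n%:R^-1 * (n%:R * S) = S by rewrite mulKf// pnatr_eq0 -lt0n.
rewrite -{1}nK root_scaling//; congr (_ * _).
rewrite mulrBr -addrA -opprD; congr (_ - _).
rewrite big_split/= sumr_const card_ord mulr_natl; congr (_ + _).
apply: eq_bigr => i _; rewrite /influence (_ : m_deriv omega (z i t) gamma0 = beta0) ?subrr ?add0r ?mul1r//.
Qed.

End average_derivative.

End regressogram_estimators.

Theorem corollary3 (R : realType)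
    (d : measure_display) (Omega : measurableType d) (P : probability Omega R)
    (r : nat) (r_gt0 : (0 < r)%N)
    (F0 : probability (obs R r) R) (z : nat -> {RV P >-> obs R r})
    (z_iid : iid F0 z)
    (L : nat) (L_ge2 : (2 <= L)%N) (I : forall n, 'I_L -> {set 'I_n})
    (f0 : r.-tuple R -> R)
    (kappa : nat) (K : nat -> nat) (q : forall n, r.-tuple R -> 'cV[R]_(K n))
    (ginv : forall k, 'M[R]_k -> 'M[R]_k)
    (s_gamma s_alpha : R)
    (ginvP : is_ginv ginv)
    (hB2 : balanced_partition R I)
    (hB3i : cube_density F0 f0) (hB3ii : tensor_bsplines kappa q) (hB3iii : normalized_basis F0 q)
    (hK : (fun n => (K n)%:R : R) @ \oo --> +oo)
    (hKlnK : (fun n => (K n)%:R * ln (K n)%:R / n%:R : R) @ \oo --> (0 : R))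
    (hkappa : kappa = 0%N)
    (hKlnn : (fun n => (K n)%:R * ln n%:R ^+ 2 / n%:R : R) @ \oo --> (0 : R)) :
  let rate n : R :=
    Delta_star r kappa s_gamma s_alpha K n +
    (K n)%:R `^ (- zeta r kappa s_gamma) * ln n%:R in
  [/\ (* expected conditional covariance *)
      forall (gamma0 abar cov : r.-tuple R -> R) (beta0 : R),
        let w := @obs_w R r in
        let alpha0 u := - abar u in
        cond_exp F0 w (@obs_y R r) gamma0 ->
        cond_exp F0 w (@obs_a R r) abar ->
        cond_exp F0 w (fun u => (obs_a u - abar (w u)) * (obs_y u - gamma0 (w u))) cov ->
        'E_F0[fun u => cov (w u)]%E = beta0%:E ->
        riesz_representer F0 w (@m_cov R r) alpha0 ->
        cond_exp_bounded F0 w (fun u => (obs_y u - gamma0 (w u)) ^+ 2) ->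
        holder s_gamma gamma0 ->
        holder s_alpha abar ->
        cond_exp_bounded F0 w (fun u => obs_a u ^+ 2) ->
        expansion z (fun n x => beta_hat_cov ginv (I n) x (q n)) beta0
          (influence w (@m_cov R r) alpha0 gamma0 beta0) rate,
      (* missing data mean *)
      forall (Y : nat -> {RV P >-> R}) (gamma0 : R * r.-tuple R -> R)
             (pi0 : r.-tuple R -> R) (beta0 : R),
        let w := @obs_w R r in
        let x := @obs_aw R r in
        let alpha0 u := u.1 / pi0 u.2 in
        (forall i o, obs_a (z i o) = 0 \/ obs_a (z i o) = 1) ->
        (forall i o, obs_y (z i o) = obs_a (z i o) * Y i o) ->
        (forall i, exists g h,
           [/\ cond_exp P (fun o => x (z i o)) (Y i) g,
               cond_exp P (fun o => w (z i o)) (Y i) h &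
               forall u, g (1, u) = h u]) ->
        (forall i, 'E_P[Y i]%E = beta0%:E) ->
        cond_exp F0 x (@obs_y R r) gamma0 ->
        cond_exp F0 w (fun u => (obs_a u == 1)%:R) pi0 ->
        riesz_representer F0 x (@m_missing R r) alpha0 ->
        (exists C : R, {ae F0, forall u, `|obs_a u| <= C}) ->
        cond_exp_bounded_away0 F0 w (fun u => obs_a u ^+ 2) ->
        cond_exp_bounded F0 x (fun u => (obs_y u - gamma0 (x u)) ^+ 2) ->
        holder s_gamma (fun u => gamma0 (1, u)) ->
        (exists2 c : R, 0 < c & forall u, cube u -> c <= pi0 u) ->
        holder s_alpha pi0 ->
        expansion z (fun n x => beta_hat_missing ginv (I n) x (q n)) beta0
          (influence x (@m_missing R r) alpha0 gamma0 beta0) rate &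
      (* average derivative *)
      forall (gamma0 dgamma0 v omega : r.-tuple R -> R) (beta0 : R),
        let w := @obs_w R r in
        let lambda := lebesgue_tuple R r in
        let alpha0 u := omega u / f0 u in
        let x1 := Ordinal r_gt0 in
        cond_exp F0 w (@obs_y R r) gamma0 ->
        has_partial x1 gamma0 dgamma0 ->
        measurable_fun setT v ->
        measurable_fun setT omega ->
        lambda.-integrable (@cube R r) (EFin \o v) ->
        \int[lambda]_(u in @cube R r) v u = 1 ->
        (forall u, cube u -> ~ open_cube u -> v u = 0) ->
        has_partial x1 v (fun u => - omega u) ->
        lambda.-integrable (@open_cube R r) (EFin \o (fun u => v u * dgamma0 u)) ->
        \int[lambda]_(u in @open_cube R r) (v u * dgamma0 u) = beta0 ->
        'E_F0[fun u => m_deriv omega u gamma0]%E = beta0%:E ->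
        riesz_representer F0 w (m_deriv omega) alpha0 ->
        cond_exp_bounded F0 w (fun u => (obs_y u - gamma0 (w u)) ^+ 2) ->
        holder s_gamma gamma0 ->
        holder s_alpha omega ->
        holder s_alpha f0 ->
        (exists2 c : R, 0 < c & forall u, cube u -> 0 < omega u -> c <= f0 u) ->
        expansion z (fun n x => beta_hat_deriv ginv x (q n) omega) beta0
          (influence w (m_deriv omega) alpha0 gamma0 beta0) rate].
Proof.
subst kappa => rate.
have [cell [sc [Cw [c3 cells]]]] := regression_cells_exist hB3i hB3ii hB3iii.
split.
- move=> gamma0 abar cov beta0 w alpha0 gamP aP _ _ riesz varP hgam ha avarP.
  exact: (covariance_expansion z_iid cells hK hKlnK ginvP L_ge2 hB2 beta0 gamP aP riesz varP hgam ha avarP).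
- move=> Y gamma0 pi0 beta0 w x alpha0 a01 _ _ _ gamP piP riesz _ _ varP hgam pic hpi.
  exact: (missing_expansion z_iid cells hK hKlnK ginvP L_ge2 hB2 a01 beta0 gamP piP riesz varP hgam pic hpi).
move=> gamma0 dgamma0 v omega beta0 w lambda alpha0 x1 gamP _ _ momega _ _ _ _ _ _ betaE riesz
  varP hgam ho hf _.
exact: (derivative_expansion z_iid cells hK hKlnK ginvP hB3i momega riesz gamP betaE varP hgam ho hf).
Qed.
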